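(* Let $m\ge1$, $\kappa=(k_1,\dots,k_m)\in\mathbb R^m$, $\tau=(t_1,\dots,t_m)\in\mathbb R^m$ and $\boldsymbol\Sigma\in\boldsymbol\Phi_m^\beta$. Let $\mathbf X_1$ and $\mathbf X_2$ be independent random matrices with Riesz distributions of type I, $\mathbf X_1\sim\mathfrak R_m^{\beta,I}(a,\kappa,\boldsymbol\Sigma)$ and $\mathbf X_2\sim\mathfrak R_m^{\beta,I}(b,\tau,\boldsymbol\Sigma)$, with $\mathrm{Re}(a)>(m-1)\beta/2+k_1$ and $\mathrm{Re}(b)>(m-1)\beta/2+t_1$. Let $\mathbf U$ be the upper triangular $m\times m$ matrix over $\mathfrak A$ with positive diagonal entries such that $\mathbf X_1+\mathbf X_2=\mathbf U^*\mathbf U$, and let $$\mathbf S=(\mathbf U^* )^{-1}\,\mathbf X_1\,\mathbf U^{-1}.$$ Then $\mathbf S$ and $\mathbf X_1+\mathbf X_2$ are independent, $\mathbf S$ has a $c$-beta-Riesz distribution of type I with parameters $(a,\kappa;b,\tau)$, and $\mathbf X_1+\mathbf X_2\sim\mathfrak R_m^{\beta,I}(a+b,\kappa+\tau,\boldsymbol\Sigma)$.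
   Context: Let $\mathfrak A$ be $\mathbb R$, $\mathbb C$ or the quaternions $\mathbb H$, and $\beta=\dim_{\mathbb R}\mathfrak A\in\{1,2,4\}$. $\mathbf A^*$ is the conjugate transpose. $\mathfrak S_m^\beta$ is the real vector space of Hermitian $m\times m$ matrices over $\mathfrak A$ and $\mathfrak P_m^\beta\subset\mathfrak S_m^\beta$ the open cone of positive definite ones; $\mathbf A<\mathbf B$ means $\mathbf B-\mathbf A\in\mathfrak P_m^\beta$. For Hermitian $\mathbf S$, $|\mathbf S|$ is the determinant, i.e. the product of its $m$ real eigenvalues; $\mathrm{tr}$ denotes the real part of the trace. $(d\mathbf S)$ is the Lebesgue measure $\prod_i ds_{ii}\prod_{i<j}\prod_{k=1}^\beta ds_{ij}^{(k)}$ on $\mathfrak S_m^\beta$, where $s_{ij}^{(k)}$ are the real components of $s_{ij}$. For $\kappa\in\mathbb R^m$ and $\mathbf S\in\mathfrak P_m^\beta$: $q_\kappa(\mathbf S)=|\mathbf S|^{k_m}\prod_{i=1}^{m-1}|\mathbf S_i|^{k_i-k_{i+1}}$, with $\mathbf S_i$ the leading principal $i\times i$ submatrix. $\Gamma_m^\beta[a,\kappa]=\int_{\mathfrak P_m^\beta}e^{-\mathrm{tr}\,\mathbf A}|\mathbf A|^{a-(m-1)\beta/2-1}q_\kappa(\mathbf A)(d\mathbf A)$. $\boldsymbol\Phi_m^\beta=\mathfrak P_m^\beta+i\,\mathfrak S_m^\beta$ is the generalised right half-plane in the complexification of $\mathfrak S_m^\beta$; for $\boldsymbol\Sigma\in\boldsymbol\Phi_m^\beta$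 the expressions $\boldsymbol\Sigma^{-1}$, $|\boldsymbol\Sigma|^a$, $q_\kappa(\boldsymbol\Sigma)$, $\mathrm{tr}(\boldsymbol\Sigma^{-1}\mathbf X)$ are the holomorphic extensions in $\boldsymbol\Sigma$ of the corresponding expressions on $\mathfrak P_m^\beta$. $\mathbf X\sim\mathfrak R_m^{\beta,I}(a,\kappa,\boldsymbol\Sigma)$ (Riesz distribution of type I) means that $\mathbf X$ has probability density $\dfrac{\beta^{am+\sum_i k_i}}{\Gamma_m^\beta[a,\kappa]|\boldsymbol\Sigma|^aq_\kappa(\boldsymbol\Sigma)}e^{-\beta\,\mathrm{tr}(\boldsymbol\Sigma^{-1}\mathbf X)}|\mathbf X|^{a-(m-1)\beta/2-1}q_\kappa(\mathbf X)$ on $\mathfrak P_m^\beta$ with respect to $(d\mathbf X)$ (parameters being such that this is a probability density). $\mathbf S$ has a $c$-beta-Riesz distribution of type I with parameters $(a,\kappa;b,\tau)$ if its density on $\{\mathbf 0<\mathbf S<\mathbf I_m\}$ with respect to $(d\mathbf S)$ is $$\frac{1}{\mathcal B_m^\beta[a,\kappa;b,\tau]}|\mathbf S|^{a-(m-1)\beta/2-1}q_\kappa(\mathbf S)|\mathbf I_m-\mathbf S|^{b-(m-1)\beta/2-1}q_\tau(\mathbf I_m-\mathbf S),$$ where $\mathcal B_m^\beta[a,\kappa;b,\tau]$ is the integral of $|\mathbf S|^{a-(m-1)\beta/2-1}q_\kappa(\mathbf S)|\mathbf I_m-\mathbf S|^{b-(m-1)\beta/2-1}q_\tau(\mathbf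 I_m-\mathbf S)$ over $\mathbf 0<\mathbf S<\mathbf I_m$. *)

(* Defs.v *)
From HB Require Import structures.
From mathcomp Require Import all_boot all_order all_algebra.
From mathcomp Require Import all_classical all_reals all_analysis.
From mathcomp Require Import ring lra complex.

Set Implicit Arguments.
Unset Strict Implicit.
Unset Printing Implicit Defensive.

Import Order.TTheory GRing.Theory Num.Theory.
Import numFieldNormedType.Exports.

Local Open Scope classical_set_scope.
Local Open Scope ring_scope.

(* Quaternions x0 + x1 i + x2 j + x3 k with coefficients in K. For K = R this is
   H; for K = R[i] it is the complexification H (x)_R C, in which the scalar
   imaginary unit is central and distinct from the quaternion units. The
   algebras R, C and H are the subalgebras of quat R on which the components of
   index >= beta vanish, with beta = 1, 2, 4 (see in_beta). *)
Definition quat (K : Type) : Type := 'rV[K]_4.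

Section QuatZmodule.
Variable K : zmodType.
HB.instance Definition _ := GRing.Zmodule.on (quat K).
End QuatZmodule.

HB.instance Definition _ (K : pointedType) := Pointed.on (quat K).

Section QuatRing.
Variable K : comNzRingType.
Implicit Types x y z : quat K.

Definition mkq (a b c d : K) : quat K := \row_k [:: a; b; c; d]`_k.

Definition quat_mul x y : quat K :=
  let c k := x 0 (inord k) in let e k := y 0 (inord k) in
  mkq (c 0%N * e 0%N - c 1%N * e 1%N - c 2%N * e 2%N - c 3%N * e 3%N)
      (c 0%N * e 1%N + c 1%N * e 0%N + c 2%N * e 3%N - c 3%N * e 2%N)
      (c 0%N * e 2%N - c 1%N * e 3%N + c 2%N * e 0%N + c 3%N * e 1%N)
      (c 0%N * e 3%N + c 1%N * e 2%N - c 2%N * e 1%N + c 3%N * e 0%N).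

Let quatP x y : (forall k : 'I_4, x 0 (inord k) = y 0 (inord k)) -> x = y.
Proof. by move=> h; apply/rowP => k; rewrite -[k]inord_val. Qed.

Let mkqE a b c d (k : 'I_4) : mkq a b c d 0 (inord k) = [:: a; b; c; d]`_k.
Proof. by rewrite mxE inord_val. Qed.

Let mkqK a b c d k : (k < 4)%N -> mkq a b c d 0 (inord k) = [:: a; b; c; d]`_k.
Proof. by move=> k4; rewrite mxE inordK. Qed.

Let mulqA : associative quat_mul.
Proof.
move=> x y z; apply: quatP => k; rewrite !mkqE !mkqK//.
by case: k => [[|[|[|[|]]]]] //= _; ring.
Qed.

Let mul1q : left_id (mkq 1 0 0 0) quat_mul.
Proof.
move=> x; apply: quatP => k; rewrite mkqE !mkqK//.
by case: k => [[|[|[|[|]]]]] //= _; ring.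
Qed.

Let mulq1 : right_id (mkq 1 0 0 0) quat_mul.
Proof.
move=> x; apply: quatP => k; rewrite mkqE !mkqK//.
by case: k => [[|[|[|[|]]]]] //= _; ring.
Qed.

Let mulqDl : left_distributive quat_mul +%R.
Proof.
move=> x y z; apply: quatP => k; rewrite [RHS]mxE !mkqE ![(x + y) _ _]mxE.
by case: k => [[|[|[|[|]]]]] //= _; ring.
Qed.

Let mulqDr : right_distributive quat_mul +%R.
Proof.
move=> x y z; apply: quatP => k; rewrite [RHS]mxE !mkqE ![(y + z) _ _]mxE.
by case: k => [[|[|[|[|]]]]] //= _; ring.
Qed.

Let oneq_neq0 : mkq 1 0 0 0 != 0.
Proof.
apply/eqP => /rowP/(_ ord0); rewrite !mxE /= => /eqP; by rewrite oner_eq0.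
Qed.

HB.instance Definition _ := GRing.Zmodule_isNzRing.Build (quat K)
  mulqA mul1q mulq1 mulqDl mulqDr oneq_neq0.
End QuatRing.

Definition measure_matrix_display : measure_display -> measure_display.
Proof. exact. Qed.

Section MeasurableMatrix.
Context {d} {T : measurableType d}.
Variables m n : nat.

Definition g_sigma_entries : set (set 'M[T]_(m, n)) :=
  <<s \bigcup_(p in [set: 'I_m * 'I_n])
        preimage_set_system setT (fun A : 'M[T]_(m, n) => A p.1 p.2)
          measurable >>.

Let entries_set0 : g_sigma_entries set0.
Proof. exact: sigma_algebra0. Qed.

Let entries_setC A : g_sigma_entries A -> g_sigma_entries (~` A).
Proof. exact: sigma_algebraC. Qed.

Let entries_bigcup (F : _^nat) : (forall i, g_sigma_entries (F i)) ->
  g_sigma_entries (\bigcup_i (F i)).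
Proof. exact: sigma_algebra_bigcup. Qed.

HB.instance Definition _ := @isMeasurable.Build (measure_matrix_display d)
  'M[T]_(m, n) g_sigma_entries entries_set0 entries_setC entries_bigcup.

Lemma measurable_fun_entries d1 (T1 : measurableType d1)
    (f : T1 -> 'M[T]_(m, n)) :
  (forall i j, measurable_fun setT (fun t => f t i j)) ->
  measurable_fun setT f.
Proof.
move=> mf; pose G := \bigcup_(p in [set: 'I_m * 'I_n])
  preimage_set_system setT (fun A : 'M[T]_(m, n) => A p.1 p.2) measurable.
apply: (measurability G) => // _ [_ [[i j] _ [C mC <-]] <-].
rewrite !setTI -comp_preimage -[X in measurable X]setTI.
exact: (mf i j).
Qed.

End MeasurableMatrix.

HB.instance Definition _ d (T : measurableType d) :=
  Measurable.on (quat T).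

Section LebesgueTuple.
Variable R : realType.
Local Notation RR := (measurableTypeR R).

Definition tcons n (p : RR * n.-tuple RR) : n.+1.-tuple RR :=
  [the n.+1.-tuple RR of p.1 :: p.2].

Lemma measurable_tcons n : measurable_fun setT (@tcons n).
Proof. exact: measurable_cons. Qed.

Section Step.
Variables (n : nat) (mu : {sigma_finite_measure set (n.-tuple RR) -> \bar R}).

(* (n+1)-fold product measure, obtained from the binary one. *)
Definition lebesgue_step : set (n.+1.-tuple RR) -> \bar R :=
  pushforward (@lebesgue_measure R \x mu)%E (@tcons n).

Let step_measure : {measure set (n.+1.-tuple RR) -> \bar R} :=
  measure_function_pushforward__canonical__measure_function_Measure
    (@lebesgue_measure R \x mu)%E (@measurable_tcons n).

Let step0 : lebesgue_step set0 = 0%E.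
Proof. exact: (@measure0 _ _ _ step_measure). Qed.

Let step_ge0 A : (0 <= lebesgue_step A)%E.
Proof. exact: (@measure_ge0 _ _ _ step_measure). Qed.

Let step_sigma_additive : semi_sigma_additive lebesgue_step.
Proof. exact: (@measure_semi_sigma_additive _ _ _ step_measure). Qed.

HB.instance Definition _ := isMeasure.Build _ _ _ lebesgue_step
  step0 step_ge0 step_sigma_additive.

Let step_sigma_finite : sigma_finite setT lebesgue_step.
Proof.
have /sigma_finiteP[F [FT ndF Foo]] := sigma_finiteT (@lebesgue_measure R).
have /sigma_finiteP[G [GT ndG Goo]] := sigma_finiteT mu.
pose g (t : n.+1.-tuple RR) : RR * n.-tuple RR :=
  (tnth t ord0, [tuple of behead t]).
have tconsK : cancel (@tcons n) g.
  by move=> [x t]; congr pair; apply/val_inj.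
have mg : measurable_fun setT g.
  apply/measurable_fun_pair; first exact: measurable_tnth.
  exact: measurable_behead.
exists (fun k => g @^-1` (F k `*` G k)).
  rewrite -preimage_bigcup (_ : \bigcup_k _ = setT) ?preimage_setT//.
  rewrite -subTset => -[x t] _.
  have [k _ Fkx] : (\bigcup_k F k) x by rewrite -FT.
  have [l _ Glt] : (\bigcup_l G l) t by rewrite -GT.
  exists (maxn k l) => //; split => /=.
    by move: x Fkx; exact/subsetPset/ndF/leq_maxl.
  by move: t Glt; exact/subsetPset/ndG/leq_maxr.
move=> k; have [mF Fk] := Foo k; have [mG Gk] := Goo k; split.
  by rewrite -[X in measurable X]setTI; apply: mg => //; exact: measurableX.
rewrite /lebesgue_step /pushforward -comp_preimage.
rewrite (_ : g \o @tcons n = id); last by apply/funext => p; exact: tconsK.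
rewrite preimage_id product_measure1E// lte_mul_pinfty//.
by rewrite ge0_fin_numE.
Qed.

HB.instance Definition _ := Measure_isSigmaFinite.Build _ _ _ lebesgue_step
  step_sigma_finite.
End Step.

Fixpoint lebesgue_tuple n : {sigma_finite_measure set (n.-tuple RR) -> \bar R} :=
  match n with
  | 0%N => \d_([tuple] : 0.-tuple RR)
  | n'.+1 => lebesgue_step (lebesgue_tuple n')
  end.

End LebesgueTuple.

Section Hermitian.
Variable K : comNzRingType.

(* Quaternion conjugation; it is K-linear, so over K = R[i] it is the complex
   linear extension of the conjugation of H. *)
Definition conjq (x : quat K) : quat K :=
  \row_k (if k == 0 then x 0 k else - x 0 k).

Definition conjtrq p q (A : 'M[quat K]_(p, q)) : 'M[quat K]_(q, p) :=
  map_mx conjq A^T.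

Definition sclq (c : K) : quat K := mkq c 0 0 0.

(* Real part of the trace; over K = R[i], its complex linear extension. *)
Definition retr p (A : 'M[quat K]_p) : K := (\tr A) 0 0.

Definition in_beta (beta : nat) (x : quat K) : Prop :=
  forall k : 'I_4, (beta <= k)%N -> x 0 k = 0.

Definition mx_beta (beta : nat) p q (A : 'M[quat K]_(p, q)) : Prop :=
  forall i j, in_beta beta (A i j).

(* Over K = R[i] these matrices form the complexification of the space of
   Hermitian matrices over R, C or H. *)
Definition hermmx (beta : nat) p (A : 'M[quat K]_p) : Prop :=
  mx_beta beta A /\ conjtrq A = A.

(* The ring quat K is not commutative (and quat R[i] is not a division ring), so
   invmx is not available. Junk value 0 for non-invertible matrices. *)
Definition mxinv p (A : 'M[quat K]_p) : 'M[quat K]_p :=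
  xget 0 [set B : 'M[quat K]_p | B *m A = 1%:M /\ A *m B = 1%:M].

End Hermitian.

(* Indices of the real coordinates of a Hermitian matrix: s_ii, and the
   components s_ij^(k), k < beta, of the entries above the diagonal. *)
Definition hcoord (beta m : nat) : finType :=
  {p : 'I_m * 'I_m * 'I_4 |
    [|| (p.1.1 == p.1.2) && (p.2 == ord0) |
        (p.1.1 < p.1.2)%N && (p.2 < beta)%N]}.

Section HermitianOfCoord.
Variables (beta m : nat).

Definition upper_entry (K : nmodType) (x : hcoord beta m -> K) (i j : 'I_m) :
    quat K :=
  \row_k oapp x 0 (insub (i, j, k)).

Definition herm_of (K : comNzRingType) (x : hcoord beta m -> K) :
    'M[quat K]_m :=
  \matrix_(i, j) if (i <= j)%N then upper_entry x i j
                 else conjq (upper_entry x j i).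

End HermitianOfCoord.

Section LebesgueHermitian.
Variables (R : realType) (beta m : nat).
Local Notation N := #|{: hcoord beta m}|.

Definition herm_of_tuple (t : N.-tuple (measurableTypeR R)) : 'M[quat R]_m :=
  herm_of (fun p : hcoord beta m => tnth t (enum_rank p) : R).

Lemma measurable_herm_of_tuple : measurable_fun setT herm_of_tuple.
Proof.
apply: measurable_fun_entries => i j; apply: measurable_fun_entries => z k.
have mu i' j' :
    measurable_fun setT (fun t : N.-tuple (measurableTypeR R) =>
      upper_entry (fun p : hcoord beta m => tnth t (enum_rank p) : R)
        i' j' z k : R).
  rewrite (_ : (fun t => _) = fun t => oapp (fun p : hcoord beta m =>
      tnth t (enum_rank p) : R) 0 (insub (i', j', k))); last first.
    by apply/funext => t; rewrite mxE.
  by case: insub => [p|] /=; [exact: measurable_tnth|exact: measurable_cst].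
rewrite (_ : (fun t => _) = fun t => if (i <= j)%N
    then upper_entry (fun p : hcoord beta m => tnth t (enum_rank p) : R) i j z k
    else if k == 0
    then upper_entry (fun p : hcoord beta m => tnth t (enum_rank p) : R) j i z k
    else - upper_entry (fun p : hcoord beta m => tnth t (enum_rank p) : R)
           j i z k); last first.
  by apply/funext => t; rewrite mxE; case: ifP => // _; rewrite mxE (ord1 z).
case: (i <= j)%N; first exact: mu.
by case: (k == 0); [exact: mu|exact: measurableT_comp].
Qed.

(* The measure (dS), seen as a measure on all m x m matrices that is carried by
   the Hermitian ones. *)
Definition lebesgue_herm : {measure set 'M[quat R]_m -> \bar R} :=
  measure_function_pushforward__canonical__measure_function_Measure
    (lebesgue_tuple R N) measurable_herm_of_tuple.

End LebesgueHermitian.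

Section Cone.
Variables (R : realType) (beta : nat).

Definition posdef m : set 'M[quat R]_m :=
  [set A | hermmx beta A /\
     forall x : 'cV[quat R]_m, mx_beta beta x -> x != 0 ->
       0 < (conjtrq x *m A *m x) 0 0 0 0].

(* The families of real eigenvalues, with multiplicity, given by the spectral
   decompositions of S; for S Hermitian over the algebra, any two of them agree
   up to a permutation. *)
Definition spectrum m (S : 'M[quat R]_m) : set 'rV[R]_m :=
  [set l | exists V : 'M[quat R]_m,
     [/\ mx_beta beta V, conjtrq V *m V = 1%:M, V *m conjtrq V = 1%:M &
         S = conjtrq V *m diag_mx (map_mx (@sclq R) l) *m V]].

Definition hdet m (S : 'M[quat R]_m) : R :=
  \prod_i (xget 0 (spectrum S)) 0 i.

(* The leading principal submatrix of size i + 1. *)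
Definition leadmx m (S : 'M[quat R]_m) (i : 'I_m) : 'M[quat R]_i.+1 :=
  mxsub (widen_ord (ltn_ord i)) (widen_ord (ltn_ord i)) S.

Definition qpow n (kappa : 'rV[R]_n.+1) (S : 'M[quat R]_n.+1) : R :=
  hdet S `^ kappa 0 ord_max *
  \prod_(i < n) hdet (leadmx S (widen_ord (leqnSn n) i)) `^
    (kappa 0 (widen_ord (leqnSn n) i) - kappa 0 (lift ord0 i)).

End Cone.

Definition herm_of_row (K : comNzRingType) beta m
    (z : 'rV[K]_#|{: hcoord beta m}|) : 'M[quat K]_m :=
  herm_of (fun p : hcoord beta m => z 0 (enum_rank p)).

(* Differentiability over K of F in the coordinates of (complexified) Hermitian
   matrices; used with K = R[i]. *)
Definition holomorphic_on (K : numFieldType) beta m (D : set 'M[quat K]_m)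
    (F : 'M[quat K]_m -> K) : Prop :=
  forall z : 'rV[K]_#|{: hcoord beta m}|, D (herm_of_row z) ->
    differentiable ((F \o @herm_of_row K beta m) : 'rV[K]__ -> K^o) z.

Section Complex.
Variable R : realType.
Local Open Scope complex_scope.

Definition cexp (z : R[i]) : R[i] :=
  (expR (complex.Re z))%:C *
  (cos (complex.Im z) +i* sin (complex.Im z)).

(* x^a for x > 0. *)
Definition cpow (x : R) (a : R[i]) : R[i] := cexp (a * (ln x)%:C).

Definition cintegral d (T : measurableType d) (mu : {measure set T -> \bar R})
    (D : set T) (f : T -> R[i]) : R[i] :=
  (\int[mu]_(x in D) complex.Re (f x)) +i* (\int[mu]_(x in D) complex.Im (f x)).

(* A + i B *)
Definition complexify m (A B : 'M[quat R]_m) : 'M[quat R[i]]_m :=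
  map2_mx (fun a b : quat R => map2_mx (@Complex R) a b : quat R[i]) A B.

Definition half_plane (beta m : nat) : set 'M[quat R[i]]_m :=
  [set Z | exists A B, [/\ posdef beta A, hermmx beta B &
                           Z = complexify A B]].

(* The holomorphic extension to half_plane of a function f on positive definite
   matrices; on half_plane it is unique by the identity theorem. *)
Definition holo_ext (beta m : nat) (f : 'M[quat R]_m -> R[i]) :
    'M[quat R[i]]_m -> R[i] :=
  xget (fun=> 0) [set F | holomorphic_on beta (@half_plane beta m) F /\
    forall S, posdef beta S -> F (complexify S 0) = f S].

End Complex.

Section Riesz.
Variables (R : realType) (beta n : nat).
Local Notation m := n.+1.
Local Notation mat := 'M[quat R]_m.
Local Notation mu := (lebesgue_herm R beta m).
Local Open Scope complex_scope.

(* (m - 1) beta / 2 + 1 with m = n + 1. *)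
Definition dim_ratio : R[i] := n%:R * beta%:R / 2 + 1.

Definition gammaR (a : R[i]) (kappa : 'rV[R]_m) : R[i] :=
  cintegral mu (posdef beta (m:=m)) (fun A =>
    cexp (- (retr A)%:C) * cpow (hdet beta A) (a - dim_ratio) *
    (qpow beta kappa A)%:C).

(* Sigma^-1 is the inverse in the complexified matrix algebra. Its entries, hence
   also tr (Sigma^-1 X), are rational in Sigma without pole on half_plane, so it
   is the holomorphic extension of the inverse of positive definite matrices. *)
Definition riesz_density (a : R[i]) (kappa : 'rV[R]_m)
    (Sigma : 'M[quat R[i]]_m) (X : mat) : R[i] :=
  cpow beta%:R (a * m%:R + (\sum_i kappa 0 i)%:C) /
    (gammaR a kappa *
     holo_ext beta (fun S => cpow (hdet beta S) a) Sigma *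
     holo_ext beta (fun S => (qpow beta kappa S)%:C) Sigma) *
  cexp (- (beta%:R * retr (mxinv Sigma *m complexify X 0))) *
  cpow (hdet beta X) (a - dim_ratio) *
  (qpow beta kappa X)%:C.

Definition unit_interval : set mat :=
  [set S | posdef beta S /\ posdef beta (1%:M - S)].

Definition beta_kernel (a : R[i]) (kappa : 'rV[R]_m) (b : R[i])
    (tau : 'rV[R]_m) (S : mat) : R[i] :=
  cpow (hdet beta S) (a - dim_ratio) * (qpow beta kappa S)%:C *
  cpow (hdet beta (1%:M - S)) (b - dim_ratio) * (qpow beta tau (1%:M - S))%:C.

Definition betaR a kappa b tau : R[i] :=
  cintegral mu unit_interval (beta_kernel a kappa b tau).

Definition beta_density a kappa b tau (S : mat) : R[i] :=
  (betaR a kappa b tau)^-1 * beta_kernel a kappa b tau S.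

Section Laws.
Context d (T : measurableType d) (P : probability T R).

(* X has a probability density f on D. The formulas for the densities are complex
   valued because the parameters are; in R[i] the order 0 <= z means that z is
   real and nonnegative. Total mass 1 is the case A = setT. *)
Definition has_density (X : T -> mat) (D : set mat) (f : mat -> R[i]) : Prop :=
  [/\ measurable_fun setT X,
      measurable_fun D (fun S => complex.Re (f S)),
      forall S, D S -> 0 <= f S &
      forall A, measurable A ->
        P (X @^-1` A) = (\int[mu]_(S in A `&` D) (complex.Re (f S))%:E)%E].

Definition riesz (X : T -> mat) a kappa Sigma : Prop :=
  has_density X (posdef beta (m:=m)) (riesz_density a kappa Sigma).

Definition beta_riesz (S : T -> mat) a kappa b tau : Prop :=
  has_density S unit_interval (beta_density a kappa b tau).

Definition independent (X Y : T -> mat) : Prop :=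
  forall A B, measurable A -> measurable B ->
    P (X @^-1` A `&` Y @^-1` B) = (P (X @^-1` A) * P (Y @^-1` B))%E.

End Laws.

Definition is_cholesky (Y U : mat) : Prop :=
  [/\ mx_beta beta U,
      forall i j : 'I_m, (j < i)%N -> U i j = 0,
      (forall i, exists2 u : R, 0 < u & U i i = sclq u) &
      Y = conjtrq U *m U].

(* The Cholesky factor is unique when Y is positive definite, and does not exist
   otherwise; the junk value then is the identity. *)
Definition cholesky (Y : mat) : mat := xget 1%:M [set U | is_cholesky Y U].

End Riesz.

(* Main.v *)
From HB Require Import structures.
Require Import Defs.
From mathcomp Require Import all_boot all_order all_algebra.
From mathcomp Require Import all_classical all_reals all_analysis.
From mathcomp Require Import measurable_realfun ring lra complex.

(** Write the law of a Riesz matrix with real parameters as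
    c exp (- ell X) k(X) on the positive definite cone, where ell is linear and
    k = |X|^al q_kappa(X). Two facts do most of the work. First, k is a character
    for triangular congruences, k(U* S U) = k(S) k(U* U) ([powker_congr]), and k
    for (al, kappa) times k for (be, tau) is k for the sums of the parameters
    ([powkerM]). Second, the congruence S |-> U* S U multiplies Lebesgue measure
    by |U* U| to the power (m - 1) beta / 2 + 1 ([integral_congr]). Change
    variables from (X1, X2) to (X1, Y) with Y = X1 + X2, then, for fixed Y = U* U,
    from X1 to S with X1 = U* S U. The exponentials combine to exp (- ell Y), and
    the joint density becomes a function of Y times the beta kernel in S, which is
    [law_split]; independence and both laws up to constants follow.

    The constant of Y must be the one in the Riesz density. The two factors have
    total mass 1 together, so both integrals are finite and positive, and the
    congruence by the Cholesky factor of Sigma / beta expresses the integral of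
    the kernel of Y by the gamma function ([gamma_scale]).

    The parameters of the densities are complex, but a probability density is
    nonnegative. Along a ray t X the phase of a Riesz density is the exponential
    of i times an affine function of t plus a multiple of log t; it is constant
    only if both coefficients vanish ([constant_phase], [riesz_phase]). So a and b
    are real, and tr (Sigma^-1 X) is real on the cone; diagonalising the real and
    imaginary parts of Sigma together, this puts Sigma itself in the cone
    ([real_half_plane]). A total mass of 1 also excludes the value 0 which
    [holo_ext] takes when no extension exists, hence the extensions exist,
    products of them serve for the parameters a + b and kappa + tau
    ([holo_ext_mul]), and at a point of the cone their values are forced.

    The rest is linear algebra over R, C and H inside the quaternions. The
    determinant is a product of eigenvalues taken from an arbitrary spectral
    decomposition. One exists because the symmetric real matrix of size 4 m
    representing a Hermitian matrix has a real eigenvalue, after which a reflection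
    splits off one dimension ([spectral_herm]). The fourth power of the determinant
    is the determinant of the real representation ([hdetP]), whence its behaviour
    under congruences ([hdet_congr]). The Cholesky factor is computed by Schur
    complements ([cholP]), which gives its uniqueness, its measurability and a test
    for positive definiteness ([posdefP]). *)

Set Implicit Arguments.
Unset Strict Implicit.
Unset Printing Implicit Defensive.

Import Order.TTheory GRing.Theory Num.Theory.
Import numFieldNormedType.Exports.

Local Open Scope classical_set_scope.
Local Open Scope ring_scope.

(** * Quaternion matrices *)

Section QuatAlgebra.
Variable K : comNzRingType.
Implicit Types (x y : quat K) (c : K).

Lemma quatP x y : (forall k : 'I_4, x 0 k = y 0 k) -> x = y.
Proof. by move=> h; apply/rowP. Qed.

Lemma quat_mulE x y : x * y = quat_mul x y.
Proof. by []. Qed.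

(** Turns an identity between quaternions into four polynomial identities. *)
Lemma ord4P (P : 'I_4 -> Prop) : P (inord 0) -> P (inord 1) -> P (inord 2) ->
  P (inord 3) -> forall k, P k.
Proof.
move=> p0 p1 p2 p3 k; rewrite -[k]inord_val.
by case: k => [[|[|[|[|]]]]] //=.
Qed.

Lemma mkqE (a b c d : K) k : (k < 4)%N ->
  mkq a b c d 0 (inord k) = [:: a; b; c; d]`_k.
Proof. by move=> k4; rewrite mxE inordK. Qed.

Lemma quat_add0 x y i : (x + y) 0 i = x 0 i + y 0 i.
Proof. by rewrite mxE. Qed.

Lemma mulq0E x y : (x * y) 0 (inord 0) =
  x 0 (inord 0) * y 0 (inord 0) - x 0 (inord 1) * y 0 (inord 1)
  - x 0 (inord 2) * y 0 (inord 2) - x 0 (inord 3) * y 0 (inord 3).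
Proof. by rewrite quat_mulE mkqE. Qed.

Lemma mulq1E x y : (x * y) 0 (inord 1) =
  x 0 (inord 0) * y 0 (inord 1) + x 0 (inord 1) * y 0 (inord 0)
  + x 0 (inord 2) * y 0 (inord 3) - x 0 (inord 3) * y 0 (inord 2).
Proof. by rewrite quat_mulE mkqE. Qed.

Lemma mulq2E x y : (x * y) 0 (inord 2) =
  x 0 (inord 0) * y 0 (inord 2) - x 0 (inord 1) * y 0 (inord 3)
  + x 0 (inord 2) * y 0 (inord 0) + x 0 (inord 3) * y 0 (inord 1).
Proof. by rewrite quat_mulE mkqE. Qed.

Lemma mulq3E x y : (x * y) 0 (inord 3) =
  x 0 (inord 0) * y 0 (inord 3) + x 0 (inord 3) * y 0 (inord 0)
  + x 0 (inord 1) * y 0 (inord 2) - x 0 (inord 2) * y 0 (inord 1).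
Proof. by rewrite quat_mulE mkqE //=; ring. Qed.

Definition mulqE := (mulq0E, mulq1E, mulq2E, mulq3E).

Lemma inord4_0 : (0 : 'I_4) = inord 0.
Proof. by apply/val_inj; rewrite /= inordK. Qed.

Lemma conjqE x k : (k < 4)%N ->
  conjq x 0 (inord k) = if k == 0%N then x 0 (inord k) else - x 0 (inord k).
Proof. by move=> k4; rewrite mxE inord4_0 -val_eqE /= !inordK. Qed.

Lemma sclqE c k : (k < 4)%N ->
  sclq c 0 (inord k) = if k == 0%N then c else 0.
Proof. by move=> k4; rewrite mkqE//; case: k k4 => [|[|[|[|]]]]. Qed.

Lemma quat1E : (1 : quat K) = sclq 1.
Proof. by []. Qed.

Lemma sclq_mulE c x k : (sclq c * x) 0 k = c * x 0 k.
Proof. by elim/ord4P: k; rewrite mulqE !sclqE//=; ring. Qed.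

Lemma sclqC c x : sclq c * x = x * sclq c.
Proof. by apply: quatP; apply: ord4P; rewrite !mulqE !sclqE//=; ring. Qed.

Lemma sclq_is_zmod : zmod_morphism (@sclq K).
Proof.
by move=> c e; apply: quatP => k; elim/ord4P: k; rewrite !mxE !inordK//= ?subr0.
Qed.

Lemma sclq_is_monoid : monoid_morphism (@sclq K).
Proof.
split=> // c e; apply: quatP => k; rewrite sclq_mulE.
by elim/ord4P: k; rewrite !sclqE//= mulr0.
Qed.

HB.instance Definition _ := GRing.isZmodMorphism.Build K (quat K) (@sclq K)
  sclq_is_zmod.
HB.instance Definition _ := GRing.isMonoidMorphism.Build K (quat K) (@sclq K)
  sclq_is_monoid.

Lemma conjq_is_zmod : zmod_morphism (@conjq K).
Proof. by move=> x y; apply: quatP => k; rewrite !mxE; case: ifP => // _; ring. Qed.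

HB.instance Definition _ := GRing.isZmodMorphism.Build (quat K) (quat K)
  (@conjq K) conjq_is_zmod.

Lemma conjqK : involutive (@conjq K).
Proof.
by move=> x; apply: quatP => k; rewrite !mxE; case: (k == 0); rewrite ?opprK.
Qed.

Lemma conjqM x y : conjq (x * y) = conjq y * conjq x.
Proof.
by apply: quatP => k; elim/ord4P: k; rewrite conjqE// ?mulqE !conjqE//=; ring.
Qed.

Lemma conjq_scl c : conjq (sclq c) = sclq c.
Proof.
by apply: quatP => k; elim/ord4P: k; rewrite conjqE// ?mulqE !sclqE//= oppr0.
Qed.

Lemma conjq1 : conjq 1 = 1 :> quat K.
Proof. exact: conjq_scl. Qed.

Definition normq x : K := \sum_k x 0 k ^+ 2.

Lemma sum4 (F : 'I_4 -> K) :
  \sum_k F k = F (inord 0) + F (inord 1) + F (inord 2) + F (inord 3).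
Proof.
have e (k : 'I_4) (j : nat) : (j < 4)%N -> val k = j -> k = inord j.
  by move=> j4 kj; apply/val_inj; rewrite /= inordK.
rewrite !big_ord_recr big_ord0 /= add0r.
by congr (F _ + F _ + F _ + F _); apply: e.
Qed.

Lemma normqE x : normq x = x 0 (inord 0) ^+ 2 + x 0 (inord 1) ^+ 2 +
  x 0 (inord 2) ^+ 2 + x 0 (inord 3) ^+ 2.
Proof. exact: sum4. Qed.

Lemma conjq_mulr x : x * conjq x = sclq (normq x).
Proof.
by apply: quatP => k; elim/ord4P: k; rewrite mulqE !conjqE// sclqE//= ?normqE; ring.
Qed.

Lemma conjq_mull x : conjq x * x = sclq (normq x).
Proof.
by apply: quatP => k; elim/ord4P: k; rewrite mulqE !conjqE// sclqE//= ?normqE; ring.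
Qed.

Lemma mulq_conj0 x y : (x * conjq y) 0 0 = \sum_k x 0 k * y 0 k.
Proof. by rewrite inord4_0 mulqE !conjqE//= sum4; ring. Qed.

Lemma reqC x y : (x * y) 0 0 = (y * x) 0 0.
Proof. by rewrite inord4_0 !mulqE; ring. Qed.

Section Beta.
Variable beta : nat.
Hypothesis hbeta : beta \in [:: 1%N; 2%N; 4%N].

Lemma in_beta0 : in_beta beta (0 : quat K).
Proof. by move=> k _; rewrite mxE. Qed.

Lemma in_betaD x y : in_beta beta x -> in_beta beta y -> in_beta beta (x + y).
Proof. by move=> hx hy k kb; rewrite mxE hx ?hy ?addr0. Qed.

Lemma in_betaN x : in_beta beta x -> in_beta beta (- x).
Proof. by move=> hx k kb; rewrite mxE hx ?oppr0. Qed.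

Lemma in_beta_conj x : in_beta beta x -> in_beta beta (conjq x).
Proof. by move=> hx k kb; rewrite mxE hx// oppr0 if_same. Qed.

Lemma in_beta_scl c : in_beta beta (sclq c).
Proof.
have b0 : (0 < beta)%N by case: beta hbeta.
move=> k kb; rewrite -[k]inord_val sclqE ?inordK//; case: eqP => // k0.
by move: kb; rewrite k0 leqn0 => /eqP b; rewrite b in b0.
Qed.

(** The first one, two or four components span the subalgebras R, C and H. *)
Lemma in_betaM x y : in_beta beta x -> in_beta beta y -> in_beta beta (x * y).
Proof.
have H (z : quat K) (j : nat) : in_beta beta z -> (j < 4)%N -> (beta <= j)%N ->
    z 0 (inord j) = 0.
  by move=> hz j4 bj; apply: hz; rewrite inordK.
move=> hx hy.
move: hbeta; rewrite !inE => /or3P[] /eqP hb; rewrite {}hb in H hx hy *.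
- apply: ord4P; rewrite inordK// => // _; rewrite mulqE
    (H x 1%N hx)// (H x 2%N hx)// (H x 3%N hx)//
    (H y 1%N hy)// (H y 2%N hy)// (H y 3%N hy)//; ring.
- apply: ord4P; rewrite inordK// => // _; rewrite mulqE
    (H x 2%N hx)// (H x 3%N hx)// (H y 2%N hy)// (H y 3%N hy)//; ring.
- by move=> k; rewrite leqNgt ltn_ord.
Qed.

Lemma in_beta_sum (I : Type) (r : seq I) (P : pred I) (F : I -> quat K) :
  (forall i, P i -> in_beta beta (F i)) ->
  in_beta beta (\sum_(i <- r | P i) F i).
Proof.
move=> h; elim/big_rec: _ => [|i x Pi hx]; first exact: in_beta0.
by apply: in_betaD => //; exact: h.
Qed.

Lemma mx_betaM p q r (A : 'M[quat K]_(p, q)) (B : 'M[quat K]_(q, r)) :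
  mx_beta beta A -> mx_beta beta B -> mx_beta beta (A *m B).
Proof.
by move=> hA hB i j; rewrite mxE; apply: in_beta_sum => k _; apply: in_betaM.
Qed.

Lemma mx_betaD p q (A B : 'M[quat K]_(p, q)) :
  mx_beta beta A -> mx_beta beta B -> mx_beta beta (A + B).
Proof. by move=> hA hB i j; rewrite mxE; apply: in_betaD. Qed.

Lemma mx_betaN p q (A : 'M[quat K]_(p, q)) :
  mx_beta beta A -> mx_beta beta (- A).
Proof. by move=> hA i j; rewrite mxE; apply: in_betaN. Qed.

Lemma mx_beta0 p q : mx_beta beta (0 : 'M[quat K]_(p, q)).
Proof. by move=> i j; rewrite mxE; apply: in_beta0. Qed.

Lemma mx_beta_scl p c : mx_beta beta ((sclq c)%:M : 'M[quat K]_p).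
Proof.
move=> i j; rewrite mxE; case: eqP => _ //=; first by rewrite mulr1n; exact: in_beta_scl.
by rewrite mulr0n; apply: in_beta0.
Qed.

Lemma mx_beta1 p : mx_beta beta (1%:M : 'M[quat K]_p).
Proof. exact: (@mx_beta_scl p 1). Qed.

Lemma mx_beta_diag p (l : 'rV[K]_p) :
  mx_beta beta (diag_mx (map_mx (@sclq K) l)).
Proof.
move=> i j; rewrite !mxE; case: eqP => _ /=.
  by rewrite mulr1n; apply: in_beta_scl.
by rewrite mulr0n; apply: in_beta0.
Qed.

Lemma mx_beta_conjtr p q (A : 'M[quat K]_(p, q)) :
  mx_beta beta A -> mx_beta beta (conjtrq A).
Proof. by move=> hA i j; rewrite !mxE; apply: in_beta_conj. Qed.

End Beta.

Lemma conjtrq_mul p q r (A : 'M[quat K]_(p, q)) (B : 'M[quat K]_(q, r)) :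
  conjtrq (A *m B) = conjtrq B *m conjtrq A.
Proof.
apply/matrixP => i j; rewrite !mxE raddf_sum.
by apply: eq_bigr => k _; rewrite /= conjqM !mxE.
Qed.

Lemma conjtrqK p q (A : 'M[quat K]_(p, q)) : conjtrq (conjtrq A) = A.
Proof. by apply/matrixP => i j; rewrite !mxE conjqK. Qed.

Lemma conjtrq_is_zmod p q : zmod_morphism (@conjtrq K p q).
Proof. by move=> A B; rewrite /conjtrq !raddfB. Qed.

HB.instance Definition _ p q := GRing.isZmodMorphism.Build
  'M[quat K]_(p, q) 'M[quat K]_(q, p) (@conjtrq K p q) (@conjtrq_is_zmod p q).

Lemma conjtrq_scl p c : conjtrq ((sclq c)%:M) = (sclq c)%:M :> 'M[quat K]_p.
Proof.
apply/matrixP => i j; rewrite !mxE eq_sym; case: eqP => _.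
  by rewrite !mulr1n conjq_scl.
by rewrite !mulr0n raddf0.
Qed.

Lemma conjtrq1 p : conjtrq 1%:M = 1%:M :> 'M[quat K]_p.
Proof. exact: (conjtrq_scl _ 1). Qed.

Lemma conjtrq_diag p (l : 'rV[K]_p) :
  conjtrq (diag_mx (map_mx (@sclq K) l)) = diag_mx (map_mx (@sclq K) l).
Proof.
apply/matrixP => i j; rewrite !mxE eq_sym; case: eqP => [->|_].
  by rewrite !mulr1n conjq_scl.
by rewrite !mulr0n raddf0.
Qed.

Lemma conjtrq_block p q r s (A : 'M[quat K]_(p, q)) B C
    (D : 'M[quat K]_(r, s)) :
  conjtrq (block_mx A B C D) =
  block_mx (conjtrq A) (conjtrq C) (conjtrq B) (conjtrq D).
Proof. by rewrite /conjtrq tr_block_mx map_block_mx. Qed.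

Lemma conjtrq_col p q r (A : 'M[quat K]_(p, q)) (B : 'M[quat K]_(r, q)) :
  conjtrq (col_mx A B) = row_mx (conjtrq A) (conjtrq B).
Proof. by rewrite /conjtrq tr_col_mx map_row_mx. Qed.

Lemma sclmxC p q c (A : 'M[quat K]_(p, q)) :
  (sclq c)%:M *m A = A *m (sclq c)%:M.
Proof.
apply/matrixP => i j; rewrite mul_scalar_mx !mxE (bigD1 j)//= big1 => [|k kj].
  by rewrite mxE eqxx mulr1n addr0 sclqC.
by rewrite mxE (negbTE kj) mulr0n mulr0.
Qed.

(** Quaternions do not commute, but the real part of a product is symmetric. *)
Lemma retrC p q (A : 'M[quat K]_(p, q)) (B : 'M[quat K]_(q, p)) :
  retr (A *m B) = retr (B *m A).
Proof.
rewrite /retr /mxtrace.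
transitivity (\sum_i \sum_j (A i j * B j i) 0 0).
  by rewrite summxE; apply: eq_bigr => i _; rewrite mxE summxE.
rewrite exchange_big /= summxE; apply: eq_bigr => j _.
by rewrite mxE summxE; apply: eq_bigr => i _; rewrite reqC.
Qed.

Lemma mxinv_eq p (A B : 'M[quat K]_p) :
  B *m A = 1%:M -> A *m B = 1%:M -> mxinv A = B.
Proof.
move=> BA AB; rewrite /mxinv; case: xgetP => [C _ [CA AC]|/(_ B) []//].
by rewrite -[C]mulmx1 -AB mulmxA CA mul1mx.
Qed.

Lemma mxinv1 p : mxinv (1%:M : 'M[quat K]_p) = 1%:M.
Proof. by apply: mxinv_eq; rewrite mul1mx. Qed.

End QuatAlgebra.

(** * Cholesky factorisation and positive definiteness *)

Section Cholesky.
Variables (R : realType) (beta : nat).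
Hypothesis hbeta : beta \in [:: 1%N; 2%N; 4%N].
Local Notation sc c := ((@sclq R c)%:M).

Lemma normq_ge0 (x : quat R) : 0 <= normq x.
Proof. by apply: sumr_ge0 => k _; exact: sqr_ge0. Qed.

Lemma normq_eq0 (x : quat R) : (normq x == 0) = (x == 0).
Proof.
rewrite psumr_eq0; last by move=> k _; exact: sqr_ge0.
apply/allP/eqP => [h|-> k _ /=]; last by rewrite mxE expr0n.
apply: quatP => k; have /= := h k (mem_index_enum _).
by rewrite sqrf_eq0 mxE => /eqP.
Qed.

Lemma conjq_fix (x : quat R) : conjq x = x -> x = sclq (x 0 0).
Proof.
move=> /rowP h; apply: quatP => k.
have {h} := h k; rewrite [LHS]mxE.
elim/ord4P: k; rewrite sclqE// inord4_0 -val_eqE /= !inordK//= => h; lra.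
Qed.

Definition nsq m (x : 'cV[quat R]_m) : R := \sum_i normq (x i 0).

Lemma nsqE m (x : 'cV[quat R]_m) : conjtrq x *m x = sc (nsq x).
Proof.
rewrite [LHS]mx11_scalar; congr (_%:M); rewrite mxE raddf_sum.
by apply: eq_bigr => i _; rewrite !mxE conjq_mull.
Qed.

Lemma nsq_ge0 m (x : 'cV[quat R]_m) : 0 <= nsq x.
Proof. by apply: sumr_ge0 => k _; exact: normq_ge0. Qed.

Lemma nsq_eq0 m (x : 'cV[quat R]_m) : (nsq x == 0) = (x == 0).
Proof.
rewrite psumr_eq0; last by move=> k _; exact: normq_ge0.
apply/allP/eqP => [h|-> k _ /=]; last by rewrite mxE normq_eq0.
apply/colP => k; have /= := h k (mem_index_enum _).
by rewrite normq_eq0 mxE => /eqP.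
Qed.

Lemma nsq_gt0 m (x : 'cV[quat R]_m) : (0 < nsq x) = (x != 0).
Proof. by rewrite lt0r nsq_eq0 nsq_ge0 andbT. Qed.

Lemma sc00 (c : R) : (sc c : 'M[quat R]_1) 0 0 0 0 = c.
Proof. by rewrite mxE eqxx mulr1n inord4_0 sclqE. Qed.

Lemma sc_mul m (c e : R) : (sc c : 'M[quat R]_m) *m sc e = sc (c * e).
Proof. by rewrite -scalar_mxM -(rmorphM (@sclq R)). Qed.

Lemma sc_mulA m p (c e : R) (A : 'M[quat R]_(m, p)) :
  sc c *m (sc e *m A) = sc (c * e) *m A.
Proof. by rewrite mulmxA sc_mul. Qed.

Lemma sc_mulCA m p q (c : R) (A : 'M[quat R]_(m, p)) (B : 'M[quat R]_(p, q)) :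
  A *m (sc c *m B) = sc c *m (A *m B).
Proof. by rewrite !mulmxA sclmxC. Qed.

Lemma sc1 m : (sc 1 : 'M[quat R]_m) = 1%:M.
Proof. by rewrite rmorph1. Qed.

Section Schur.
Variable m : nat.
Implicit Type S : 'M[quat R]_(1 + m).

Definition pivot S : R := ulsubmx S 0 0 0 0.

(** What remains of S after eliminating the first coordinate by a congruence. *)
Definition schur S : 'M[quat R]_m :=
  drsubmx S - sc (pivot S)^-1 *m (conjtrq (ursubmx S) *m ursubmx S).

Lemma herm_block S : hermmx beta S ->
  [/\ S = block_mx (sc (pivot S)) (ursubmx S)
            (conjtrq (ursubmx S)) (drsubmx S),
      mx_beta beta (ursubmx S), mx_beta beta (drsubmx S) &
      conjtrq (drsubmx S) = drsubmx S].
Proof.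
move=> [Sb Sh].
have := Sh; rewrite -{1 2}[S]submxK conjtrq_block => /eq_block_mx[h1 h2 h3 h4].
split=> //; last by move=> i j; rewrite !mxE.
- rewrite -{1}[S]submxK; congr block_mx; last by rewrite -h3.
  rewrite [LHS]mx11_scalar; congr (_%:M); apply: conjq_fix.
  by move: h1 => /matrixP/(_ 0 0); rewrite !mxE.
- by move=> i j; rewrite !mxE.
Qed.

Lemma herm_schur S : hermmx beta S -> hermmx beta (schur S).
Proof.
move=> /herm_block[_ hr hd hh]; split.
  apply: mx_betaD => //; apply: mx_betaN.
  apply: (mx_betaM hbeta); first exact: mx_beta_scl.
  by apply: (mx_betaM hbeta) => //; exact: mx_beta_conjtr.
by rewrite /schur raddfB /= hh !conjtrq_mul conjtrqK conjtrq_scl sclmxC.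
Qed.

Lemma posdef_pivot S : posdef beta S -> 0 < pivot S.
Proof.
move=> [/herm_block[E _ _ _] h].
have := h (col_mx 1%:M 0); rewrite {1}E conjtrq_col.
rewrite mul_row_block mul_row_col conjtrq1 !mul1mx mulmx1.
rewrite raddf0 !mul0mx !addr0 mulmx0 addr0 sc00; apply.
- move=> i j; case: (split_ordP i) => k ->.
    by rewrite col_mxEu; exact: mx_beta1.
  by rewrite col_mxEd mxE; exact: in_beta0.
- apply/eqP => /matrixP/(_ (lshift m 0) 0); rewrite col_mxEu !mxE eqxx => /eqP.
  by rewrite oner_eq0.
Qed.

(** Minimising the quadratic form of S over the first coordinate leaves the form
    of the Schur complement. *)
Lemma posdef_schur S : posdef beta S -> posdef beta (schur S).
Proof.
move=> pS; have s0 := posdef_pivot pS; case: pS => hS h.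
split=> [|y yb y0]; first exact: herm_schur.
have [E hr hd hh] := herm_block hS.
set s := pivot S in s0 E *; set v := ursubmx S in E hr *.
set z := - (sc s^-1 *m (v *m y)).
have := h (col_mx z y).
rewrite {1}E -mulmxA mul_block_col.
have -> : sc s *m z + v *m y = 0.
  by rewrite /z mulmxN sc_mulA divff ?gt_eqF// sc1 mul1mx addNr.
have -> : conjtrq v *m z + drsubmx S *m y = schur S *m y.
  rewrite /z /schur mulmxBl mulmxN addrC -/v -/s; congr (_ - _).
  by rewrite sc_mulCA -!mulmxA.
rewrite conjtrq_col mul_row_col mulmx0 add0r mulmxA.
apply.
- move=> i j; case: (split_ordP i) => k ->.
    rewrite col_mxEu; apply: mx_betaN.
    apply: (mx_betaM hbeta); first exact: mx_beta_scl.
    exact: (mx_betaM hbeta).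
  by rewrite col_mxEd.
- apply: contraNneq y0 => /matrixP e; apply/eqP/colP => i.
  by have := e (rshift 1 i) 0; rewrite col_mxEd !mxE.
Qed.

End Schur.

(** One step of Gaussian elimination, so that the entries are explicit measurable
    functions of S; the values are meaningful when all pivots are positive. *)
Fixpoint chol m : 'M[quat R]_m -> 'M[quat R]_m :=
  match m return 'M[quat R]_m -> 'M[quat R]_m with
  | 0%N => id
  | m'.+1 => fun S : 'M[quat R]_(1 + m') =>
      block_mx (sc (Num.sqrt (pivot S)))
        (sc (Num.sqrt (pivot S))^-1 *m ursubmx S) 0 (chol (schur S))
  end.

Fixpoint invchol m : 'M[quat R]_m -> 'M[quat R]_m :=
  match m return 'M[quat R]_m -> 'M[quat R]_m with
  | 0%N => id
  | m'.+1 => fun S : 'M[quat R]_(1 + m') =>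
      let W := invchol (schur S) in
      block_mx (sc (Num.sqrt (pivot S))^-1)
        (- (sc (pivot S)^-1 *m (ursubmx S *m W))) 0 W
  end.

Fixpoint pivots_gt0 m : 'M[quat R]_m -> bool :=
  match m return 'M[quat R]_m -> bool with
  | 0%N => xpredT
  | m'.+1 => fun S : 'M[quat R]_(1 + m') =>
     (0 < pivot S) && pivots_gt0 (schur S)
  end.

Definition uptri m (U : 'M[quat R]_m) : Prop :=
  [/\ mx_beta beta U, forall i j : 'I_m, (j < i)%N -> U i j = 0 &
      forall i, exists2 u : R, 0 < u & U i i = sclq u].

Lemma uptri_block m (u : R) (w : 'M[quat R]_(1, m)) (V : 'M[quat R]_m) :
  0 < u -> mx_beta beta w -> uptri V -> @uptri (1 + m) (block_mx (sc u) w 0 V).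
Proof.
move=> u0 wb [Vb Vt Vd]; split.
- move=> i j; case: (split_ordP i) => k ->; case: (split_ordP j) => l ->.
  + by rewrite block_mxEul; exact: mx_beta_scl.
  + by rewrite block_mxEur.
  + by rewrite block_mxEdl; exact: mx_beta0.
  + by rewrite block_mxEdr.
- move=> i j; case: (split_ordP i) => k ->; case: (split_ordP j) => l ->.
  + by rewrite !ord1.
  + by rewrite !ord1.
  + by rewrite block_mxEdl mxE.
  + by rewrite block_mxEdr ltn_add2l => /Vt.
- move=> i; case: (split_ordP i) => k ->.
    by exists u => //; rewrite block_mxEul !ord1 mxE eqxx mulr1n.
  by rewrite block_mxEdr.
Qed.

Lemma uptri_unblock m (U : 'M[quat R]_(1 + m)) : uptri U ->
  exists u w V, [/\ 0 < u, mx_beta beta w, uptri V & U = block_mx (sc u) w 0 V].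
Proof.
move=> [Ub Ut Ud]; have [u u0 uE] := Ud (lshift m 0).
exists u, (ursubmx U), (drsubmx U); split=> //.
- by move=> i j; rewrite !mxE.
- split=> [i j|i j ij|i].
  + by rewrite !mxE.
  + by rewrite !mxE; apply: Ut; rewrite ltn_add2l.
  + have [c c0 cE] := Ud (rshift 1 i).
    by exists c => //; rewrite -cE !mxE.
- rewrite -{1}[U]submxK; congr block_mx.
    by rewrite [LHS]mx11_scalar !mxE uE.
  by apply/matrixP => i j; rewrite !mxE Ut//= !ord1.
Qed.

Lemma gram_block m (u : R) (w : 'M[quat R]_(1, m)) (V : 'M[quat R]_m) :
  conjtrq (block_mx (sc u) w 0 V) *m block_mx (sc u) w 0 V =
  block_mx (sc (u * u)) (sc u *m w) (conjtrq w *m sc u)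
    (conjtrq w *m w + conjtrq V *m V).
Proof.
rewrite conjtrq_block mulmx_block conjtrq_scl sc_mul !mulmx0 !raddf0 !mul0mx.
by rewrite !addr0.
Qed.

Lemma chol_block m (u : R) (w : 'M[quat R]_(1, m)) (V : 'M[quat R]_m) :
  0 < u ->
  let S := conjtrq (block_mx (sc u) w 0 V) *m block_mx (sc u) w 0 V in
  [/\ pivot S = u * u, ursubmx S = sc u *m w & schur S = conjtrq V *m V].
Proof.
move=> u0 S.
have Ep : pivot S = u * u by rewrite /pivot /S gram_block block_mxKul sc00.
have Er : ursubmx S = sc u *m w by rewrite /S gram_block block_mxKur.
split=> //; rewrite /schur Ep Er /S gram_block block_mxKdr.
rewrite conjtrq_mul conjtrq_scl -mulmxA sc_mulA sc_mulCA.
rewrite sc_mulA mulVf ?gt_eqF ?mulr_gt0// sc1 mul1mx.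
by rewrite addrC addKr.
Qed.

(** Uniqueness of the triangular factor: its first row is read off the Gram
    matrix, and the Schur complement is the Gram matrix of the rest. *)
Lemma chol_gram m (U : 'M[quat R]_m) : uptri U ->
  chol (conjtrq U *m U) = U /\ pivots_gt0 (conjtrq U *m U).
Proof.
elim: m U => [|m IH] U; first by split=> //; apply/matrixP => -[].
move=> /uptri_unblock[u [w [V [u0 wb Vt ->]]]] /=.
have [Ep Er Es] := chol_block w V u0.
have [IH1 IH2] := IH _ Vt.
rewrite Ep Er Es IH1 IH2 mulr_gt0//; split=> //.
rewrite -expr2 sqrtr_sqr gtr0_norm//.
by rewrite sc_mulA mulVf ?gt_eqF// sc1 mul1mx.
Qed.

Lemma cholP m (S : 'M[quat R]_m) : hermmx beta S -> pivots_gt0 S ->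
  [/\ uptri (chol S), S = conjtrq (chol S) *m chol S,
      chol S *m invchol S = 1%:M, invchol S *m chol S = 1%:M & uptri (invchol S)].
Proof.
elim: m S => [|m IH] S; first by move=> _ _; split; do ?[apply/matrixP => -[//]|split=> -[//]].
move=> hS pS.
have /andP[s0 /(IH _ (herm_schur hS))[Ut Ueq UV VU Vt]] :
  (0 < pivot (S : 'M[quat R]_(1 + m))) && pivots_gt0 (schur (S : 'M[quat R]_(1 + m))) := pS.
have [E rb db dh] := herm_block hS.
set U := chol (schur S) in Ut Ueq UV VU *.
set V := invchol (schur S) in UV VU Vt *.
set s := pivot S in s0 E *.
set v := ursubmx (S : 'M[quat R]_(1 + m)) in E rb *.
have q0 : 0 < Num.sqrt s by rewrite sqrtr_gt0.
have qq : Num.sqrt s * Num.sqrt s = s by rewrite -expr2 sqr_sqrtr// ltW.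
have q1 : Num.sqrt s != 0 by rewrite gt_eqF.
have s1 : s != 0 by rewrite gt_eqF.
have [Vb _ _] := Vt.
have -> : @chol m.+1 S =
  block_mx (sc (Num.sqrt s)) (sc (Num.sqrt s)^-1 *m v) 0 U by [].
have -> : @invchol m.+1 S =
  block_mx (sc (Num.sqrt s)^-1) (- (sc s^-1 *m (v *m V))) 0 V by [].
split.
- apply: uptri_block => //; apply: (mx_betaM hbeta) => //.
  exact: mx_beta_scl.
- rewrite gram_block [LHS]E qq sc_mulA divff// sc1 mul1mx.
  apply: (congr2 (block_mx (sc s) v)).
    by rewrite conjtrq_mul conjtrq_scl -mulmxA sc_mul mulVf// sc1 mulmx1.
  rewrite -Ueq /schur conjtrq_mul conjtrq_scl.
  rewrite -mulmxA sc_mulA sc_mulCA -invfM qq.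
  by rewrite addrC subrK.
- etransitivity; first exact: (@mulmx_block _ 1 m 1 m 1 m).
  rewrite sc_mul divff// !mulmx0 !mul0mx !addr0 add0r UV sc1.
  rewrite mulmxN sc_mulA -mulmxA.
  have -> : Num.sqrt s / s = (Num.sqrt s)^-1.
    by apply: (mulfI q1); rewrite mulrA qq !divff.
  by rewrite addNr; exact/esym/(@scalar_mx_block _ 1 m).
- etransitivity; first exact: (@mulmx_block _ 1 m 1 m 1 m).
  rewrite sc_mul mulVf// !mulmx0 !mul0mx !addr0 add0r VU sc1.
  rewrite mulNmx -!mulmxA VU mulmx1 sc_mulA -invfM qq.
  by rewrite subrr; exact/esym/(@scalar_mx_block _ 1 m).
- apply: uptri_block => //; first by rewrite invr_gt0.
  apply: mx_betaN; apply: (mx_betaM hbeta); first exact: mx_beta_scl.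
  exact: (mx_betaM hbeta).
Qed.

Lemma posdef_pivots m (S : 'M[quat R]_m) : posdef beta S -> pivots_gt0 S.
Proof.
elim: m S => [//|m IH] S pS /=.
by rewrite (posdef_pivot pS) IH//; exact: posdef_schur.
Qed.

Lemma herm_gram m p (U : 'M[quat R]_(p, m)) :
  mx_beta beta U -> hermmx beta (conjtrq U *m U).
Proof.
move=> Ub; split; last by rewrite conjtrq_mul conjtrqK.
by apply: (mx_betaM hbeta) => //; exact: mx_beta_conjtr.
Qed.

Lemma herm_congr m p (S : 'M[quat R]_m) (U : 'M[quat R]_(m, p)) :
  mx_beta beta U -> hermmx beta S -> hermmx beta (conjtrq U *m S *m U).
Proof.
move=> Ub [Sb Sh]; split; last by rewrite !conjtrq_mul conjtrqK Sh mulmxA.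
apply: (mx_betaM hbeta) => //; apply: (mx_betaM hbeta) => //.
exact: mx_beta_conjtr.
Qed.

(** A matrix with a left inverse is injective on vectors, so the congruence by it
    preserves definiteness. *)
Lemma posdef_congr m p (S : 'M[quat R]_m) (U : 'M[quat R]_(m, p)) V :
  mx_beta beta U -> V *m U = 1%:M ->
  posdef beta S -> posdef beta (conjtrq U *m S *m U).
Proof.
move=> Ub VU [hS pS]; split=> [|x xb x0]; first exact: herm_congr.
have := pS (U *m x); rewrite conjtrq_mul !mulmxA; apply.
  exact: (mx_betaM hbeta).
by apply: contraNneq x0 => e; rewrite -[x]mul1mx -VU -mulmxA e mulmx0.
Qed.

Lemma posdef_sc m (c : R) : 0 < c -> posdef beta (sc c : 'M[quat R]_m).
Proof.
move=> c0; split=> [|x xb x0].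
  by split; [exact: mx_beta_scl|exact: conjtrq_scl].
rewrite -sclmxC -mulmxA nsqE sc_mul sc00.
by rewrite mulr_gt0// nsq_gt0.
Qed.

Lemma posdef1 m : posdef beta (1%:M : 'M[quat R]_m).
Proof. by rewrite -sc1; apply: posdef_sc. Qed.

Lemma uptri_inv m (U : 'M[quat R]_m) : uptri U ->
  exists V, [/\ uptri V, U *m V = 1%:M & V *m U = 1%:M].
Proof.
move=> Ut; have [e p] := chol_gram Ut.
have hU : hermmx beta (conjtrq U *m U) by apply: herm_gram; case: Ut.
have [_ _ + + Vt] := cholP hU p; rewrite e => UV VU.
by exists (invchol (conjtrq U *m U)).
Qed.

Lemma posdef_gram m (U : 'M[quat R]_m) : uptri U ->
  posdef beta (conjtrq U *m U).
Proof.
move=> Ut; have [V [_ UV VU]] := uptri_inv Ut.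
rewrite -[X in X *m U]mulmx1; apply: (posdef_congr (V := V)) => //.
  by case: Ut.
exact: posdef1.
Qed.

(** Definiteness quantifies over all vectors; the pivots decide it by finitely many
    inequalities. *)
Lemma posdefP m (S : 'M[quat R]_m) :
  posdef beta S <-> hermmx beta S /\ pivots_gt0 S.
Proof.
split=> [pS|[hS pS]]; first by split; [case: pS|exact: posdef_pivots].
have [Ut -> _ _ _] := cholP hS pS; exact: posdef_gram.
Qed.

Lemma addqmxE p q (A B : 'M[quat R]_(p, q)) i j :
  (A + B) i j = A i j + B i j.
Proof. by rewrite mxE. Qed.

Lemma posdefD m (S S' : 'M[quat R]_m) :
  posdef beta S -> posdef beta S' -> posdef beta (S + S').
Proof.
move=> [[Sb Sh] pS] [[Sb' Sh'] pS']; split=> [|x xb x0].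
  by split; [exact: mx_betaD|rewrite raddfD /= Sh Sh'].
rewrite mulmxDr mulmxDl addqmxE quat_add0.
by apply: addr_gt0; [exact: pS|exact: pS'].
Qed.

Lemma uptri_mul m (U V : 'M[quat R]_m) : uptri U -> uptri V -> uptri (U *m V).
Proof.
move=> [Ub Ut Ud] [Vb Vt Vd]; split.
- exact: (mx_betaM hbeta).
- move=> i j ji; rewrite mxE big1// => k _.
  have [ki|ik] := ltnP k i; first by rewrite Ut ?mul0r.
  by rewrite (Vt k j) ?mulr0// (leq_trans ji).
- move=> i; have [u u0 uE] := Ud i; have [v v0 vE] := Vd i.
  exists (u * v); first exact: mulr_gt0.
  rewrite mxE (bigD1 i)//= uE vE big1 ?addr0 ?rmorphM// => k ki.
  have [ki'|ik] := ltnP k i; first by rewrite Ut ?mul0r.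
  by rewrite (Vt k i) ?mulr0// ltn_neqAle eq_sym ik andbT.
Qed.

Lemma uptri_sc m (c : R) : 0 < c -> uptri (sc c : 'M[quat R]_m).
Proof.
move=> c0; split.
- exact: mx_beta_scl.
- by move=> i j ji; rewrite mxE -val_eqE gtn_eqF.
- by move=> i; exists c => //; rewrite mxE eqxx.
Qed.

End Cholesky.

Section CholeskyDef.
Variables (R : realType) (beta : nat).
Hypothesis hbeta : beta \in [:: 1%N; 2%N; 4%N].

Lemma is_choleskyP n (Y U : 'M[quat R]_n.+1) :
  is_cholesky beta Y U <-> uptri beta U /\ Y = conjtrq U *m U.
Proof.
by split=> [[h1 h2 h3 ->]|[[h1 h2 h3] ->]].
Qed.

Lemma choleskyE n (Y : 'M[quat R]_n.+1) : posdef beta Y ->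
  cholesky beta Y = chol Y.
Proof.
move=> /(posdefP hbeta)[hY pY]; have [Ut Ye _ _ _] := cholP hbeta hY pY.
rewrite /cholesky; case: xgetP => [U _ /is_choleskyP[U't Y'e]|].
  by rewrite Y'e (chol_gram U't).1.
by move=> /(_ (chol Y))[]; apply/is_choleskyP.
Qed.

(** A matrix with a triangular factor is a Gram matrix, hence definite. *)
Lemma cholesky_junk n (Y : 'M[quat R]_n.+1) : ~ posdef beta Y ->
  cholesky beta Y = 1%:M.
Proof.
move=> pY; rewrite /cholesky; case: xgetP => // U _ /is_choleskyP[Ut YU].
by case: pY; rewrite YU; exact: posdef_gram.
Qed.
End CholeskyDef.

(** * Real eigenvalues of Hermitian quaternion matrices *)

Section RealSymmetric.
Variable R : realType.

(** The Hermitian spectral theorem over R[i] gives a real eigenvalue of the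
    complexified matrix; an eigenvalue is a root of the characteristic polynomial,
    so it is one for the real matrix as well. *)
Lemma sym_eigen n (M : 'M[R]_n.+1) : M^T = M ->
  exists l (v : 'cV[R]_n.+1), v != 0 /\ M *m v = l *: v.
Proof.
move=> Msym; pose A : 'M[R[i]]_n.+1 := map_mx (real_complex R) M.
have Ah : A \is hermsymmx.
  apply: realsym_hermsym.
    apply/is_hermitianmxP; rewrite expr0 scale1r.
    by apply/matrixP => i j; rewrite !mxE -{1}Msym mxE.
  apply/mxOverP => i j; by rewrite mxE; apply/complex_realP; exists (M i j).
have := hermitian_spectral_diag_real Ah.
move=> /mxOverP/(_ 0 0).
have /orthomx_spectralP := hermitian_normalmx Ah.
set P := spectralmx A; set D := spectral_diag A => AE dr.
have Pu : P \in unitmx by exact: spectral_unit.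
have PA : P *m A = diag_mx D *m P by rewrite {1}AE !mulmxA mulmxV// mul1mx.
have dE : (complex.Re (D 0 0))%:C%C = D 0 0 by apply: RRe_real.
have : eigenvalue A (complex.Re (D 0 0))%:C%C.
  apply/eigenvalueP; exists (row 0 P).
    by rewrite -row_mul PA row_mul row_diag_mx -scalemxAl -rowE dE.
  apply/eqP => /(congr1 (fun v => v *m invmx P)).
  rewrite rowE mulmxK// mul0mx => /matrixP/(_ 0 0)/eqP.
  by rewrite !mxE !eqxx oner_eq0.
rewrite eigenvalue_root_char -map_char_poly fmorph_root -eigenvalue_root_char.
move=> /eigenvalueP[v vM v0]; exists (complex.Re (D 0 0)), v^T; split.
  by rewrite -(inj_eq trmx_inj) trmxK trmx0.
by rewrite -{1}Msym -trmx_mul vM linearZ.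
Qed.

End RealSymmetric.

Section RealRep.
Variable R : realType.
Implicit Types x y : quat R.

Definition unitq (l : 'I_4) : quat R := delta_mx 0 l.

Lemma unitqE (l k : 'I_4) : unitq l 0 k = (k == l)%:R.
Proof. by rewrite mxE eqxx. Qed.

(** Left multiplication by x, as a real matrix. *)
Definition lmulq x : 'M[R]_4 := \matrix_(k, l) (x * unitq l) 0 k.

Lemma lmulq_entry x k l : lmulq x k l = (x * unitq l) 0 k.
Proof. by rewrite mxE. Qed.

Lemma lmulqE x y k : (x * y) 0 k = \sum_l lmulq x k l * y 0 l.
Proof.
rewrite sum4 !lmulq_entry.
by elim/ord4P: k; rewrite !mulqE !unitqE -!val_eqE /= !inordK//=; ring.
Qed.

Lemma lmulqM x y : lmulq (x * y) = lmulq x *m lmulq y.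
Proof.
apply/matrixP => k l; rewrite lmulq_entry -mulrA lmulqE [RHS]mxE.
by apply: eq_bigr => j _; rewrite [lmulq y _ _]lmulq_entry.
Qed.

Lemma lmulq_is_zmod : zmod_morphism lmulq.
Proof. move=> x y; apply/matrixP => k l.
by rewrite [RHS]mxE [X in _ = _ + X]mxE !lmulq_entry mulrBl [LHS]mxE [X in _ + X]mxE. Qed.

HB.instance Definition _ := GRing.isZmodMorphism.Build (quat R) 'M[R]_4 lmulq
  lmulq_is_zmod.

Lemma lmulq_scl c : lmulq (sclq c) = c%:M.
Proof. by apply/matrixP => k l; rewrite lmulq_entry sclq_mulE unitqE mxE mulr_natr. Qed.

Lemma lmulq_conj x : lmulq (conjq x) = (lmulq x)^T.
Proof.
apply/matrixP => k l; rewrite [RHS]mxE !lmulq_entry.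
by elim/ord4P: k; elim/ord4P: l; rewrite !mulqE !unitqE !conjqE// -!val_eqE /=
  !inordK//=; ring.
Qed.

(** The action of A on m-tuples of quaternions, as a real matrix of size 4 m. It
    is a ring morphism that carries the conjugate transpose to the transpose, so the
    usual determinant becomes available over the quaternions. *)
Definition realrep m (A : 'M[quat R]_m) : 'M[R]_(\sum_(i < m) 4)%N :=
  \mxblock_(i < m, j < m) lmulq (A i j).

Lemma realrepM m (A B : 'M[quat R]_m) :
  realrep (A *m B) = realrep A *m realrep B.
Proof.
rewrite /realrep mul_mxblock; apply: eq_mxblock => i j.
rewrite mxE raddf_sum; apply: eq_bigr => k _; exact: lmulqM.
Qed.

Lemma realrep_tr m (A : 'M[quat R]_m) : realrep (conjtrq A) = (realrep A)^T.
Proof.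
rewrite /realrep tr_mxblock; apply: eq_mxblock => i j.
by rewrite !mxE lmulq_conj.
Qed.

Lemma det_realrep_tri m (U : 'M[quat R]_m) (u : 'I_m -> R) :
  (forall i j : 'I_m, (j < i)%N -> U i j = 0) ->
  (forall i, U i i = sclq (u i)) ->
  \det (realrep U) = \prod_i u i ^+ 4.
Proof.
move=> Ut Ud; rewrite -det_tr det_trig; last first.
  rewrite /realrep tr_mxblock.
  apply/is_trig_mxblockP; split=> [i j ij|i].
    by rewrite Ut// raddf0 trmx0.
  by rewrite Ud lmulq_scl tr_scalar_mx scalar_mx_is_trig.
rewrite (eq_bigr (fun s => realrep U s s)); last by move=> s _; rewrite mxE.
transitivity (\prod_(i < m) \prod_(k < 4) lmulq (U i i) k k).
  by rewrite sig_big_dep (reindex _ tagnat.sig_bij_on)/=; apply: eq_bigr => s _; rewrite mxE.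
apply: eq_bigr => i _; rewrite (eq_bigr (fun=> u i)).
  by rewrite prodr_const card_ord.
by move=> k _; rewrite Ud lmulq_scl mxE eqxx.
Qed.

Lemma det_realrep_diag m (l : 'rV[R]_m) :
  \det (realrep (diag_mx (map_mx (@sclq R) l))) = \prod_i l 0 i ^+ 4.
Proof.
apply: det_realrep_tri => [i j ji|i].
  by rewrite mxE -val_eqE gtn_eqF.
by rewrite mxE eqxx mulr1n mxE.
Qed.

Lemma det_realrep_tr m (A : 'M[quat R]_m) :
  \det (realrep (conjtrq A)) = \det (realrep A).
Proof. by rewrite realrep_tr det_tr. Qed.

Lemma realrep1 m : \det (realrep (1%:M : 'M[quat R]_m)) = 1.
Proof.
rewrite (det_realrep_tri (u := fun=> 1)) => [|i j ji|i].
- by rewrite big1// => i _; rewrite expr1n.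
- by rewrite mxE -val_eqE gtn_eqF.
- by rewrite mxE eqxx.
Qed.

(** The eigenvector of the real representation is regrouped into quaternions; its
    eigenvalue is real, hence central. *)
Lemma quat_eigen n (S : 'M[quat R]_n.+1) : conjtrq S = S ->
  exists l (x : 'cV[quat R]_n.+1), x != 0 /\ S *m x = x *m (sclq l)%:M.
Proof.
move=> Sh; have Ssym : (realrep S)^T = realrep S by rewrite -realrep_tr Sh.
have [N NE] : exists N, (\sum_(i < n.+1) 4)%N = N.+1.
  by rewrite big_ord_recl; eexists.
have [l [v [v0 vE]]] : exists l (v : 'cV[R]_(\sum_(i < n.+1) 4)%N),
    v != 0 /\ realrep S *m v = l *: v.
  by move: (realrep S) Ssym; rewrite NE; exact: sym_eigen.
pose x : 'cV[quat R]_n.+1 := \col_i (submxcol v i)^T.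
have key i k : (S *m x) i 0 0 k = submxcol (realrep S *m v) i k 0.
  rewrite -{1}[v]submxcolK mul_mxblock_mxrow mxcolK mxE !summxE.
  apply: eq_bigr => j _; rewrite lmulqE [RHS]mxE; apply: eq_bigr => h _.
  by rewrite [x _ _]mxE [(submxcol v j)^T _ _]mxE.
exists l, x; split.
  apply: contraNneq v0 => x0; apply/eqP/mxcolP => i; apply/matrixP => k j.
  move: x0 => /matrixP/(_ i 0)/rowP/(_ k).
  by rewrite ord1 submxcol0 !mxE.
apply/matrixP => i j; rewrite ord1; apply: quatP => k.
rewrite key vE -sclmxC mul_scalar_mx [RHS](_ : _ = (sclq l * x i 0) 0 k); last first.
  by rewrite [(_ *: x) _ _]mxE.
by rewrite sclq_mulE !mxE.
Qed.
End RealRep.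

(** * The spectral theorem and the determinant *)

Lemma mulmx_sandwich (K : pzSemiRingType) m (H A D W : 'M[K]_m) :
  H *m (A *m D *m W) *m H = H *m A *m D *m (W *m H).
Proof. by rewrite !mulmxA. Qed.

Section Spectral.
Variables (R : realType) (beta : nat).
Hypothesis hbeta : beta \in [:: 1%N; 2%N; 4%N].
Local Notation sc c := ((@sclq R c)%:M).

(** The projection of H onto the subalgebra; it is linear over that subalgebra. *)
Definition truncq (x : quat R) : quat R :=
  \row_k (if (k < beta)%N then x 0 k else 0).

Lemma truncq_in x : in_beta beta (truncq x).
Proof. by move=> k kb; rewrite mxE ltnNge kb. Qed.

Lemma truncqE x k : (k < 4)%N ->
  truncq x 0 (inord k) = if (k < beta)%N then x 0 (inord k) else 0.
Proof. by move=> k4; rewrite mxE inordK. Qed.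

Lemma truncq_is_zmod : zmod_morphism truncq.
Proof.
by move=> x y; apply: quatP => k; rewrite !mxE; case: ifP => // _; rewrite subr0.
Qed.

HB.instance Definition _ := GRing.isZmodMorphism.Build (quat R) (quat R) truncq
  truncq_is_zmod.

Lemma truncqM a x : in_beta beta a -> truncq (a * x) = a * truncq x.
Proof.
have H (z : quat R) (j : nat) : in_beta beta z -> (j < 4)%N -> (beta <= j)%N ->
    z 0 (inord j) = 0.
  by move=> hz j4 bj; apply: hz; rewrite inordK.
move=> ha; apply: quatP => k.
move: hbeta; rewrite !inE => /or3P[] /eqP hb; move: H ha;
  elim/ord4P: k; rewrite truncqE// !mulqE !truncqE// hb /= => H ha.
1-4: by rewrite (H a 1%N ha)// (H a 2%N ha)// (H a 3%N ha)//; ring.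
1-4: by rewrite (H a 2%N ha)// (H a 3%N ha)//; ring.
1-4: by [].
Qed.

(** An eigenvector over the quaternions gives one over the algebra: right
    multiplication by a quaternion and truncation of the components both commute
    with the left action of a matrix over the algebra. *)
Lemma beta_eigen n (S : 'M[quat R]_n.+1) : hermmx beta S ->
  exists l (x : 'cV[quat R]_n.+1),
    [/\ mx_beta beta x, x != 0 & S *m x = x *m sc l].
Proof.
move=> [Sb Sh]; have [l [x [x0 Sx]]] := quat_eigen Sh.
have /cV0Pn[i xi] := x0.
have /rV0Pn[k xik] := xi.
(* the component k of x i 0 is nonzero; q moves it to the real part *)
pose q := conjq (unitq R k).
pose y : 'cV[quat R]_n.+1 := \col_i truncq (x i 0 * q).
have b0 : (0 < beta)%N by case: beta hbeta.
exists l, y; split.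
- by move=> a b; rewrite mxE; exact: truncq_in.
- apply: contraNneq xik => y0.
  have : truncq (x i 0 * q) = 0.
    by move: y0 => /matrixP/(_ i 0); rewrite mxE [RHS]mxE.
  move=> /rowP/(_ 0); rewrite [RHS]mxE inord4_0 truncqE// b0 -inord4_0.
  rewrite mulq_conj0 (bigD1 k)//= unitqE eqxx mulr1 big1 => [|j jk].
    by rewrite addr0 => ->.
  by rewrite unitqE (negbTE jk) mulr0.
- apply/matrixP => a b; rewrite ord1 -sclmxC mul_scalar_mx.
  have E : \sum_j S a j * x j 0 = sclq l * x a 0.
    move: Sx => /matrixP/(_ a 0); rewrite -sclmxC mul_scalar_mx !mxE => ->.
    by [].
  rewrite [LHS]mxE [RHS]mxE [y _ _]mxE.
  rewrite (eq_bigr (fun j => truncq (S a j * x j 0 * q))); last first.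
    by move=> j _; rewrite mxE -truncqM// mulrA.
  rewrite -raddf_sum -mulr_suml E -mulrA.
  by apply: truncqM; exact: in_beta_scl.
Qed.

Definition e0 n : 'cV[quat R]_(1 + n) := col_mx 1%:M 0.

Lemma e0_beta n : mx_beta beta (e0 n).
Proof.
move=> i j; case: (split_ordP i) => k ->.
  by rewrite col_mxEu; exact: mx_beta1.
by rewrite col_mxEd mxE; exact: in_beta0.
Qed.

Lemma conjtrq_e0 n (x : 'cV[quat R]_(1 + n)) : conjtrq (e0 n) *m x = usubmx x.
Proof.
by rewrite -{1}[x]vsubmxK conjtrq_col conjtrq1 raddf0 mul_row_col mul1mx mul0mx addr0.
Qed.

(** The reflection along x - e0. The first entry of x must be real, because the
    inner products with x - e0 have to be central. *)
Lemma householder n (x : 'cV[quat R]_(1 + n)) (c : R) :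
  mx_beta beta x -> conjtrq x *m x = 1%:M -> usubmx x = sc c ->
  exists H : 'M[quat R]_(1 + n),
    [/\ mx_beta beta H, conjtrq H = H, H *m H = 1%:M & H *m x = e0 n].
Proof.
move=> xb xx xu; pose w := x - e0 n.
have [w0|w0] := eqVneq w 0.
  exists 1%:M; rewrite conjtrq1 !mul1mx; split=> //; first exact: mx_beta1.
  by apply/eqP; rewrite -subr_eq0; apply/eqP.
have wb : mx_beta beta w by apply: mx_betaD => //; apply/mx_betaN/e0_beta.
have wx : conjtrq w *m x = sc (1 - c).
  by rewrite /w raddfB /= mulmxBl xx conjtrq_e0 xu -sc1 -raddfB -raddfB.
have we : conjtrq w *m e0 n = sc (c - 1).
  rewrite /w raddfB /= mulmxBl conjtrq_e0 col_mxKu.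
  rewrite -[conjtrq x *m _]conjtrqK conjtrq_mul conjtrqK conjtrq_e0 xu.
  by rewrite conjtrq_scl -sc1 -raddfB -raddfB.
have nw : nsq w = 2 * (1 - c).
  have : conjtrq w *m w = sc (2 * (1 - c)).
    rewrite {2}/w mulmxBr wx we -raddfB -raddfB.
    by congr ((sclq _)%:M); ring.
  by rewrite nsqE => /matrixP/(_ 0 0)/rowP/(_ 0); rewrite !sc00.
have c1 : 1 - c != 0.
  by apply: contraNneq w0 => e; rewrite -nsq_eq0 nw e mulr0.
pose s := (1 - c)^-1.
have ww : conjtrq w *m w = sc (2 * (1 - c)) by rewrite nsqE nw.
(* the orthogonal projection on w is P / 2, and the reflection is 1 - P *)
pose P := sc s *m (w *m conjtrq w).
have Pc : conjtrq P = P.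
  by rewrite /P conjtrq_mul conjtrq_mul conjtrqK conjtrq_scl sclmxC.
have PP : P *m P = P + P.
  have key : (w *m conjtrq w) *m (w *m conjtrq w) =
      sc (2 * (1 - c)) *m (w *m conjtrq w).
    by rewrite mulmxA -(mulmxA w (conjtrq w) w) ww -sclmxC -mulmxA.
  rewrite /P -[LHS]mulmxA (sc_mulCA s (w *m conjtrq w)) key !sc_mulA -mulmxDl.
  have sE : s * s * (2 * (1 - c)) = s + s by rewrite /s; field.
  by rewrite -raddfD -raddfD sE.
exists (1%:M - P); split.
- apply: mx_betaD; first exact: mx_beta1.
  apply: mx_betaN; apply: (mx_betaM hbeta); first exact: mx_beta_scl.
  by apply: (mx_betaM hbeta) => //; exact: mx_beta_conjtr.
- by rewrite raddfB /= conjtrq1 Pc.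
- by rewrite mulmxBl mul1mx mulmxBr mulmx1 PP opprB addrK subrK.
- rewrite mulmxBl mul1mx /P -!mulmxA wx -sclmxC sc_mulA mulVf// sc1 mul1mx.
  by rewrite /w opprB addrC subrK.
Qed.

(** Right multiplication by the conjugate of the first entry makes that entry real
    and keeps the eigenvalue, which is central. *)
Lemma normalized_eigen n (S : 'M[quat R]_(1 + n)) : hermmx beta S ->
  exists l (x : 'cV[quat R]_(1 + n)) (c : R),
    [/\ mx_beta beta x, conjtrq x *m x = 1%:M, S *m x = x *m sc l &
        usubmx x = sc c].
Proof.
move=> hS; have [l [x [xb x0 Sx]]] := @beta_eigen n S hS.
pose x1 : quat R := x 0 0.
pose q : quat R := if x1 == 0 then 1 else conjq x1.
have q0 : q != 0.
  rewrite /q; case: (eqVneq x1 0) => [_|h].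
    apply/eqP => /rowP/(_ (inord 0)).
    by rewrite quat1E sclqE// mxE => /eqP; rewrite oner_eq0.
  by rewrite -(inj_eq (can_inj (@conjqK R))) conjqK raddf0.
have qb : in_beta beta q.
  rewrite /q; case: ifP => _; first exact: (@in_beta_scl R beta hbeta 1).
  by apply: in_beta_conj; exact: xb.
have [d x1q] : exists d, x1 * q = sclq d.
  rewrite /q; case: (eqVneq x1 0) => [->|_].
    by exists 0; rewrite mul0r raddf0.
  by exists (normq x1); rewrite conjq_mulr.
pose y := x *m q%:M.
have y0 : y != 0.
  apply: contraNneq x0 => y0.
  have : y *m (conjq q)%:M = 0 by rewrite y0 mul0mx.
  rewrite /y -mulmxA -scalar_mxM conjq_mulr -sclmxC => h.
  have nq : normq q != 0 by rewrite normq_eq0.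
  by rewrite -[x]mul1mx -sc1 -(mulVf nq) -sc_mulA h mulmx0.
have yb : mx_beta beta y.
  apply: (mx_betaM hbeta) => // i j; rewrite mxE.
  by case: eqP => _; rewrite ?mulr1n ?mulr0n//; exact: in_beta0.
have Sy : S *m y = y *m sc l by rewrite /y mulmxA Sx -!mulmxA sclmxC.
pose t := (Num.sqrt (nsq y))^-1.
have ny : 0 < nsq y by rewrite nsq_gt0.
exists l, (y *m sc t), (d * t); split.
- by apply: (mx_betaM hbeta) => //; exact: mx_beta_scl.
- rewrite conjtrq_mul conjtrq_scl -mulmxA (mulmxA (conjtrq y)) nsqE !sc_mul.
  rewrite -sc1; congr ((sclq _)%:M).
  by rewrite /t mulrCA -invfM -expr2 sqr_sqrtr ?ltW// divff// gt_eqF.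
- by rewrite mulmxA Sy -mulmxA -[RHS]mulmxA 2!sc_mul mulrC.
- rewrite -sclmxC mul_scalar_mx linearZ /= [@usubmx _ 1 n 1 y]mx11_scalar.
  have -> : @usubmx _ 1 n 1 y 0 0 = sclq d.
    rewrite -x1q mxE /y mxE (bigD1 0)//= big1 ?addr0 => [|k k0].
      by rewrite mxE eqxx mulr1n /x1; congr (x _ _ * _); exact/val_inj.
    by rewrite ord1 eqxx in k0.
  rewrite -mul_scalar_mx sc_mul mulrC.
  by [].
Qed.

(** Deflation: the reflection takes an eigenvector to the first basis vector, and
    the remaining block is Hermitian of smaller size. *)
Lemma spectral_herm m (S : 'M[quat R]_m) : hermmx beta S ->
  exists l, spectrum beta S l.
Proof.
elim: m S => [|m IH] S hS.
  exists 0, 1%:M; split; try by apply/matrixP => -[].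
  exact: mx_beta1.
have [l [x [c [xb xx Sx xu]]]] := @normalized_eigen m S hS.
have [H [Hb Hc HH Hx]] := householder xb xx xu.
pose B : 'M[quat R]_(1 + m) := H *m S *m H.
have hB : hermmx beta B by rewrite /B -{1}Hc; exact: (herm_congr hbeta).
have SE : S = H *m B *m H.
  by rewrite /B !mulmxA HH mul1mx -mulmxA HH mulmx1.
have xE : x = H *m e0 m by rewrite -Hx mulmxA HH mul1mx.
have Be : B *m e0 m = e0 m *m sc l.
  by rewrite /B -mulmxA -xE -mulmxA Sx mulmxA Hx.
have [BE rb db dh] := herm_block hB.
move: Be; rewrite {1}BE /e0 mul_block_col mul_col_mx !mulmx1 !mulmx0 !addr0.
rewrite mul1mx mul0mx => /eq_col_mx[pl vz].
have rz : ursubmx B = 0.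
  by rewrite -[ursubmx B]conjtrqK vz raddf0.
rewrite pl rz raddf0 in BE.
have [l' [V [Vb VV1 VV2 WE]]] := IH _ (conj db dh).
exists (row_mx (const_mx l : 'M[R]_1) l').
pose W : 'M[quat R]_(1 + m) := block_mx 1%:M 0 0 V.
have Wc : conjtrq W = block_mx 1%:M 0 0 (conjtrq V).
  by rewrite /W conjtrq_block conjtrq1 !raddf0.
have Wb : mx_beta beta W.
  move=> i j; case: (split_ordP i) => k ->; case: (split_ordP j) => k' ->.
  - by rewrite block_mxEul; exact: mx_beta1.
  - by rewrite block_mxEur; exact: mx_beta0.
  - by rewrite block_mxEdl; exact: mx_beta0.
  - by rewrite block_mxEdr.
have one : block_mx 1%:M 0 0 1%:M = 1%:M :> 'M[quat R]_(1 + m).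
  by rewrite [RHS]scalar_mx_block.
have WcW : conjtrq W *m W = 1%:M.
  by rewrite Wc mulmx_block !mulmx0 !mul0mx !mulmx1 VV1 !addr0 add0r one.
have WWc : W *m conjtrq W = 1%:M.
  by rewrite Wc mulmx_block !mulmx0 !mul0mx !mulmx1 VV2 !addr0 add0r one.
have BW : B = conjtrq W *m
    diag_mx (map_mx (@sclq R) (row_mx (const_mx l : 'M[R]_1) l')) *m W.
  rewrite [LHS]BE map_row_mx diag_mx_row.
  have -> : diag_mx (map_mx (@sclq R) (const_mx l : 'M[R]_1)) = sc l.
    by rewrite [LHS]mx11_scalar !mxE eqxx.
  rewrite Wc !mulmx_block !mulmx0 !mul0mx !mulmx1 !mul1mx !addr0 !add0r.
  by rewrite !mul0mx -WE.
exists (W *m H); split.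
- exact: (mx_betaM hbeta).
- by rewrite conjtrq_mul Hc mulmxA -(mulmxA H) WcW mulmx1.
- by rewrite conjtrq_mul Hc mulmxA -(mulmxA W) HH mulmx1.
- by rewrite conjtrq_mul Hc [LHS]SE BW; exact: mulmx_sandwich.
Qed.

Definition dg m (U : 'M[quat R]_m) (i : 'I_m) : R := U i i 0 0.

Lemma uptri_dg m (U : 'M[quat R]_m) : uptri beta U ->
  forall i, 0 < dg U i /\ U i i = sclq (dg U i).
Proof.
move=> [_ _ Ud] i; have [u u0 uE] := Ud i.
by rewrite /dg uE inord4_0 sclqE.
Qed.

Lemma det_realrep_uptri m (U : 'M[quat R]_m) : uptri beta U ->
  \det (realrep U) = (\prod_i dg U i) ^+ 4.
Proof.
move=> Ut; rewrite (det_realrep_tri (u := dg U)).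
- by rewrite prodrXl.
- by case: Ut.
- by move=> i; case: (uptri_dg Ut i).
Qed.

Lemma spectrum_gt0 m (S : 'M[quat R]_m) l : posdef beta S ->
  spectrum beta S l -> forall i, 0 < l 0 i.
Proof.
move=> [hS pS] [V [Vb VV1 VV2 SE]] i.
pose e : 'cV[quat R]_m := delta_mx i 0.
have := pS (conjtrq V *m e).
rewrite SE conjtrq_mul conjtrqK !mulmxA -(mulmxA _ V) VV2 mulmx1.
rewrite -(mulmxA _ V) VV2 mulmx1.
have -> : (conjtrq e *m diag_mx (map_mx (@sclq R) l) *m e) 0 0 0 0 = l 0 i.
  have -> : conjtrq e = delta_mx 0 i.
    apply/matrixP => a b; rewrite !mxE [(a == _) && _]andbC.
    by case: (_ && _); rewrite ?conjq1 ?raddf0.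
  rewrite -rowE -colE !mxE eqxx mulr1n inord4_0 mkqE//.
apply.
- apply: (mx_betaM hbeta); first exact: mx_beta_conjtr.
  move=> a b; rewrite mxE; case: (_ && _); last exact: in_beta0.
  exact: in_beta_scl.
- apply/eqP => /(congr1 (mulmx V)); rewrite mulmxA VV2 mul1mx mulmx0.
  by move=> /matrixP/(_ i 0)/eqP; rewrite !mxE !eqxx oner_eq0.
Qed.

(** The spectral decomposition behind [hdet] is arbitrary, but the determinant of
    the real representation does not see it: each eigenvalue is counted four times,
    and the unitary factors have determinants of product 1. *)
Lemma hdetP m (S : 'M[quat R]_m) : posdef beta S ->
  0 < hdet beta S /\ hdet beta S ^+ 4 = \det (realrep S).
Proof.
move=> pS; rewrite /hdet; case: xgetP => [l _ lS|]; last first.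
  by have [l lS] := spectral_herm pS.1; move=> /(_ l).
split; first by apply: prodr_gt0 => i _; exact: (spectrum_gt0 pS lS).
have [V [Vb VV1 VV2 SE]] := lS.
have -> : realrep S = realrep (conjtrq V) *m
    realrep (diag_mx (map_mx (@sclq R) l)) *m realrep V.
  by rewrite -2!realrepM -SE.
rewrite 2!det_mulmx det_realrep_diag det_realrep_tr.
rewrite mulrC mulrA -det_mulmx.
have -> : \det (realrep V *m realrep V) = 1.
  by rewrite det_mulmx -{1}det_realrep_tr -det_mulmx -realrepM VV1 realrep1.
by rewrite mul1r prodrXl.
Qed.

Lemma hdet_gt0 m (S : 'M[quat R]_m) : posdef beta S -> 0 < hdet beta S.
Proof. by move=> /hdetP[]. Qed.

(** Both sides are positive, so it suffices to compare fourth powers, which are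
    ordinary determinants. *)
Lemma hdet_congr m (S U : 'M[quat R]_m) : posdef beta S -> uptri beta U ->
  hdet beta (conjtrq U *m S *m U) = hdet beta S * (\prod_i dg U i) ^+ 2.
Proof.
move=> pS Ut.
have [V [_ UV VU]] := uptri_inv hbeta Ut.
have pC : posdef beta (conjtrq U *m S *m U).
  by apply: (posdef_congr hbeta (V := V)) => //; case: Ut.
have [h1 h2] := hdetP pS; have [h3 h4] := hdetP pC.
have d0 : 0 < \prod_i dg U i.
  by apply: prodr_gt0 => i _; case: (uptri_dg Ut i).
apply/eqP; rewrite -(@eqrXn2 _ 4%N)//; last 2 first.
- exact: ltW.
- by rewrite mulr_ge0// ltW ?exprn_gt0.
rewrite h4 2!realrepM 2!det_mulmx det_realrep_tr det_realrep_uptri//.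
by rewrite exprMn h2; apply/eqP; ring.
Qed.

Lemma hdet1 m : hdet beta (1%:M : 'M[quat R]_m) = 1.
Proof.
have [h1 h2] := hdetP (posdef1 R hbeta m).
apply/eqP; rewrite -(@eqrXn2 _ 4%N)//; last exact: ltW.
by rewrite h2 realrep1 expr1n.
Qed.

Lemma hdet_gram m (U : 'M[quat R]_m) : uptri beta U ->
  hdet beta (conjtrq U *m U) = (\prod_i dg U i) ^+ 2.
Proof.
move=> Ut; have := hdet_congr (posdef1 R hbeta m) Ut.
by rewrite mulmx1 hdet1 mul1r.
Qed.

End Spectral.

(** * Triangular changes of variables for Lebesgue measure *)

Section LebesgueTuple.
Variable R : realType.
Local Notation RR := (measurableTypeR R).
Local Open Scope ereal_scope.

(** Lebesgue measure is determined by the lengths of intervals. *)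
Lemma affine_measure (k c : R) (k0 : (0 < k)%R) (A : set RR) : measurable A ->
  pushforward lebesgue_measure (fun x : RR => (k * x + c)%R : RR) A =
  (k^-1)%:E * @lebesgue_measure R A.
Proof.
pose phi := fun x : RR => (k * x + c)%R : RR.
have mphi : measurable_fun setT phi.
  by apply: measurable_funD => //; exact: measurable_funM.
pose kn : {nonneg R} := NngNum (ltW k0).
pose m0 : {measure set RR -> \bar R} :=
  measure_function_pushforward__canonical__measure_function_Measure
    (@lebesgue_measure R) mphi.
pose m : {measure set RR -> \bar R} := mscale kn m0.
have mE : forall X, measurable X -> lebesgue_measure X = m X.
  apply: lebesgue_measure_unique => _ [[a b]] _ <- /=.
  rewrite /m /mscale /= /m0 /= /pushforward.
  have -> : phi @^-1` `]a, b]%classic = `]((a - c) / k)%R, ((b - c) / k)%R]%classic.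
    apply/seteqP; split=> x /=; rewrite !in_itv/= /phi ltr_pdivrMr// ler_pdivlMr//.
      by rewrite ltrBlDr lerBrDr mulrC.
    by rewrite ltrBlDr lerBrDr mulrC.
  rewrite !lebesgue_measure_itv/= !lte_fin ltr_pM2r ?invr_gt0// ltrD2r.
  case: ifPn => _; last by rewrite mule0.
  rewrite -!EFinB -EFinM -mulrBl mulrC divfK ?gt_eqF//.
  by rewrite opprB addrA subrK.
move=> mA; rewrite mE// /m /mscale /= muleA -EFinM mulVf ?gt_eqF// mul1e.
by [].
Qed.

Lemma integral_affine (k c : R) (h : RR -> \bar R) : (0 < k)%R ->
  measurable_fun setT h -> (forall x, 0 <= h x) ->
  \int[lebesgue_measure]_x h (k * x + c)%R =
  (k^-1)%:E * \int[lebesgue_measure]_x h x.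
Proof.
move=> k0 mh h0.
pose phi := fun x : RR => (k * x + c)%R : RR.
have mphi : measurable_fun setT phi.
  by apply: measurable_funD => //; exact: measurable_funM.
have := ge0_integral_pushforward mphi (@lebesgue_measure R) measurableT mh
  (fun y _ => h0 y).
rewrite preimage_setT => <-.
have ki : (0 <= k^-1)%R by rewrite invr_ge0 ltW.
pose kn : {nonneg R} := NngNum ki.
rewrite (eq_measure_integral (mscale kn (@lebesgue_measure R))).
  by rewrite ge0_integral_mscale.
by move=> A mA _; rewrite /mscale /=; exact: affine_measure.
Qed.

Section Step.
Variable n : nat.
Variable h : n.+1.-tuple RR -> \bar R.
Hypothesis mh : measurable_fun setT h.
Hypothesis h0 : forall t, 0 <= h t.

Lemma integral_tuple1 :
  \int[lebesgue_tuple R n.+1]_t h t =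
  \int[lebesgue_measure]_x \int[lebesgue_tuple R n]_t h (tcons (x, t)).
Proof.
have mc := @measurable_tcons R n.
have := ge0_integral_pushforward mc (lebesgue_measure \x lebesgue_tuple R n)
  measurableT mh (fun y _ => h0 y).
rewrite preimage_setT => E; rewrite [LHS]E.
have mhc : measurable_fun setT (h \o @tcons R n) by exact: measurableT_comp.
by rewrite (fubini_tonelli1 _ mhc)// => t; exact: h0.
Qed.

Lemma integral_tuple2 :
  \int[lebesgue_tuple R n.+1]_t h t =
  \int[lebesgue_tuple R n]_t \int[lebesgue_measure]_x h (tcons (x, t)).
Proof.
have mc := @measurable_tcons R n.
have := ge0_integral_pushforward mc (lebesgue_measure \x lebesgue_tuple R n)
  measurableT mh (fun y _ => h0 y).
rewrite preimage_setT => E; rewrite [LHS]E.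
have mhc : measurable_fun setT (h \o @tcons R n) by exact: measurableT_comp.
by rewrite (fubini_tonelli2 _ mhc)// => t; exact: h0.
Qed.
End Step.

Definition upd n (t : n.-tuple RR) (i : 'I_n) (v : RR) : n.-tuple RR :=
  [tuple if j == i then v else tnth t j | j < n].

Lemma updE n (t : n.-tuple RR) i v j :
  tnth (upd t i v) j = if j == i then v else tnth t j.
Proof. by rewrite tnth_mktuple. Qed.

Lemma measurable_upd d (T : measurableType d) n (f : T -> n.-tuple RR) (i : 'I_n)
  (g : T -> RR) : measurable_fun setT f -> measurable_fun setT g ->
  measurable_fun setT (fun x => upd (f x) i (g x)).
Proof.
move=> mf mg; apply/measurable_fun_tnthP => j.
rewrite (_ : _ \o _ = if j == i then g else fun x => tnth (f x) j).
  case: (j == i) => //; apply: (measurableT_comp (measurable_tnth j) mf).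
by apply/funext => x; rewrite /= updE; case: (j == i).
Qed.

Lemma upd_cons0 n x (t : n.-tuple RR) v :
  upd (tcons (x, t)) ord0 v = tcons (v, t).
Proof.
apply: eq_from_tnth => j; rewrite updE.
by case: (unliftP ord0 j) => [k ->|->]; rewrite ?tnthS ?tnth0.
Qed.

Lemma upd_consS n x (t : n.-tuple RR) j v :
  upd (tcons (x, t)) (lift ord0 j) v = tcons (x, upd t j v).
Proof.
apply: eq_from_tnth => i; rewrite updE.
case: (unliftP ord0 i) => [k ->|->]; last by rewrite !tnth0.
by rewrite !tnthS updE (inj_eq lift_inj).
Qed.

Lemma measurable_tcons_r n x : measurable_fun setT (fun t : n.-tuple RR => tcons (x, t)).
Proof. by apply: measurableT_comp; [exact: measurable_tcons|exact: pair1_measurable]. Qed.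

Lemma measurable_tcons_l n (t : n.-tuple RR) : measurable_fun setT (fun x => tcons (x, t)).
Proof. by apply: measurableT_comp; [exact: measurable_tcons|exact: pair2_measurable]. Qed.

(** By Tonelli the integral over the coordinate i is computed first, with the others
    fixed; there the map is affine. *)
Lemma integral_shear n (i : 'I_n) (k : R) (g : n.-tuple RR -> RR)
    (h : n.-tuple RR -> \bar R) : (0 < k)%R ->
  measurable_fun setT g -> (forall t v, g (upd t i v) = g t) ->
  measurable_fun setT h -> (forall t, 0 <= h t) ->
  \int[lebesgue_tuple R n]_t h (upd t i (k * tnth t i + g t)%R) =
  (k^-1)%:E * \int[lebesgue_tuple R n]_t h t.
Proof.
move=> k0; elim: n i g h => [[]//|n IH] i g h mg gi mh h0.
have ms : measurable_fun setT
    (fun t : n.+1.-tuple RR => upd t i (k * tnth t i + g t)%R).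
  apply: measurable_upd; first exact: measurable_id.
  apply: measurable_funD => //; apply: measurable_funM => //.
  exact: measurable_tnth.
have mhs := measurableT_comp mh ms.
case: (unliftP ord0 i) => [j|] iE; subst i.
  rewrite (integral_tuple1 mhs (fun t => h0 _)) (integral_tuple1 mh h0).
  rewrite -ge0_integralZl//; last 3 first.
  - have mhc : measurable_fun setT (h \o @tcons R n).
      by apply: measurableT_comp => //; exact: measurable_tcons.
    exact: (measurable_fun_fubini_tonelli_F _ mhc (fun=> h0 _)).
  - by move=> x _; apply: integral_ge0 => t _; exact: h0.
  - by rewrite lee_fin invr_ge0 ltW.
  apply: eq_integral => x _ /=.
  under eq_integral do rewrite upd_consS tnthS.
  apply: (IH j (fun t => g (tcons (x, t))) (fun t => h (tcons (x, t)))) => //.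
  - by apply: measurableT_comp => //; exact: measurable_tcons_r.
  - by move=> t v; rewrite -upd_consS gi.
  - by apply: measurableT_comp => //; exact: measurable_tcons_r.
rewrite (integral_tuple2 mhs (fun t => h0 _)) (integral_tuple2 mh h0).
rewrite -ge0_integralZl//; last 3 first.
- have mhc : measurable_fun setT (h \o @tcons R n).
    by apply: measurableT_comp => //; exact: measurable_tcons.
  exact: (measurable_fun_fubini_tonelli_G _ mhc (fun=> h0 _)).
- by move=> x _; apply: integral_ge0 => t _; exact: h0.
- by rewrite lee_fin invr_ge0 ltW.
apply: eq_integral => t _ /=.
under eq_integral => x _.
  rewrite upd_cons0 tnth0 (_ : g (tcons (x, t)) = g (tcons (0%R : RR, t))); last first.
    by rewrite -(upd_cons0 0%R t x) gi.
  over.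
apply: (@integral_affine _ _ (fun x => h (tcons (x, t)))) => //.
by apply: measurableT_comp => //; exact: measurable_tcons_l.
Qed.

(** A composition of shears, one for each coordinate. The coordinates of high rank
    are changed first, so that every g i still reads the original values of the
    coordinates of lower rank. *)
Lemma integral_triangular n (r : 'I_n -> nat) (k : 'I_n -> R)
    (g : 'I_n -> n.-tuple RR -> RR) (h : n.-tuple RR -> \bar R) :
  (forall i, 0 < k i)%R -> (forall i, measurable_fun setT (g i)) ->
  (forall i t t', (forall j, (r j < r i)%N -> tnth t j = tnth t' j) ->
     g i t = g i t') ->
  measurable_fun setT h -> (forall t, 0 <= h t) ->
  \int[lebesgue_tuple R n]_t h [tuple (k i * tnth t i + g i t)%R | i < n] =
  ((\prod_i k i)^-1)%:E * \int[lebesgue_tuple R n]_t h t.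
Proof.
move=> k0 mg gr mh h0.
(* F s changes only the coordinates in s *)
pose F (s : seq 'I_n) (t : n.-tuple RR) : n.-tuple RR :=
  [tuple if i \in s then (k i * tnth t i + g i t)%R else tnth t i | i < n].
have mi i : measurable_fun setT (fun t : n.-tuple RR => (k i * tnth t i + g i t)%R).
  apply: measurable_funD; last exact: mg.
  apply: measurable_funM => //.
  exact: measurable_tnth.
suff H s : uniq s -> sorted (relpre r leq) s ->
    forall h : n.-tuple RR -> \bar R, measurable_fun setT h ->
      (forall t, 0 <= h t) ->
    \int[lebesgue_tuple R n]_t h (F s t) =
    ((\prod_(i <- s) k i)^-1)%:E * \int[lebesgue_tuple R n]_t h t.
  pose s := sort (relpre r leq) (enum 'I_n).
  have ps : perm_eq s (enum 'I_n) by rewrite perm_sort.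
  rewrite -(big_enum _ _ _ k) -(perm_big _ ps) -(H s)//.
  - apply: eq_integral => t _; congr h; apply: eq_from_tnth => i.
    by rewrite !tnth_mktuple (perm_mem ps) mem_enum.
  - by rewrite (perm_uniq ps) enum_uniq.
  - by apply: sort_sorted => i j; exact: leq_total.
elim: s => [|i s IH] /=.
  move=> _ _ {mh h0}h mh h0; rewrite big_nil invr1 mul1e.
  by apply: eq_integral => t _; congr h; apply: eq_from_tnth => i; rewrite tnth_mktuple.
move=> /andP[si us] ps {mh h0}h mh h0.
pose sh t := upd t i (k i * tnth t i + g i t)%R.
have msh : measurable_fun setT sh.
  by apply: measurable_upd; [exact: measurable_id|exact: mi].
have ss : sorted (relpre r leq) s := path_sorted ps.
have ri j : j \in s -> (r i <= r j)%N.
  have tr : transitive (relpre r leq) by move=> a b c; exact: leq_trans.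
  by move=> js; have /allP/(_ j js) := order_path_min tr ps.
(* i has the lowest rank, so F s leaves alone the coordinates that g i reads *)
have FE t : F (i :: s) t = sh (F s t).
  apply: eq_from_tnth => j; rewrite updE !tnth_mktuple in_cons.
  case: eqVneq => [->|ji] //=.
  rewrite (negbTE si); congr (_ + _)%R; apply: gr => l rl.
  rewrite tnth_mktuple; case: ifPn => // /ri.
  by rewrite leqNgt rl.
under eq_integral do rewrite FE.
rewrite (IH us ss (h \o sh) (measurableT_comp mh msh) (fun t => h0 _)).
rewrite big_cons invfM mulrC EFinM -muleA; congr (_ * _).
apply: (integral_shear (k0 i) (mg i) _ mh h0) => t v; apply: gr => j rj.
by rewrite updE; case: eqVneq => // ji; rewrite ji ltnn in rj.
Qed.

End LebesgueTuple.

(** * Measurability *)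

Section MeasurableMatrix.
Variable R : realType.

Lemma measurable_entry d (T : measurableType d) m n (i : 'I_m) (j : 'I_n) :
  measurable_fun setT (fun A : 'M[T]_(m, n) => A i j).
Proof.
move=> _ Y mY; rewrite setTI; apply: sub_gen_smallest.
exists (i, j) => //; exists Y => //.
by rewrite setTI.
Qed.

Section Fun.
Context {d} {T : measurableType d}.

Lemma measurable_mxP m n (f : T -> 'M[quat R]_(m, n)) :
  measurable_fun setT f <->
  forall i j k, measurable_fun setT (fun t => f t i j 0 k : R).
Proof.
split=> [mf i j k|mf].
  have m1 := measurableT_comp (measurable_entry (T := quat R) i j) mf.
  exact: (measurableT_comp (measurable_entry (T := R) 0 k) m1).
apply: measurable_fun_entries => i j; apply: measurable_fun_entries => z k.
by rewrite (ord1 z).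
Qed.

Lemma measurable_mulq (x y : T -> quat R) :
  (forall k, measurable_fun setT (fun t => x t 0 k : R)) ->
  (forall k, measurable_fun setT (fun t => y t 0 k : R)) ->
  forall k, measurable_fun setT (fun t => (x t * y t) 0 k : R).
Proof.
move=> mx my.
have mM i j := measurable_funM (mx i) (my j).
elim/ord4P; under eq_fun do rewrite mulqE;
  do ?[apply: measurable_funB|apply: measurable_funD]; exact: mM.
Qed.

Lemma measurable_mulmx m n p (f : T -> 'M[quat R]_(m, n))
    (g : T -> 'M[quat R]_(n, p)) :
  measurable_fun setT f -> measurable_fun setT g ->
  measurable_fun setT (fun t => f t *m g t).
Proof.
move=> /measurable_mxP mf /measurable_mxP mg; apply/measurable_mxP => i j k.
rewrite (_ : (fun t => _) = fun t => \sum_l (f t i l * g t l j) 0 k).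
  by apply: measurable_sum => l; exact: measurable_mulq.
by apply/funext => t; rewrite mxE summxE.
Qed.

Lemma measurable_addmx m n (f g : T -> 'M[quat R]_(m, n)) :
  measurable_fun setT f -> measurable_fun setT g ->
  measurable_fun setT (fun t => f t + g t).
Proof.
move=> /measurable_mxP mf /measurable_mxP mg; apply/measurable_mxP => i j k.
rewrite (_ : (fun t => _) = (fun t => f t i j 0 k) \+ (fun t => g t i j 0 k)).
  exact: measurable_funD.
by apply/funext => t; rewrite addqmxE quat_add0.
Qed.

Lemma measurable_oppmx m n (f : T -> 'M[quat R]_(m, n)) :
  measurable_fun setT f -> measurable_fun setT (fun t => - f t).
Proof.
move=> /measurable_mxP mf; apply/measurable_mxP => i j k.
rewrite (_ : (fun t => _) = (\- (fun t => f t i j 0 k))).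
  exact: measurable_funN.
by apply/funext => t; rewrite !mxE.
Qed.

Lemma measurable_conjtrq m n (f : T -> 'M[quat R]_(m, n)) :
  measurable_fun setT f -> measurable_fun setT (fun t => conjtrq (f t)).
Proof.
move=> /measurable_mxP mf; apply/measurable_mxP => i j k.
rewrite (_ : (fun t => _) = if k == 0 then fun t => f t j i 0 k
    else (\- (fun t => f t j i 0 k))).
  by case: (k == 0); [exact: mf|exact: measurable_funN].
by apply/funext => t; rewrite !mxE; case: (k == 0).
Qed.

Lemma measurable_sc m (c : T -> R) :
  measurable_fun setT c ->
  measurable_fun setT (fun t => (sclq (c t))%:M : 'M[quat R]_m).
Proof.
move=> mc; apply/measurable_mxP => i j k.
rewrite (_ : (fun t => _) = if (i == j) && (k == 0) then c else cst 0).
  by case: ifP.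
apply/funext => t; rewrite mxE; case: (i == j); rewrite /= ?mulr1n ?mulr0n.
  rewrite -[k]inord_val sclqE// inord4_0 -val_eqE /= !inordK//.
  by case: ifP.
by rewrite mxE.
Qed.

Lemma measurable_mxsub m n p q (f : T -> 'M[quat R]_(m, n))
    (a : 'I_p -> 'I_m) (b : 'I_q -> 'I_n) :
  measurable_fun setT f -> measurable_fun setT (fun t => mxsub a b (f t)).
Proof.
move=> /measurable_mxP mf; apply/measurable_mxP => i j k.
under eq_fun do rewrite mxE.
exact: mf.
Qed.

Lemma measurable_block m n p q (f1 : T -> 'M[quat R]_(m, n))
    (f2 : T -> 'M[quat R]_(m, p)) (f3 : T -> 'M[quat R]_(q, n))
    (f4 : T -> 'M[quat R]_(q, p)) :
  measurable_fun setT f1 -> measurable_fun setT f2 ->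
  measurable_fun setT f3 -> measurable_fun setT f4 ->
  measurable_fun setT (fun t => block_mx (f1 t) (f2 t) (f3 t) (f4 t)).
Proof.
move=> /measurable_mxP m1 /measurable_mxP m2 /measurable_mxP m3
  /measurable_mxP m4; apply/measurable_mxP => i j k.
case: (split_ordP i) => i' ->; case: (split_ordP j) => j' ->.
- by under eq_fun do rewrite block_mxEul; exact: m1.
- by under eq_fun do rewrite block_mxEur; exact: m2.
- by under eq_fun do rewrite block_mxEdl; exact: m3.
- by under eq_fun do rewrite block_mxEdr; exact: m4.
Qed.

Lemma measurable_pivot m (f : T -> 'M[quat R]_(1 + m)) :
  measurable_fun setT f -> measurable_fun setT (fun t => pivot (f t)).
Proof. by move=> /measurable_mxP mf; rewrite /pivot; under eq_fun do rewrite !mxE; exact: mf. Qed.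

(** Inversion is discontinuous at 0, but it is built from products and a real
    power, whose measurability holds on the whole line. *)
Lemma measurable_inv (c : T -> R) :
  measurable_fun setT c -> measurable_fun setT (fun t => (c t)^-1 : R).
Proof.
move=> mc; have h : (fun t => (c t)^-1) = c \* (fun t => (c t ^+ 2) `^ (-1)).
  apply/funext => t; rewrite /= powR_inv1 ?sqr_ge0//.
  have [->|c0] := eqVneq (c t) 0; first by rewrite invr0 mul0r.
  by rewrite expr2 invfM mulrA divff// mul1r.
rewrite h; apply: measurable_funM => //.
apply: (@measurableT_comp _ _ _ _ _ _ (fun x : R => x `^ (-1)) setT
  (fun t => c t ^+ 2)).
  exact: measurable_powR.
exact: measurable_funX.
Qed.

Lemma measurable_schur m (f : T -> 'M[quat R]_(1 + m)) :
  measurable_fun setT f -> measurable_fun setT (fun t => schur (f t)).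
Proof.
move=> mf; rewrite /schur.
have mu : measurable_fun setT (fun t => ursubmx (f t)).
  move/measurable_mxP : mf => mf; apply/measurable_mxP => i j k.
  by under eq_fun do rewrite !mxE; exact: mf.
apply: measurable_addmx.
  move/measurable_mxP : mf => mf; apply/measurable_mxP => i j k.
  by under eq_fun do rewrite !mxE; exact: mf.
apply: measurable_oppmx; apply: measurable_mulmx.
  by apply: measurable_sc; apply: measurable_inv; exact: measurable_pivot.
by apply: measurable_mulmx => //; exact: measurable_conjtrq.
Qed.

Lemma measurable_chol m (f : T -> 'M[quat R]_m) :
  measurable_fun setT f -> measurable_fun setT (fun t => chol (f t)).
Proof.
elim: m f => [//|m IH] f mf.
have mp : measurable_fun setT (fun t => pivot (f t : 'M[quat R]_(1 + m))).
  exact: measurable_pivot.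
have ms : measurable_fun setT (fun t => Num.sqrt (pivot (f t : 'M[quat R]_(1 + m)))).
  apply: (measurableT_comp _ mp).
  by apply: continuous_measurable_fun; exact: sqrt_continuous.
apply: (@measurable_block 1 1 m m) => //.
- exact: measurable_sc.
- apply: measurable_mulmx; first by apply: measurable_sc; exact: measurable_inv.
  move/measurable_mxP : mf => mf; apply/measurable_mxP => i j k.
  by under eq_fun do rewrite !mxE; exact: mf.
- by apply: IH; exact: measurable_schur.
Qed.

Lemma measurable_invchol m (f : T -> 'M[quat R]_m) :
  measurable_fun setT f -> measurable_fun setT (fun t => invchol (f t)).
Proof.
elim: m f => [//|m IH] f mf.
have mp : measurable_fun setT (fun t => pivot (f t : 'M[quat R]_(1 + m))).
  exact: measurable_pivot.
have ms : measurable_fun setT (fun t => Num.sqrt (pivot (f t : 'M[quat R]_(1 + m)))).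
  apply: (measurableT_comp _ mp).
  by apply: continuous_measurable_fun; exact: sqrt_continuous.
have mW : measurable_fun setT (fun t => invchol (schur (f t : 'M[quat R]_(1 + m)))).
  by apply: IH; exact: measurable_schur.
apply: (@measurable_block 1 1 m m) => //.
- by apply: measurable_sc; exact: measurable_inv.
- apply: measurable_oppmx; apply: measurable_mulmx.
    by apply: measurable_sc; exact: measurable_inv.
  apply: measurable_mulmx => //.
  move/measurable_mxP : mf => mf; apply/measurable_mxP => i j k.
  by under eq_fun do rewrite !mxE; exact: mf.
Qed.

Lemma measurable_pivots m (f : T -> 'M[quat R]_m) :
  measurable_fun setT f -> measurable [set t | pivots_gt0 (f t)].
Proof.
elim: m f => [|m IH] f mf.
  by rewrite (_ : [set t | _] = setT)//; apply/seteqP; split.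
have mp : measurable_fun setT (fun t => pivot (f t : 'M[quat R]_(1 + m))).
  exact: measurable_pivot.
rewrite (_ : [set t | _] = ((fun t => pivot (f t : 'M[quat R]_(1 + m))) @^-1` `]0, +oo[) `&`
   [set t | pivots_gt0 (schur (f t : 'M[quat R]_(1 + m)))]).
  apply: measurableI; last by apply: IH; exact: measurable_schur.
  by rewrite -[X in measurable X]setTI; exact: mp.
by apply/seteqP; split=> t /=; rewrite in_itv/= andbT => /andP.
Qed.

Lemma measurable_eqr (f g : T -> R) : measurable_fun setT f ->
  measurable_fun setT g -> measurable [set t | f t = g t].
Proof.
move=> mf mg.
rewrite (_ : [set t | _] = (f \- g) @^-1` [set 0]).
  rewrite -[X in measurable X]setTI; apply: measurable_funB => //.
apply/seteqP; split=> t /=; first by move=> ->; rewrite subrr.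
by move=> /eqP; rewrite subr_eq0 => /eqP.
Qed.

(** The Hermitian matrices are cut out by equations between entries, and the pivots
    are measurable. *)
Lemma measurable_posdef beta m (hbeta : beta \in [:: 1%N; 2%N; 4%N])
    (f : T -> 'M[quat R]_m) :
  measurable_fun setT f -> measurable [set t | posdef beta (f t)].
Proof.
move=> mf.
rewrite (_ : [set t | _] = (\bigcap_(p in [set: 'I_m * 'I_m * 'I_4])
   ([set t | f t p.1.1 p.1.2 0 p.2 =
       if (beta <= p.2)%N then 0 else (conjtrq (f t)) p.1.1 p.1.2 0 p.2] `&`
    [set t | (conjtrq (f t)) p.1.1 p.1.2 0 p.2 = f t p.1.1 p.1.2 0 p.2])) `&`
    [set t | pivots_gt0 (f t)]).
  apply: measurableI; last exact: measurable_pivots.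
  have mc := measurable_conjtrq mf.
  move/measurable_mxP in mf; move/measurable_mxP in mc.
  apply: fin_bigcap_measurable; first exact: finite_finset.
  move=> p _; apply: measurableI; apply: measurable_eqr.
  - exact: mf.
  - by case: (beta <= p.2)%N; [exact: measurable_cst|exact: mc].
  - exact: mc.
  - exact: mf.
apply/seteqP; split=> t /=.
  move=> /(posdefP hbeta)[[hb hh] hp]; split=> // -[[i j] k] _ /=.
  rewrite hh; split=> //; case: ifP => // kb; exact: hb.
move=> [h hp]; apply/(posdefP hbeta); split=> //; split.
  by move=> i j k kb; have [/= -> _] := h (i, j, k) I; rewrite kb.
apply/matrixP => i j; apply: quatP => k.
by have [_ /= ->] := h (i, j, k) I.
Qed.

End Fun.
End MeasurableMatrix.

(** * Lebesgue measure on Hermitian matrices *)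

Lemma subqmxE (K : zmodType) p q (A B : 'M[K]_(p, q)) i j :
  (A - B) i j = A i j - B i j.
Proof. by rewrite !mxE. Qed.

Lemma quat_sub0 (K : comNzRingType) (x y : quat K) i :
  (x - y) 0 i = x 0 i - y 0 i.
Proof. by rewrite !mxE. Qed.

Section HermCoord.
Variables (R : realType) (beta : nat).
Hypothesis hbeta : beta \in [:: 1%N; 2%N; 4%N].
Variable m : nat.
Local Notation N := #|{: hcoord beta m}|.
Local Notation RR := (measurableTypeR R).
Local Notation mat := 'M[quat R]_m.
Local Notation mu := (lebesgue_herm R beta m).

Lemma beta_gt0 : (0 < beta)%N. Proof. by case: beta hbeta. Qed.

(** The real coordinates, inverse to [herm_of] on Hermitian matrices. *)
Definition hc (A : mat) (p : hcoord beta m) : R :=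
  A (val p).1.1 (val p).1.2 0 (val p).2.

Lemma hcond_le (p : hcoord beta m) : ((val p).1.1 <= (val p).1.2)%N.
Proof.
by case: p => -[[i j] k] /= /orP[/andP[/eqP-> _]//|/andP[/ltnW]].
Qed.

Lemma upper_entryE (x : hcoord beta m -> R) p :
  upper_entry x (val p).1.1 (val p).1.2 0 (val p).2 = x p.
Proof.
rewrite mxE; case: p => -[[i j] k] /= h.
by rewrite insubT.
Qed.

Lemma upper_entry_junk (x : hcoord beta m -> R) (i j : 'I_m) (k : 'I_4) :
  ~~ [|| (i == j) && (k == ord0) | (i < j)%N && (k < beta)%N] ->
  upper_entry x i j 0 k = 0.
Proof. by move=> h; rewrite mxE insubF//; exact: negbTE. Qed.

Lemma hc_herm_of (x : hcoord beta m -> R) p : hc (herm_of x) p = x p.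
Proof. by rewrite /hc mxE hcond_le upper_entryE. Qed.

Lemma herm_of_herm (x : hcoord beta m -> R) : hermmx beta (herm_of x).
Proof.
have junk i j (k : 'I_4) : (beta <= k)%N -> upper_entry x i j 0 k = 0.
  move=> kb; apply: upper_entry_junk; rewrite [(k < beta)%N]ltnNge kb andbF orbF.
  rewrite negb_and; apply/orP; right; apply/eqP => k0.
  by move: kb; rewrite k0 leqNgt beta_gt0.
split.
  move=> i j k kb; rewrite mxE; case: ifP => _; first exact: junk.
  by rewrite mxE junk// oppr0 if_same.
apply/matrixP => i j; rewrite !mxE.
case: (ltngtP i j) => [ij|ji|ij].
- by rewrite conjqK.
- by [].
- have -> : i = j by apply/val_inj.
  apply: quatP => k; rewrite mxE; case: ifPn => // k0.
  by rewrite upper_entry_junk ?oppr0// ltnn (negbTE k0) andbF.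
Qed.

(** An entry and its mirror image share their coordinates and have the same i + j,
    so the coordinates below a given rank determine the entries below that rank. *)
Lemma herm_entry (S S' : mat) (B : nat) : hermmx beta S -> hermmx beta S' ->
  (forall q : hcoord beta m, ((val q).1.1 + (val q).1.2 < B)%N -> hc S q = hc S' q) ->
  forall i j : 'I_m, (i + j < B)%N -> S i j = S' i j.
Proof.
move=> [Sb Sh] [Sb' Sh'] h.
have up (i j : 'I_m) : (i <= j)%N -> (i + j < B)%N -> S i j = S' i j.
  move=> ij ijB; apply: quatP => k.
  have [kc|kc] := boolP [|| (i == j) && (k == ord0) | (i < j)%N && (k < beta)%N].
    exact: (h (exist _ (i, j, k) kc)).
  have [kb|kb] := ltnP k beta; last by rewrite Sb ?Sb'.
  move: kc; rewrite kb andbT negb_or negb_and -leqNgt => /andP[kc ji].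
  have e : i = j by apply/val_inj/eqP; rewrite eqn_leq ij ji.
  move: kc; rewrite e eqxx /= => k0.
  have z (A : mat) : conjtrq A = A -> A j j 0 k = 0.
    move=> /matrixP/(_ j j)/rowP/(_ k); rewrite !mxE.
    by rewrite (_ : (k == 0) = false) ?(negbTE k0)// => e'; lra.
  by rewrite !z.
move=> i j; case: (leqP i j) => [ij|/ltnW ji] ijB; first exact: up.
rewrite -Sh -Sh' !mxE up//.
by rewrite addnC.
Qed.

Lemma herm_eq (S S' : mat) : hermmx beta S -> hermmx beta S' ->
  hc S =1 hc S' -> S = S'.
Proof.
move=> hS hS' h; apply/matrixP => i j.
by apply: (@herm_entry _ _ (i + j).+1 hS hS').
Qed.

Definition tup (A : mat) : N.-tuple RR := [tuple hc A (enum_val i) | i < N].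

Lemma herm_of_tupleK (t : N.-tuple RR) : tup (herm_of_tuple t) = t.
Proof.
by apply: eq_from_tnth => i; rewrite tnth_mktuple hc_herm_of enum_valK.
Qed.

Lemma hc_tuple (t : N.-tuple RR) p : hc (herm_of_tuple t) p = tnth t (enum_rank p).
Proof. by rewrite hc_herm_of. Qed.

Lemma herm_tuple (t : N.-tuple RR) : hermmx beta (herm_of_tuple t : mat).
Proof. exact: herm_of_herm. Qed.

Lemma tupK (A : mat) : hermmx beta A -> herm_of_tuple (tup A) = A.
Proof.
move=> hA; apply: (herm_eq (herm_tuple _) hA) => p.
by rewrite hc_tuple tnth_mktuple enum_rankK.
Qed.

Lemma measurable_hc p : measurable_fun setT (fun A => hc A p).
Proof. by move/measurable_mxP : (@measurable_id _ mat setT); exact. Qed.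

Lemma measurable_tup : measurable_fun setT tup.
Proof.
apply/measurable_fun_tnthP => i.
rewrite (_ : _ \o _ = fun A => hc A (enum_val i)); first exact: measurable_hc.
by apply/funext => A; rewrite /= tnth_mktuple.
Qed.

Lemma herm_sigma_finite : sigma_finite setT mu.
Proof.
have /sigma_finiteP[F [FT ndF Foo]] := sigma_finiteT (lebesgue_tuple R N).
exists (fun k => tup @^-1` F k).
  by rewrite -preimage_bigcup (_ : \bigcup_k _ = setT) ?preimage_setT.
move=> k; have [mF Fk] := Foo k; split.
  by rewrite -[X in measurable X]setTI; exact: measurable_tup.
rewrite /lebesgue_herm /= /pushforward -comp_preimage.
rewrite (_ : tup \o _ = id) ?preimage_id//.
by apply/funext => t; exact: herm_of_tupleK.
Qed.

End HermCoord.

(** The measure [lebesgue_herm] as a sigma-finite measure, which product measures and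
    Tonelli require. *)
Definition herm_measure (R : realType) beta m : set 'M[quat R]_m -> \bar R :=
  lebesgue_herm R beta m.
HB.instance Definition _ (R : realType) beta m :=
  isMeasure.Build _ _ R (@herm_measure R beta m)
    (measure0 (lebesgue_herm R beta m)) (measure_ge0 (lebesgue_herm R beta m))
    (@measure_semi_sigma_additive _ _ _ (lebesgue_herm R beta m)).
HB.instance Definition _ (R : realType) beta m :=
  Measure_isSigmaFinite.Build _ _ R (@herm_measure R beta m)
    (@herm_sigma_finite R beta m).

Section HermIntegral.
Variables (R : realType) (beta : nat).
Hypothesis hbeta : beta \in [:: 1%N; 2%N; 4%N].
Variable m : nat.
Local Notation N := #|{: hcoord beta m}|.
Local Notation RR := (measurableTypeR R).
Local Notation mat := 'M[quat R]_m.
Local Notation mu := (@herm_measure R beta m).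

Local Open Scope ereal_scope.

Lemma integral_herm (h : mat -> \bar R) : measurable_fun setT h ->
  (forall S, 0 <= h S) ->
  \int[mu]_S h S = \int[lebesgue_tuple R N]_t h (herm_of_tuple t).
Proof.
move=> mh h0.
have := ge0_integral_pushforward (@measurable_herm_of_tuple R beta m)
  (lebesgue_tuple R N) measurableT mh (fun y _ => h0 y).
by rewrite preimage_setT.
Qed.

(** A change of variables that is triangular when the coordinate p is ranked by the
    sum of its row and column indices: that rank is the same for an entry and its
    mirror image, and it makes congruences by triangular matrices triangular. *)
Lemma integral_herm_triangular (F : mat -> mat) (k : hcoord beta m -> R)
    (g : hcoord beta m -> mat -> R) (h : mat -> \bar R) :
  (forall p, 0 < k p)%R ->
  (forall S, hermmx beta S -> hermmx beta (F S)) ->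
  (forall S p, hermmx beta S -> hc (F S) p = k p * hc S p + g p S)%R ->
  (forall p, measurable_fun setT (g p)) ->
  (forall (p : hcoord beta m) S S', hermmx beta S -> hermmx beta S' ->
     (forall i j : 'I_m, (i + j < (val p).1.1 + (val p).1.2)%N -> S i j = S' i j) ->
     g p S = g p S') ->
  measurable_fun setT h -> (forall S, 0 <= h S) -> measurable_fun setT F ->
  \int[mu]_S h (F S) = ((\prod_p k p)^-1)%:E * \int[mu]_S h S.
Proof.
move=> k0 hF FE mg gE mh h0 mF.
rewrite (integral_herm (measurableT_comp mh mF) (fun=> h0 _)) (integral_herm mh h0).
pose r (i : 'I_N) := let p := val (enum_val i) in (p.1.1 + p.1.2)%N.
pose G (i : 'I_N) (t : N.-tuple RR) : RR := g (enum_val i) (herm_of_tuple t).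
have mho : measurable_fun setT (fun t : N.-tuple RR => h (herm_of_tuple t)).
  exact: (measurableT_comp mh (@measurable_herm_of_tuple R beta m)).
have mG i : measurable_fun setT (G i).
  exact: (measurableT_comp (mg _) (@measurable_herm_of_tuple R beta m)).
have Gr i (t t' : N.-tuple RR) :
    (forall j, (r j < r i)%N -> tnth t j = tnth t' j) -> G i t = G i t'.
  move=> tt'; apply: gE; [exact: (herm_tuple hbeta)|exact: (herm_tuple hbeta)|].
  apply: herm_entry; [exact: (herm_tuple hbeta)|exact: (herm_tuple hbeta)|].
  move=> q rq; rewrite !hc_tuple; apply: tt'.
  by rewrite /r enum_rankK.
have := @integral_triangular R N r (fun i => k (enum_val i)) G
  (fun t => h (herm_of_tuple t)) (fun=> k0 _) mG Gr mho (fun=> h0 _).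
have -> : (\prod_(i < N) k (enum_val i))%R = (\prod_p k p)%R.
  by apply/esym; apply: reindex; exact/onW_bij/enum_val_bij.
move=> <-; apply: eq_integral => t _; congr h.
rewrite -[LHS](tupK hbeta); last by apply: hF; exact: (herm_tuple hbeta).
congr herm_of_tuple; apply: eq_from_tnth => i; rewrite !tnth_mktuple.
by rewrite FE ?hc_tuple ?enum_valK//; exact: (herm_tuple hbeta).
Qed.

Lemma integral_herm_translation (C : mat) (h : mat -> \bar R) :
  hermmx beta C -> measurable_fun setT h -> (forall S, 0 <= h S) ->
  \int[mu]_S h (S + C)%R = \int[mu]_S h S.
Proof.
move=> hC mh h0.
have := @integral_herm_triangular (fun S => S + C)%R (fun=> 1%R)
  (fun p _ => hc C p) h.
rewrite big1// invr1 mul1e; apply => //.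
- move=> S [Sb Sh]; split; first by apply: mx_betaD => //; case: hC.
  by rewrite raddfD /= Sh; case: hC => _ ->.
- by move=> S p _; rewrite mul1r /hc addqmxE quat_add0.
- by apply: measurable_addmx => //; exact: measurable_cst.
Qed.

(** Applied to the difference D of two Hermitian matrices that agree below the rank of
    (i, j): up to the diagonal term, the entry (i, j) of a congruence only involves
    entries of lower rank. *)
Lemma congr_entry (U D : mat) (i j : 'I_m) :
  (forall a b : 'I_m, (b < a)%N -> U a b = 0%R) ->
  (forall a b : 'I_m, (a + b < i + j)%N -> D a b = 0%R) ->
  ((conjtrq U *m D *m U) i j = conjq (U i i) * D i j * U j j)%R.
Proof.
move=> Ut D0; rewrite mxE (bigD1 j)//= [X in (_ + X)%R]big1 ?addr0 => [|b bj].
  congr (_ * _)%R; rewrite mxE (bigD1 i)//= !mxE big1 ?addr0// => a ai.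
  rewrite !mxE; have [ia|ai'] := ltnP i a; first by rewrite Ut// raddf0 mul0r.
  rewrite D0 ?mulr0// ltn_add2r ltn_neqAle ai' andbT.
  by rewrite (inj_eq val_inj).
have [jb|bj'] := ltnP j b; first by rewrite Ut// mulr0.
rewrite mxE big1 ?mul0r// => a _; rewrite !mxE.
have [ia|ai] := ltnP i a; first by rewrite Ut// raddf0 mul0r.
rewrite D0 ?mulr0// -addnS leq_add// ltn_neqAle bj' andbT.
by rewrite (inj_eq val_inj).
Qed.

Lemma integral_herm_congr (U : mat) (h : mat -> \bar R) : uptri beta U ->
  measurable_fun setT h -> (forall S, 0 <= h S) ->
  \int[mu]_S h (conjtrq U *m S *m U)%R =
  ((\prod_(p : hcoord beta m) (dg U (val p).1.1 * dg U (val p).1.2))^-1)%:E *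
    \int[mu]_S h S.
Proof.
move=> Ut mh h0; have [Ub Uz _] := Ut; have Ud := uptri_dg Ut.
pose d (p : hcoord beta m) : R := (dg U (val p).1.1 * dg U (val p).1.2)%R.
have mF : measurable_fun setT (fun S : mat => conjtrq U *m S *m U)%R.
  by do 2 apply: measurable_mulmx => //; exact: measurable_cst.
apply: (@integral_herm_triangular (fun S => conjtrq U *m S *m U)%R d
  (fun p S => hc (conjtrq U *m S *m U) p - d p * hc S p)%R h) => //.
- by move=> p; apply: mulr_gt0; [case: (Ud (val p).1.1)|case: (Ud (val p).1.2)].
- by move=> S hS; exact: (herm_congr hbeta Ub hS).
- by move=> S p _; rewrite addrC subrK.
- move=> p; apply: measurable_funB.
    exact: (measurableT_comp (measurable_hc p) mF).
  by apply: measurable_funM => //; exact: measurable_hc.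
- move=> p S S' hS hS' SS'; apply/eqP; rewrite -subr_eq0; apply/eqP.
  set i := (val p).1.1 in SS' *; set j := (val p).1.2 in SS' *.
  have : ((conjtrq U *m (S - S') *m U) i j =
      conjq (U i i) * (S - S') i j * U j j)%R.
    by apply: congr_entry => // a b ab; rewrite subqmxE SS'// subrr.
  rewrite mulmxBr mulmxBl !subqmxE => /rowP/(_ (val p).2).
  rewrite (Ud i).2 (Ud j).2 conjq_scl -sclqC mulrA -rmorphM sclq_mulE.
  rewrite !quat_sub0 /hc /d -/i -/j.
  suff G (X X' s s' ui uj : R) : (X - X' = uj * ui * (s - s') ->
      X - ui * uj * s - (X' - ui * uj * s') = 0)%R by exact: G.
  move=> E; have -> : (X - ui * uj * s - (X' - ui * uj * s') =
    (X - X') - uj * ui * (s - s'))%R by ring.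
  by rewrite E subrr.
Qed.

End HermIntegral.

(** * Leading minors and the functions q *)

(** The factor u_i comes twice from the diagonal entry at i, and beta times for each of
    the n other indices, from the entry above the diagonal that pairs it with i. *)
Lemma prod_hcoord (R : realType) (beta n : nat)
    (hbeta : beta \in [:: 1%N; 2%N; 4%N]) (u : 'I_n.+1 -> R) :
  \prod_(p : hcoord beta n.+1) (u (val p).1.1 * u (val p).1.2) =
  (\prod_i u i) ^+ (beta * n + 2).
Proof.
rewrite -(big_sub (fun p : 'I_n.+1 * 'I_n.+1 * 'I_4 =>
  [|| (p.1.1 == p.1.2) && (p.2 == ord0) | (p.1.1 < p.1.2)%N && (p.2 < beta)%N])
  (fun p => u p.1.1 * u p.1.2)) big_mkcond /=.
rewrite -(pair_bigA _ (fun q k => if (q, k) \in (fun p : 'I_n.+1 * 'I_n.+1 * 'I_4 =>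
  [|| (p.1.1 == p.1.2) && (p.2 == ord0) | (p.1.1 < p.1.2)%N && (p.2 < beta)%N])
  then u q.1 * u q.2 else 1))/=.
pose f (i j : 'I_n.+1) := if (i < j)%N then u i ^+ beta else 1.
pose g (i j : 'I_n.+1) := if (i < j)%N then u j ^+ beta else 1.
pose h (i j : 'I_n.+1) := if i == j then u i ^+ 2 else 1.
transitivity (\prod_i \prod_j (h i j * (f i j * g i j))).
  rewrite [RHS]pair_bigA /=; apply: eq_bigr => -[i j] _ /=.
  rewrite -big_mkcond /= prodr_const /h /f /g.
  case: (eqVneq i j) => [->|ij].
    rewrite [X in _ ^+ X](_ : _ = 1%N); first by rewrite ltnn !mulr1 expr2.
    rewrite (eq_card (B := pred1 (ord0 : 'I_4))) ?card1// => k.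
    by rewrite unfold_in /= ?eqxx ltnn orbF.
  rewrite mul1r; case: ifPn => lij; last first.
    rewrite [X in _ ^+ X](_ : _ = 0%N) ?mulr1//.
    by apply: eq_card0 => k; rewrite unfold_in /= ?(negbTE ij) ?(negbTE lij).
  rewrite -exprMn; congr (_ ^+ _).
  transitivity #|[pred k : 'I_4 | (k < beta)%N]|.
    by apply: eq_card => k; rewrite unfold_in /= ?(negbTE ij) ?lij.
  rewrite -sum1_card big_mkcond !big_ord_recl big_ord0 /=.
  by move: hbeta; rewrite !inE => /or3P[] /eqP->.
under eq_bigr do rewrite 2!big_split.
rewrite 2!big_split /= [X in _ * (_ * X)]exchange_big /= -2!big_split /=.
rewrite -prodrXl; apply: eq_bigr => i _.
rewrite -2!big_split /= (bigD1 i)//= /h /f /g eqxx ltnn !mulr1.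
rewrite (eq_bigr (fun=> u i ^+ beta)); last first.
  move=> j ji; rewrite eq_sym (negbTE ji) mul1r.
  case: ltngtP => [| |ij]; rewrite ?mulr1 ?mul1r//.
  by rewrite -val_eqE /= ij eqxx in ji.
rewrite prodr_const cardC1 card_ord /= -exprM -exprD addnC.
by [].
Qed.

Section Leading.
Variables (R : realType) (beta : nat).
Hypothesis hbeta : beta \in [:: 1%N; 2%N; 4%N].
Variable m : nat.
Implicit Types (S U : 'M[quat R]_m) (i : 'I_m).
Local Notation sc c := ((@sclq R c)%:M).

(** The inclusion of the first i + 1 coordinates: taking a leading submatrix is a
    congruence by it. *)
Definition embmx i : 'M[quat R]_(m, i.+1) :=
  colsub (widen_ord (ltn_ord i)) 1%:M.

Lemma leadmxE S i : leadmx S i = conjtrq (embmx i) *m S *m embmx i.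
Proof.
have -> : conjtrq (embmx i) = rowsub (widen_ord (ltn_ord i)) 1%:M.
  apply/matrixP => a b; rewrite !mxE eq_sym.
  by case: eqP => _; rewrite ?mulr1n ?mulr0n ?conjq1 ?raddf0.
rewrite -rowsubE /embmx mulmx_colsub mulmx1.
by apply/matrixP => a b; rewrite !mxE.
Qed.

Lemma embmx_beta i : mx_beta beta (embmx i).
Proof. by move=> a b; rewrite mxE; exact: mx_beta1. Qed.

Lemma leadmx1 i : leadmx (1%:M : 'M[quat R]_m) i = 1%:M.
Proof.
by apply/matrixP => a b; rewrite !mxE.
Qed.

Lemma embmxK i : conjtrq (embmx i) *m embmx i = 1%:M.
Proof. by rewrite -[conjtrq _]mulmx1 -leadmxE leadmx1. Qed.

Lemma posdef_leadmx S i : posdef beta S -> posdef beta (leadmx S i).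
Proof.
move=> pS; rewrite leadmxE.
apply: (posdef_congr hbeta (V := conjtrq (embmx i))) => //.
- exact: embmx_beta.
- exact: embmxK.
Qed.

Lemma uptri_leadmx U i : uptri beta U -> uptri beta (leadmx U i).
Proof.
move=> [Ub Uz Ud]; split=> [a b|a b ab|a]; first by rewrite mxE.
  by rewrite mxE Uz.
have [u u0 uE] := Ud (widen_ord (ltn_ord i) a).
by exists u => //; rewrite -uE mxE.
Qed.

(** A triangular matrix preserves the span of the first coordinates, hence leading
    submatrices are compatible with triangular congruences. *)
Lemma mul_uptri_embmx U i : uptri beta U -> U *m embmx i = embmx i *m leadmx U i.
Proof.
move=> [_ Uz _]; rewrite /embmx mulmx_colsub mulmx1.
apply/matrixP => a b; rewrite !mxE.
have [ai|ia] := leqP a i; last first.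
  have le_i (k : 'I_i.+1) : (k < a)%N.
    by apply: leq_ltn_trans ia; rewrite -ltnS.
  rewrite Uz ?le_i// big1// => k _.
  by rewrite !mxE -val_eqE /= gtn_eqF ?le_i// mul0r.
have aE : widen_ord (ltn_ord i) (Ordinal (n := i.+1) ai) = a by exact/val_inj.
rewrite (bigD1 (Ordinal (n := i.+1) ai))//= big1 ?addr0 => [|k ka].
  by rewrite !mxE aE eqxx mul1r.
rewrite !mxE (_ : (a == _) = false) ?mul0r//.
by apply: contraNF ka => /eqP e; apply/eqP/val_inj; rewrite /= e.
Qed.

Lemma leadmx_congr S U i : uptri beta U ->
  leadmx (conjtrq U *m S *m U) i =
  conjtrq (leadmx U i) *m leadmx S i *m leadmx U i.
Proof.
move=> Ut; have h := mul_uptri_embmx i Ut.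
rewrite leadmxE (leadmxE S) -!mulmxA h.
by rewrite mulmxA -conjtrq_mul h conjtrq_mul -!mulmxA.
Qed.

Lemma leadmx_gram U i : uptri beta U ->
  leadmx (conjtrq U *m U) i = conjtrq (leadmx U i) *m leadmx U i.
Proof. by move=> Ut; have := leadmx_congr 1%:M i Ut; rewrite leadmx1 !mulmx1. Qed.

End Leading.

Lemma powRD_pos (R : realType) (c x y : R) : 0 < c ->
  c `^ (x + y) = c `^ x * c `^ y.
Proof. by move=> c0; rewrite powRD// (gt_eqF c0) implybT. Qed.

Section QPow.
Variables (R : realType) (beta : nat).
Hypothesis hbeta : beta \in [:: 1%N; 2%N; 4%N].
Variable n : nat.
Local Notation m := n.+1.
Implicit Types (S U : 'M[quat R]_m) (kappa tau : 'rV[R]_m).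
Local Notation sc c := ((@sclq R c)%:M).

(** Each factor of q is a power of a leading minor, which is multiplied by the
    determinant of the leading Gram matrix. *)
Lemma qpow_congr kappa S U : posdef beta S -> uptri beta U ->
  qpow beta kappa (conjtrq U *m S *m U) =
  qpow beta kappa S * qpow beta kappa (conjtrq U *m U).
Proof.
move=> pS Ut; rewrite /qpow hdet_congr// hdet_gram// powRM; last 2 first.
- by rewrite ltW// hdet_gt0.
- exact: sqr_ge0.
rewrite mulrACA; congr (_ * _); rewrite -big_split; apply: eq_bigr => i _ /=.
set j := widen_ord _ i.
have Uj := uptri_leadmx j Ut; have pj := posdef_leadmx hbeta j pS.
rewrite (leadmx_congr S j Ut) (leadmx_gram j Ut) (hdet_congr hbeta pj Uj) (hdet_gram hbeta Uj).
rewrite powRM//; last exact: sqr_ge0.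
by rewrite ltW// hdet_gt0.
Qed.

Lemma qpow_gt0 kappa S : posdef beta S -> 0 < qpow beta kappa S.
Proof.
move=> pS; rewrite mulr_gt0//; first by rewrite powR_gt0// hdet_gt0.
by apply: prodr_gt0 => i _; rewrite powR_gt0// hdet_gt0//; exact: posdef_leadmx.
Qed.

Lemma qpowD kappa tau S : posdef beta S ->
  qpow beta (kappa + tau) S = qpow beta kappa S * qpow beta tau S.
Proof.
move=> pS; rewrite /qpow mxE powRD_pos ?hdet_gt0// mulrACA; congr (_ * _).
rewrite -big_split; apply: eq_bigr => i _ /=.
rewrite !mxE opprD addrACA; apply: powRD_pos.
apply: hdet_gt0 => //.
exact: (@posdef_leadmx R beta hbeta m S (widen_ord (leqnSn n) i) pS).
Qed.

Lemma dg_sc k (c : R) (i : 'I_k) : dg (sc c : 'M[quat R]_k) i = c.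
Proof. by rewrite /dg mxE eqxx mulr1n inord4_0 sclqE. Qed.

Lemma hdet_sc k (c : R) : 0 < c -> hdet beta (sc c : 'M[quat R]_k) = c ^+ k.
Proof.
move=> c0; have q0 : 0 < Num.sqrt c by rewrite sqrtr_gt0.
have qq : Num.sqrt c * Num.sqrt c = c by rewrite -expr2 sqr_sqrtr// ltW.
have := hdet_gram hbeta (@uptri_sc R beta hbeta k (Num.sqrt c) q0).
rewrite conjtrq_scl sc_mul qq => ->.
under eq_bigr do rewrite dg_sc.
by rewrite prodr_const card_ord -exprM mulnC exprM sqr_sqrtr// ltW.
Qed.

Lemma leadmx_sc (c : R) (i : 'I_m) : leadmx (sc c : 'M[quat R]_m) i = sc c.
Proof. by apply/matrixP => a b; rewrite !mxE. Qed.

(** Summation by parts: the degrees of the minors in q add up to the sum of the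
    entries of kappa. *)
Lemma abel_sum (k : nat -> R) (p : nat) :
  k p *+ p.+1 + \sum_(i < p) (k i - k i.+1) *+ i.+1 = \sum_(i < p.+1) k i.
Proof.
elim: p => [|p IH]; first by rewrite big_ord0 big_ord1 addr0.
rewrite big_ord_recr [RHS]big_ord_recr /= -IH mulrnBl.
by rewrite mulrS; ring.
Qed.

Lemma qpow_sc kappa (c : R) : 0 < c ->
  qpow beta kappa (sc c) = c `^ (\sum_i kappa 0 i).
Proof.
move=> c0; rewrite /qpow hdet_sc//.
under eq_bigr do rewrite leadmx_sc hdet_sc//= -powR_mulrn ?ltW// -powRrM.
rewrite -powR_mulrn ?ltW// -powRrM.
have P (p : nat) (f : 'I_p -> R) : \prod_(i < p) c `^ f i = c `^ (\sum_i f i).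
  elim: p f => [|p IH] f; first by rewrite !big_ord0 powRr0.
  by rewrite !big_ord_recl IH powRD_pos.
rewrite P -powRD_pos//.
congr (_ `^ _).
pose k (i : nat) := kappa 0 (inord i).
have kE (i : 'I_m) : kappa 0 i = k i by rewrite /k inord_val.
transitivity (k n *+ n.+1 + \sum_(i < n) (k i - k i.+1) *+ i.+1).
  congr (_ + _); first by rewrite kE mulr_natl.
  apply: eq_bigr => i _; rewrite mulr_natl 2!kE.
  by [].
by rewrite abel_sum; apply: eq_bigr => i _; rewrite kE.
Qed.

End QPow.

(** * Laws with a density *)

Section DensityIntegral.
Local Open Scope ereal_scope.
Context d (E : measurableType d) (R : realType).
Variables (nu mu : {measure set E -> \bar R}) (k : E -> R).
Hypotheses (mk : measurable_fun setT k) (k0 : forall x, (0 <= k x)%R).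
Hypothesis nuE : forall A, measurable A -> nu A = \int[mu]_(x in A) (k x)%:E.

Import HBNNSimple.

(** The density formula holds for indicators by hypothesis; simple functions and
    monotone convergence extend it. *)
Lemma integral_density (h : E -> \bar R) :
  measurable_fun setT h -> (forall x, 0 <= h x) ->
  \int[nu]_x h x = \int[mu]_x (h x * (k x)%:E).
Proof.
move=> mh h0; pose f_ := nnsfun_approx measurableT mh.
have mf n : measurable_fun setT (EFin \o f_ n).
  exact/measurable_EFinP/measurable_funTS.
have mkE : measurable_fun setT (EFin \o k) by exact/measurable_EFinP.
transitivity (limn (fun n => \int[nu]_x (f_ n x)%:E)).
  rewrite -monotone_convergence//.
  - by apply: eq_integral => x _; apply/esym/cvg_lim => //; exact: cvg_nnsfun_approx.
  - by move=> n x _; rewrite lee_fin.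
  - by move=> x _ a b ab; rewrite lee_fin; exact/lefP/nd_nnsfun_approx.
transitivity (limn (fun n => \int[mu]_x ((f_ n x)%:E * (k x)%:E))); last first.
  rewrite -monotone_convergence//.
  - apply: eq_integral => x _; apply/cvg_lim => //.
    under eq_fun do rewrite muleC.
    by rewrite muleC; apply: cvgeZl => //; exact: cvg_nnsfun_approx.
  - by move=> n; exact: (emeasurable_funM (mf n) mkE).
  - by move=> n x _; rewrite mule_ge0// lee_fin.
  - move=> x _ a b ab; apply: lee_wpmul2r; first by rewrite lee_fin.
    by rewrite lee_fin; exact/lefP/nd_nnsfun_approx.
congr (limn _); apply/funext => n.
have mpre r : measurable (f_ n @^-1` [set r]) by [].
have mind r : measurable_fun setT (fun x => (\1_(f_ n @^-1` [set r]) x)%:E : \bar R).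
  exact/measurable_EFinP/measurable_indic.
transitivity (\sum_(r \in range (f_ n)) r%:E * nu (f_ n @^-1` [set r])).
  under eq_integral do rewrite fimfunE -fsumEFin//.
  rewrite ge0_integral_fsum//; last 2 first.
  - by move=> y; exact/measurable_EFinP/measurable_funM.
  - by move=> y x _; rewrite nnfun_muleindic_ge0.
  by apply: eq_fsbigr => r _; rewrite integralZl_indic_nnsfun// integral_indic// setIT.
transitivity (\sum_(r \in range (f_ n))
   \int[mu]_x ((r * \1_(f_ n @^-1` [set r]) x)%:E * (k x)%:E)).
  apply: eq_fsbigr => r rr.
  have r0 : (0 <= r)%R by move: rr; rewrite inE => -[x _ <-].
  under eq_integral do rewrite EFinM -muleA.
  rewrite ge0_integralZl//.
  - rewrite nuE// [in LHS]integral_mkcond; congr (_ * _); apply: eq_integral => x _.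
    rewrite patchE indicE; case: ifPn => _; rewrite ?mul1e ?mul0e//.
  - by apply: emeasurable_funM.
  - by move=> x _; rewrite mule_ge0// lee_fin.
rewrite -ge0_integral_fsum//.
- apply: eq_integral => x _.
  rewrite [in RHS]fimfunE -fsumEFin// ge0_mule_fsuml//.
  by move=> r; rewrite EFinM nnfun_muleindic_ge0.
- move=> r; apply: emeasurable_funM => //.
  exact/measurable_EFinP/measurable_funM.
- by move=> r x _; apply: mule_ge0; rewrite ?lee_fin// -lee_fin EFinM nnfun_muleindic_ge0.
Qed.

End DensityIntegral.

Section JointLaw.
Local Open Scope ereal_scope.
Context d (T : measurableType d) (R : realType) (P : probability T R).
Context d' (E : measurableType d').
Variable mu : {sigma_finite_measure set E -> \bar R}.

(** By independence the joint law is the product measure. *)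
Lemma joint_law (X1 X2 : T -> E) (k1 k2 : E -> R) :
  measurable_fun setT X1 -> measurable_fun setT X2 ->
  measurable_fun setT k1 -> measurable_fun setT k2 ->
  (forall x, 0 <= k1 x)%R -> (forall x, 0 <= k2 x)%R ->
  (forall A, measurable A -> P (X1 @^-1` A) = \int[mu]_(x in A) (k1 x)%:E) ->
  (forall A, measurable A -> P (X2 @^-1` A) = \int[mu]_(x in A) (k2 x)%:E) ->
  (forall A B, measurable A -> measurable B ->
    P (X1 @^-1` A `&` X2 @^-1` B) = P (X1 @^-1` A) * P (X2 @^-1` B)) ->
  forall G : set (E * E), measurable G ->
  P [set w | G (X1 w, X2 w)] =
  \int[mu]_x (\int[mu]_y ((\1_G (x, y))%:E * (k2 y)%:E) * (k1 x)%:E).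
Proof.
move=> mX1 mX2 mk1 mk2 k10 k20 P1 P2 ind G mG.
pose m1 : probability E R := distribution P (mfun_Sub (mem_set mX1)).
pose m2 : probability E R := distribution P (mfun_Sub (mem_set mX2)).
have mX : measurable_fun setT (fun w => (X1 w, X2 w)).
  exact: measurable_fun_pair.
pose m12 : {measure set (E * E) -> \bar R} :=
  measure_function_pushforward__canonical__measure_function_Measure P mX.
have mE : (m1 \x m2) G = m12 G.
  by apply: product_measure_unique => // A B mA mB; exact: (ind A B mA mB).
transitivity (m12 G) => //; rewrite -mE.
have m1E A : measurable A -> m1 A = \int[mu]_(x in A) (k1 x)%:E by exact: P1.
have m2E A : measurable A -> m2 A = \int[mu]_(x in A) (k2 x)%:E by exact: P2.
transitivity (\int[m1]_x m2 (xsection G x)) => //.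
rewrite (integral_density mk1 k10 m1E)//; last exact: measurable_fun_xsection.
apply: eq_integral => x _; congr (_ * _).
rewrite m2E; last exact: measurable_xsection.
rewrite integral_mkcond; apply: eq_integral => y _.
rewrite patchE indicE mem_xsection.
by case: (_ \in G); rewrite ?mul1e ?mul0e.
Qed.

End JointLaw.

(** * Power functions on the cone and the Jacobian of a congruence *)

Section Kernels.
Variables (R : realType) (beta : nat).
Hypothesis hbeta : beta \in [:: 1%N; 2%N; 4%N].

(** The determinant through the Cholesky factor: on the cone it agrees with [hdet],
    and unlike [hdet] it is visibly measurable. *)
Definition choldet m (S : 'M[quat R]_m) : R := (\prod_i dg (chol S) i) ^+ 2.

Lemma hdet_choldet m (S : 'M[quat R]_m) : posdef beta S ->
  hdet beta S = choldet S.
Proof.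
move=> /(posdefP hbeta)[hS pS]; have [Ut E _ _ _] := cholP hbeta hS pS.
by rewrite {1}E (hdet_gram hbeta Ut).
Qed.

Lemma measurable_choldet d (T : measurableType d) m (f : T -> 'M[quat R]_m) :
  measurable_fun setT f -> measurable_fun setT (fun t => choldet (f t)).
Proof.
move=> mf; apply: (measurable_funX (f := fun t => \prod_i dg (chol (f t)) i)).
apply: measurable_prod => i _.
by move/measurable_mxP : (measurable_chol mf); exact.
Qed.

Variable n : nat.
Local Notation m := n.+1.
Local Notation mat := 'M[quat R]_m.
Local Notation mu := (@herm_measure R beta m).

(** The common factor of Riesz and beta densities. *)
Definition powker (al : R) (kappa : 'rV[R]_m) (S : mat) : R :=
  hdet beta S `^ al * qpow beta kappa S.

Definition powkerT (al : R) (kappa : 'rV[R]_m) (S : mat) : R :=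
  choldet S `^ al * (choldet S `^ kappa 0 ord_max *
  \prod_(i < n) choldet (leadmx S (widen_ord (leqnSn n) i)) `^
    (kappa 0 (widen_ord (leqnSn n) i) - kappa 0 (lift ord0 i))).

Lemma powkerTE al kappa S : posdef beta S ->
  powker al kappa S = powkerT al kappa S.
Proof.
move=> pS; rewrite /powker /powkerT /qpow !hdet_choldet//.
congr (_ * (_ * _)); apply: eq_bigr => i _.
by rewrite (hdet_choldet (@posdef_leadmx R beta hbeta m S (widen_ord (leqnSn n) i) pS)).
Qed.

Lemma measurable_powkerT d (T : measurableType d) al kappa (f : T -> mat) :
  measurable_fun setT f -> measurable_fun setT (fun t => powkerT al kappa (f t)).
Proof.
move=> mf; have mp (g : T -> R) a : measurable_fun setT g ->
    measurable_fun setT (fun t => g t `^ a).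
  move=> mg; apply: (@measurableT_comp _ _ _ _ _ _ (fun x : R => x `^ a) setT g).
    exact: measurable_powR.
  exact: mg.
apply: measurable_funM; first by apply: mp; exact: measurable_choldet.
apply: measurable_funM; first by apply: mp; exact: measurable_choldet.
apply: measurable_prod => i _; apply: mp; apply: measurable_choldet.
exact: measurable_mxsub.
Qed.

Lemma powker_gt0 al kappa S : posdef beta S -> 0 < powker al kappa S.
Proof. by move=> pS; rewrite mulr_gt0 ?powR_gt0 ?hdet_gt0 ?qpow_gt0. Qed.

(** Determinant and q both turn a triangular congruence into a product. *)
Lemma powker_congr al kappa S U : posdef beta S -> uptri beta U ->
  powker al kappa (conjtrq U *m S *m U) =
  powker al kappa S * powker al kappa (conjtrq U *m U).
Proof.
move=> pS Ut; rewrite /powker qpow_congr// hdet_congr// hdet_gram// powRM.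
- by rewrite mulrACA.
- by rewrite ltW// hdet_gt0.
- exact: sqr_ge0.
Qed.

Lemma powkerM al be kappa tau S : posdef beta S ->
  powker al kappa S * powker be tau S = powker (al + be) (kappa + tau) S.
Proof.
by move=> pS; rewrite /powker qpowD// powRD_pos ?hdet_gt0// mulrACA.
Qed.

Lemma powker_hdet al be kappa S : posdef beta S ->
  hdet beta S `^ be * powker al kappa S = powker (be + al) kappa S.
Proof. by move=> pS; rewrite /powker powRD_pos ?hdet_gt0// mulrA. Qed.

(** The exponent of the invariant measure of the cone; it is [dim_ratio] as a real
    number. *)
Definition rdim : R := n%:R * beta%:R / 2 + 1.

Local Open Scope ereal_scope.

(** The congruence multiplies the coordinate p by u_i u_j, where (i, j) is its
    position, and [prod_hcoord] collects the factors. *)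
Lemma integral_congr (U : mat) (h : mat -> \bar R) : uptri beta U ->
  measurable_fun setT h -> (forall S, 0 <= h S) ->
  \int[mu]_S h S =
  (hdet beta (conjtrq U *m U) `^ rdim)%:E *
    \int[mu]_S h (conjtrq U *m S *m U)%R.
Proof.
move=> Ut mh h0; rewrite integral_herm_congr// muleA -EFinM.
rewrite (prod_hcoord hbeta) hdet_gram//.
have d0 : (0 < \prod_i dg U i)%R.
  by apply: prodr_gt0 => i _; case: (uptri_dg Ut i).
have -> : ((\prod_i dg U i) ^+ (beta * n + 2) =
   ((\prod_i dg U i) ^+ 2) `^ rdim)%R.
  rewrite -!powR_mulrn ?ltW// -powRrM /rdim; congr (_ `^ _)%R.
  by rewrite natrD natrM; field.
by rewrite mulfV ?mul1e// gt_eqF// powR_gt0// exprn_gt0.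
Qed.

End Kernels.

(** * Phases of complex exponentials *)

Section Phase.
Variable R : realType.

(** By the half-angle formula, 1 - cos x is twice the square of sin (x / 2), and
    sin is positive on the open interval from 0 to pi. *)
Lemma cos_eq1 (x : R) : `|x| < 3 -> cos x = 1 -> x = 0.
Proof.
wlog x0 : x / 0 <= x => [H|].
  case: (leP 0 x) => [|/ltW x0]; first exact: H.
  rewrite -normrN -cosN => h1 h2; apply/eqP; rewrite -oppr_eq0; apply/eqP.
  by apply: H => //; rewrite oppr_ge0.
rewrite ger0_norm// => x3 cx; apply/eqP; rewrite eq_le x0 andbT leNgt.
apply/negP => xp; have /sin_gt0_pi : 0 < x / 2 < pi.
  apply/andP; split; first lra.
  by have := pi_ge2 R; lra.
have : cos (x / 2 + x / 2) = 1 by rewrite -splitr.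
rewrite cosD -!expr2 cos2sin2 => e s0.
have : 0 < sin (x / 2) ^+ 2 by rewrite exprn_gt0.
lra.
Qed.

(** The phases at 1 + e and at its square are small multiples of 2 pi, hence zero.
    The logarithm doubles from one point to the other, the affine part does not. *)
Lemma constant_phase (c1 c2 : R) :
  (forall t, 0 < t -> cos (c1 * (t - 1) + c2 * ln t) = 1) -> c1 = 0 /\ c2 = 0.
Proof.
move=> H; pose M := 1 + `|c1| + `|c2|.
have M1 : 1 <= M by rewrite /M -addrA lerDl addr_ge0.
have M0 : 0 < M by lra.
pose e := M^-1; have e0 : 0 < e by rewrite invr_gt0.
have e1 : e <= 1 by rewrite invf_le1.
have eM : e * M = 1 by rewrite mulVf// gt_eqF.
pose L := ln (1 + e).
have L0 : 0 < L by apply: ln_gt0; lra.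
have Le : L <= e by apply: le_ln1Dx; lra.
have a1 := normr_ge0 c1; have a2 := normr_ge0 c2.
have bound (u v : R) : 0 <= u -> u <= 3 * e -> 0 <= v -> v <= 3 * e ->
    `|c1 * u + c2 * v| < 3.
  move=> u0 u3 v0 v3; apply: le_lt_trans (ler_normD _ _) _.
  rewrite !normrM (ger0_norm u0) (ger0_norm v0).
  have h1 : `|c1| * u <= `|c1| * (3 * e) by rewrite ler_wpM2l.
  have h2 : `|c2| * v <= `|c2| * (3 * e) by rewrite ler_wpM2l.
  have h3 : `|c1| * e + `|c2| * e = 1 - e by rewrite -[1 in RHS]eM /M; ring.
  lra.
(* the choice of M keeps both phases below 3 in absolute value *)
have E1 : c1 * e + c2 * L = 0.
  apply: cos_eq1; first by apply: bound; lra.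
  have -> : c1 * e + c2 * L = c1 * ((1 + e) - 1) + c2 * ln (1 + e).
    by rewrite /L; congr (_ + _); ring.
  by apply: H; lra.
have E2 : c1 * (e * (2 + e)) + c2 * (L + L) = 0.
  apply: cos_eq1; first by apply: bound; nra.
  have -> : c1 * (e * (2 + e)) + c2 * (L + L) =
      c1 * ((1 + e) * (1 + e) - 1) + c2 * ln ((1 + e) * (1 + e)).
    rewrite lnM ?posrE; [|lra|lra].
    by rewrite /L; congr (_ + _); ring.
  by apply: H; nra.
have c10 : c1 = 0.
  have : c1 * (e * e) = 0 by lra.
  by move=> /eqP; rewrite !mulf_eq0 (gt_eqF e0) !orbF => /eqP.
split=> //; move: E1; rewrite c10 mul0r add0r => /eqP.
by rewrite mulf_eq0 (gt_eqF L0) orbF => /eqP.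
Qed.

Local Open Scope complex_scope.
Notation ImC := complex.Im.

Lemma cexpD (z w : R[i]) : cexp (z + w) = cexp z * cexp w.
Proof.
case: z w => [a b] [c d]; rewrite /cexp /= expRD cosD sinD.
by apply/eqP; rewrite eq_complex /=; apply/andP; split; apply/eqP; ring.
Qed.

Lemma cexp0 : cexp (0 : R[i]) = 1.
Proof. by rewrite /cexp /= expR0 cos0 sin0 mul1r. Qed.

Lemma cexp_neq0 (z : R[i]) : cexp z != 0.
Proof.
apply/eqP => z0; have : cexp (z - z) = 1 by rewrite subrr cexp0.
by rewrite cexpD z0 mul0r => /eqP; rewrite eq_sym oner_eq0.
Qed.

Lemma cexp_real (r : R) : cexp r%:C = (expR r)%:C.
Proof.
by rewrite /cexp /= cos0 sin0; apply/eqP; rewrite eq_complex /= !mulr0 !mulr1 subr0 addr0 !eqxx.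
Qed.

Lemma cpow_real (x r : R) : 0 < x -> cpow x r%:C = (x `^ r)%:C.
Proof.
by move=> x0; rewrite /cpow -rmorphM cexp_real /powR gt_eqF.
Qed.

Lemma cpowD (x : R) (a b : R[i]) : cpow x (a + b) = cpow x a * cpow x b.
Proof. by rewrite /cpow mulrDl cexpD. Qed.

Lemma cpow_neq0 (x : R) (a : R[i]) : cpow x a != 0.
Proof. exact: cexp_neq0. Qed.

Lemma cexp_gt0 (z : R[i]) : 0 < cexp z -> cos (ImC z) = 1.
Proof.
case: z => [a b]; rewrite /cexp ltcE /=.
rewrite !mul0r subr0 addr0 => /andP[/eqP s c].
have ea := expR_gt0 a.
have s0 : sin b = 0.
  by move/eqP: s; rewrite mulf_eq0 (gt_eqF ea) => /eqP.
have c0 : 0 < cos b by rewrite -(pmulr_rgt0 _ ea).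
have := cos2sin2 b; rewrite s0 expr0n subr0 => /eqP.
rewrite sqrf_eq1 => /orP[/eqP//|/eqP e].
by rewrite e in c0; lra.
Qed.

End Phase.

(** * The half-plane and holomorphic extensions *)

Lemma congr_cancel (K : comNzRingType) m p (U : 'M[quat K]_(m, p))
    (V : 'M[quat K]_(p, m)) (X : 'M[quat K]_m) : U *m V = 1%:M ->
  conjtrq V *m (conjtrq U *m X *m U) *m V = X.
Proof.
move=> UV; rewrite -2!mulmxA UV mulmx1 mulmxA.
by rewrite -conjtrq_mul UV conjtrq1 mul1mx.
Qed.

Lemma mul_sclE (K : comNzRingType) m p (c : K) (A : 'M[quat K]_(m, p)) i j :
  ((sclq c)%:M *m A) i j = sclq c * A i j.
Proof. by rewrite mul_scalar_mx mxE. Qed.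

Lemma conjtrqE (K : comNzRingType) m p (A : 'M[quat K]_(m, p)) i j :
  conjtrq A i j = conjq (A j i).
Proof. by rewrite mxE mxE. Qed.

Lemma scl_mid (K : comNzRingType) m p q r (c : K) (A : 'M[quat K]_(m, p))
    (D : 'M[quat K]_(p, q)) (B : 'M[quat K]_(q, r)) :
  A *m ((sclq c)%:M *m D) *m B = (sclq c)%:M *m (A *m D *m B).
Proof. by rewrite mulmxA -sclmxC !mulmxA. Qed.

Lemma diag_affine (K : comNzRingType) m (c : K) (l : 'rV[K]_m) :
  diag_mx (map_mx (@sclq K) (\row_j (1 + c * l 0 j))) =
  1%:M + (sclq c)%:M *m diag_mx (map_mx (@sclq K) l).
Proof.
have dE (v : 'rV[K]_m) i j :
    diag_mx (map_mx (@sclq K) v) i j = sclq (v 0 i) *+ (i == j).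
  by rewrite mxE [map_mx _ _ _ _]mxE.
apply/matrixP => i j; rewrite [RHS]mxE mul_sclE !dE.
rewrite [(\row__ _) _ _]mxE [1%:M _ _]mxE.
case: eqP => _; last by rewrite !mulr0n mulr0 addr0.
by rewrite !mulr1n rmorphD rmorphM rmorph1.
Qed.

Lemma regroup (K : pzSemiRingType) m (A B C D E : 'M[K]_m) :
  A *m B *m C *m (D *m E) = A *m (B *m C *m D) *m E.
Proof. by rewrite !mulmxA. Qed.

Section Complexification.
Variable R : realType.
Local Open Scope complex_scope.
Notation ImC := complex.Im.
Local Notation C := R[i].
Local Notation sc c := ((@sclq C c)%:M).

Definition qcomplex (x : quat R) : quat C := map_mx (real_complex R) x.

Lemma qcomplexE x k : qcomplex x 0 k = (x 0 k)%:C.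
Proof. by rewrite mxE. Qed.

Lemma qcomplex_zmod : zmod_morphism qcomplex.
Proof. by move=> x y; rewrite /qcomplex raddfB. Qed.

Lemma qcomplex_scl c : qcomplex (sclq c) = sclq c%:C.
Proof.
by apply: quatP; apply: ord4P; rewrite qcomplexE !sclqE//= ?rmorph0.
Qed.

Lemma qcomplex_monoid : monoid_morphism qcomplex.
Proof.
split; first by rewrite quat1E qcomplex_scl rmorph1.
move=> x y; apply: quatP; apply: ord4P; rewrite qcomplexE !mulqE !qcomplexE;
  by rewrite !(rmorphD, rmorphN, rmorphM).
Qed.

HB.instance Definition _ := GRing.isZmodMorphism.Build (quat R) (quat C)
  qcomplex qcomplex_zmod.
HB.instance Definition _ := GRing.isMonoidMorphism.Build (quat R) (quat C)
  qcomplex qcomplex_monoid.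

(** Extension of scalars from R to R[i], which keeps products and conjugates. *)
Definition emb p q (A : 'M[quat R]_(p, q)) : 'M[quat C]_(p, q) :=
  map_mx qcomplex A.

Lemma embM p q r (A : 'M[quat R]_(p, q)) (B : 'M[quat R]_(q, r)) :
  emb (A *m B) = emb A *m emb B.
Proof. exact: map_mxM. Qed.

Lemma emb1 p : emb (1%:M : 'M[quat R]_p) = 1%:M.
Proof. exact: map_mx1. Qed.

Lemma emb_diag p (l : 'rV[R]_p) :
  emb (diag_mx (map_mx (@sclq R) l)) =
  diag_mx (map_mx (@sclq C) (map_mx (real_complex R) l)).
Proof.
rewrite /emb map_diag_mx; congr diag_mx.
by apply/matrixP => i j; rewrite !mxE; exact: qcomplex_scl.
Qed.

Lemma complexify0 m (A : 'M[quat R]_m) : complexify A 0 = emb A.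
Proof.
apply/matrixP => i j; apply: quatP => k.
by rewrite !mxE.
Qed.

Lemma complexifyE m (A B : 'M[quat R]_m) :
  complexify A B = emb A + sc (0 +i* 1) *m emb B.
Proof.
apply/matrixP => i j; apply: quatP => k.
rewrite [(emb A + _) i j]mxE quat_add0 mul_sclE sclq_mulE.
rewrite [emb A _ _]mxE [emb B _ _]mxE !qcomplexE !mxE.
by apply/eqP; rewrite eq_complex /=; apply/andP; split; apply/eqP; ring.
Qed.

Lemma retr_emb p (A : 'M[quat R]_p) : retr (emb A) = (retr A)%:C.
Proof.
rewrite /retr /mxtrace !summxE rmorph_sum; apply: eq_bigr => i _.
by rewrite [emb A _ _]mxE qcomplexE.
Qed.

Lemma retr_diag (K : comNzRingType) p (l : 'rV[K]_p) :
  retr (diag_mx (map_mx (@sclq K) l)) = \sum_i l 0 i.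
Proof.
rewrite /retr /mxtrace !summxE; apply: eq_bigr => i _.
by rewrite mxE eqxx mulr1n mxE inord4_0 sclqE.
Qed.

Lemma diag_sclM (K : comNzRingType) p (l l' : 'rV[K]_p) :
  diag_mx (map_mx (@sclq K) l) *m diag_mx (map_mx (@sclq K) l') =
  diag_mx (map_mx (@sclq K) (\row_i (l 0 i * l' 0 i))).
Proof.
rewrite mulmx_diag; congr diag_mx; apply/rowP => j.
rewrite [LHS]mxE [map_mx _ l _ _]mxE [map_mx _ l' _ _]mxE [RHS]mxE -rmorphM.
by congr sclq; rewrite mxE.
Qed.

Variable beta : nat.
Hypothesis hbeta : beta \in [:: 1%N; 2%N; 4%N].

(** The Cholesky factor of A carries A to the identity; the spectral theorem then
    diagonalises B by a unitary matrix, which keeps the identity. *)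
Lemma simultaneous_diag m (A B : 'M[quat R]_m) :
  posdef beta A -> hermmx beta B ->
  exists (G K : 'M[quat R]_m) (l : 'rV[R]_m),
    [/\ mx_beta beta G, G *m K = 1%:M, K *m G = 1%:M,
        A = conjtrq G *m G &
        B = conjtrq G *m diag_mx (map_mx (@sclq R) l) *m G].
Proof.
move=> /(posdefP hbeta)[hA pA] hB.
have [[Ub _ _] AE UV VU [Vb _ _]] := cholP hbeta hA pA.
set U := chol A in Ub AE UV VU; set V := invchol A in UV VU Vb.
have hB' : hermmx beta (conjtrq V *m B *m V) by exact: (herm_congr hbeta).
have [l [W [Wb WW1 WW2 BE]]] := spectral_herm hbeta hB'.
exists (W *m U), (V *m conjtrq W), l; split.
- exact: (mx_betaM hbeta).
- by rewrite mulmxA -(mulmxA W U) UV mulmx1 WW2.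
- by rewrite mulmxA -(mulmxA V (conjtrq W)) WW1 mulmx1 VU.
- by rewrite conjtrq_mul mulmxA -(mulmxA _ (conjtrq W)) WW1 mulmx1.
- have -> : conjtrq (W *m U) *m diag_mx (map_mx (@sclq R) l) *m (W *m U) =
     conjtrq U *m (conjtrq W *m diag_mx (map_mx (@sclq R) l) *m W) *m U.
    rewrite conjtrq_mul; exact: regroup.
  by rewrite -BE congr_cancel.
Qed.

Lemma embE p q (A : 'M[quat R]_(p, q)) i j : emb A i j = qcomplex (A i j).
Proof. by rewrite mxE. Qed.

Lemma qcomplex_conj x : conjq (qcomplex x) = qcomplex (conjq x).
Proof.
apply: quatP; apply: ord4P; rewrite conjqE// !qcomplexE conjqE//=;
  by rewrite ?rmorphN.
Qed.

Lemma emb_conjtrq p q (A : 'M[quat R]_(p, q)) :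
  conjtrq (emb A) = emb (conjtrq A).
Proof.
apply/matrixP => i j.
by rewrite conjtrqE !embE conjtrqE qcomplex_conj.
Qed.

Lemma inv_1i (l : R) : (1 +i* l)^-1 = (1 + l ^+ 2)^-1 +i* (- (l / (1 + l ^+ 2))).
Proof.
have l0 : 0 < 1 + l ^+ 2 by rewrite ltr_wpDr// sqr_ge0.
have n0 : (1 +i* l) != 0 by rewrite eq_complex /= oner_eq0.
apply: (mulfI n0); rewrite mulfV//; apply/eqP; rewrite eq_complex /=.
by apply/andP; split; apply/eqP; field; rewrite gt_eqF.
Qed.

Section HalfPlane.
Variable m : nat.
Variables (A B G K : 'M[quat R]_m) (l : 'rV[R]_m).
Hypotheses (Gb : mx_beta beta G) (GK : G *m K = 1%:M) (KG : K *m G = 1%:M).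
Hypotheses (AE : A = conjtrq G *m G).
Hypotheses (BE : B = conjtrq G *m diag_mx (map_mx (@sclq R) l) *m G).
Let Sigma := complexify A B.
Let dg1 : 'rV[C]_m := \row_j (1 +i* l 0 j).
Let dg1i : 'rV[C]_m := \row_j (1 +i* l 0 j)^-1.
Local Notation dq v := (diag_mx (map_mx (@sclq C) v)).

Let dg1K : dq dg1 *m dq dg1i = 1%:M.
Proof.
rewrite diag_sclM -diag_const_mx; congr diag_mx; apply/rowP => j.
rewrite [LHS]mxE [RHS]mxE -[RHS](rmorph1 (@sclq C)); congr sclq.
rewrite [LHS]mxE [dg1 _ _]mxE [dg1i _ _]mxE mulfV//.
by rewrite eq_complex /= oner_eq0.
Qed.

Let dg1Ki : dq dg1i *m dq dg1 = 1%:M.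
Proof.
rewrite -dg1K !diag_sclM; congr (diag_mx (map_mx _ _)).
by apply/rowP => j; rewrite !mxE mulrC.
Qed.

(** In the common basis, Sigma becomes the diagonal matrix of the 1 + i l_j. *)
Lemma half_planeE : Sigma = conjtrq (emb G) *m dq dg1 *m emb G.
Proof.
have dE : dg1 = \row_j (1 + (0 +i* 1) * (map_mx (real_complex R) l) 0 j).
  apply/rowP => j; rewrite !mxE; apply/eqP; rewrite eq_complex /=.
  by apply/andP; split; apply/eqP; ring.
rewrite dE diag_affine mulmxDr mulmx1 mulmxDl /Sigma complexifyE AE BE !embM.
rewrite -(emb_conjtrq G) (emb_diag l).
rewrite [in RHS]scl_mid; reflexivity.
Qed.

Lemma half_plane_inv :
  mxinv Sigma = emb K *m dq dg1i *m conjtrq (emb K).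
Proof.
have cGK : emb G *m emb K = 1%:M by rewrite -embM GK emb1.
have cKG : emb K *m emb G = 1%:M by rewrite -embM KG emb1.
have cGK' : conjtrq (emb K) *m conjtrq (emb G) = 1%:M.
  by rewrite -conjtrq_mul cGK conjtrq1.
have cKG' : conjtrq (emb G) *m conjtrq (emb K) = 1%:M.
  by rewrite -conjtrq_mul cKG conjtrq1.
have mid (a b c d e f : 'M[quat C]_m) : c *m d = 1%:M -> b *m e = 1%:M ->
    a *m f = 1%:M -> a *m b *m c *m (d *m e *m f) = 1%:M.
  move=> cd be af; rewrite -!mulmxA (mulmxA c) cd mul1mx (mulmxA b) be mul1mx.
  exact: af.
rewrite half_planeE; apply: mxinv_eq.
  exact: (mid _ _ _ _ _ _ cGK' dg1Ki cKG).
exact: (mid _ _ _ _ _ _ cGK dg1K cKG').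
Qed.

Lemma half_plane_trace (e : 'rV[R]_m) :
  retr (mxinv Sigma *m complexify
    (conjtrq G *m diag_mx (map_mx (@sclq R) e) *m G) 0) =
  \sum_j (e 0 j)%:C * (1 +i* l 0 j)^-1.
Proof.
rewrite complexify0 !embM -(emb_conjtrq G) (emb_diag e) half_plane_inv.
have cGK : emb G *m emb K = 1%:M by rewrite -embM GK emb1.
have cGK' : conjtrq (emb K) *m conjtrq (emb G) = 1%:M.
  by rewrite -conjtrq_mul cGK conjtrq1.
have mid (a b c d e' f : 'M[quat C]_m) : c *m d = 1%:M -> f *m a = 1%:M ->
    retr (a *m b *m c *m (d *m e' *m f)) = retr (b *m e').
  move=> cd fa; rewrite -!mulmxA (mulmxA c) cd mul1mx retrC -!mulmxA fa mulmx1.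
  by [].
rewrite (mid _ _ _ _ _ _ cGK' cGK) diag_sclM retr_diag; apply: eq_bigr => j _.
by rewrite mxE [dg1i _ _]mxE [map_mx _ e _ _]mxE mulrC.
Qed.

(** On the matrices diagonal in the common basis, the imaginary part of the trace is
    a linear form with coefficients - l_j / (1 + l_j^2), and it vanishes on all
    positive weights. *)
Lemma half_plane_real :
  (forall X, posdef beta X -> ImC (retr (mxinv Sigma *m complexify X 0)) = 0) ->
  B = 0.
Proof.
move=> H.
have pX (e : 'rV[R]_m) : (forall j, 0 < e 0 j) ->
    posdef beta (conjtrq G *m diag_mx (map_mx (@sclq R) e) *m G).
  move=> e0; apply: (posdef_congr hbeta Gb KG).
  pose q : 'rV[R]_m := \row_j Num.sqrt (e 0 j).
  have -> : diag_mx (map_mx (@sclq R) e) =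
      conjtrq (diag_mx (map_mx (@sclq R) q)) *m diag_mx (map_mx (@sclq R) q).
    rewrite conjtrq_diag diag_sclM; congr (diag_mx (map_mx _ _)).
    by apply/rowP => j; rewrite !mxE -expr2 sqr_sqrtr// ltW.
  apply: (posdef_gram hbeta); split; first exact: mx_beta_diag.
    by move=> i j ji; rewrite mxE -val_eqE gtn_eqF.
  move=> i; exists (q 0 i); first by rewrite mxE sqrtr_gt0.
  by rewrite mxE eqxx mulr1n mxE.
have F (e : 'rV[R]_m) : (forall j, 0 < e 0 j) ->
    \sum_j e 0 j * (l 0 j / (1 + l 0 j ^+ 2)) = 0.
  move=> e0; have := H _ (pX e e0); rewrite half_plane_trace.
  rewrite raddf_sum => h.
  apply: oppr_inj; rewrite oppr0 -[RHS]h -sumrN; apply: eq_bigr => j _.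
  by rewrite inv_1i /= mul0r addr0 mulrN.
have l0 : l = 0.
  apply/rowP => i; rewrite [RHS]mxE.
  (* doubling the weight i isolates the term of index i *)
  pose e1 : 'rV[R]_m := \row_j 1.
  pose e2 : 'rV[R]_m := \row_j (if j == i then 2 else 1).
  have F1 := F e1 (fun j => _); have F2 := F e2 (fun j => _).
  have {}F1 : \sum_j e1 0 j * (l 0 j / (1 + l 0 j ^+ 2)) = 0.
    by apply: F1 => j; rewrite mxE.
  have {}F2 : \sum_j e2 0 j * (l 0 j / (1 + l 0 j ^+ 2)) = 0.
    by apply: F2 => j; rewrite mxE; case: ifP.
  have : \sum_j e2 0 j * (l 0 j / (1 + l 0 j ^+ 2)) =
      \sum_j e1 0 j * (l 0 j / (1 + l 0 j ^+ 2)) + l 0 i / (1 + l 0 i ^+ 2).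
    rewrite (bigD1 i)//= [in RHS](bigD1 i)//= !mxE eqxx.
    rewrite [in RHS]addrAC; congr (_ + _); first by ring.
    by apply: eq_bigr => j ji; rewrite !mxE (negbTE ji).
  rewrite F1 F2 add0r => /esym/eqP; rewrite mulf_eq0 invr_eq0.
  have : 0 < 1 + l 0 i ^+ 2 by rewrite ltr_wpDr// sqr_ge0.
  by move=> /gt_eqF ->; rewrite orbF => /eqP.
by rewrite BE l0 map_mx0 raddf0 mulmx0 mul0mx.
Qed.

End HalfPlane.

Lemma real_half_plane m (Sigma : 'M[quat C]_m) : half_plane beta Sigma ->
  (forall X, posdef beta X -> ImC (retr (mxinv Sigma *m complexify X 0)) = 0) ->
  exists A Ai : 'M[quat R]_m, [/\ posdef beta A, Sigma = complexify A 0,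
    A *m Ai = 1%:M, Ai *m A = 1%:M &
    forall X, retr (mxinv Sigma *m complexify X 0) = (retr (Ai *m X))%:C].
Proof.
move=> [A [B [pA hB ->]]] H.
have [G [K [l [Gb GK KG AE BE]]]] := simultaneous_diag pA hB.
have B0 := half_plane_real Gb GK KG AE BE H.
have [[hA _] hp] := (posdefP hbeta A).1 pA; have [_ _ UV VU _] := cholP hbeta (proj1 pA) hp.
pose Ai := invchol A *m conjtrq (invchol A).
have [_ AU _ _ _] := cholP hbeta (proj1 pA) hp.
have A1 : A *m Ai = 1%:M.
  rewrite {1}AU /Ai -mulmxA (mulmxA (chol A)) UV mul1mx -conjtrq_mul VU.
  exact: conjtrq1.
have A2 : Ai *m A = 1%:M.
  rewrite {1}AU /Ai -mulmxA (mulmxA (conjtrq (invchol A))) -conjtrq_mul UV.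
  by rewrite conjtrq1 mul1mx VU.
exists A, Ai; split=> //; first by rewrite B0.
move=> X; rewrite B0 !complexify0 -retr_emb embM; congr (retr (_ *m _)).
by apply: mxinv_eq; rewrite -embM ?A1 ?A2 emb1.
Qed.

Section HoloExt.
Variable m : nat.
Implicit Types f g : 'M[quat R]_m -> C.

Definition has_ext f : Prop :=
  exists F, holomorphic_on beta (@half_plane R beta m) F /\
    forall S, posdef beta S -> F (complexify S 0) = f S.

(** The default value of [holo_ext] is 0. *)
Lemma holo_ext_ex f Sigma : holo_ext beta f Sigma != 0 -> has_ext f.
Proof.
rewrite /holo_ext; case: xgetP => [F _ [h1 h2] _|]; first by exists F.
by move=> _; rewrite eqxx.
Qed.

Lemma holo_extE f A : posdef beta A ->
  has_ext f -> holo_ext beta f (complexify A 0) = f A.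
Proof.
move=> pA [F [h1 h2]]; rewrite /holo_ext.
by case: xgetP => [F' _ [_ h]|/(_ F)[]//]; exact: h.
Qed.

Lemma holo_ext_mul f g h :
  (forall S, posdef beta S -> h S = f S * g S) ->
  has_ext f -> has_ext g -> has_ext h.
Proof.
move=> hE [F [hF FE]] [F' [hF' FE']]; exists (fun Z => F Z * F' Z); split.
  by move=> z Dz; apply: (differentiableM (hF z Dz) (hF' z Dz)).
by move=> S pS; rewrite FE// FE'// hE.
Qed.

End HoloExt.
End Complexification.

(** * The joint law of the normalised matrix and the sum *)

Lemma measurable_mem_set d (T : measurableType d) (E : Type) (A : set E)
    (f : T -> E) :
  measurable (f @^-1` A) -> measurable_fun setT (fun t => f t \in A).
Proof.
move=> mA; apply: (@measurable_fun_bool _ _ _ _ true) => //.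
rewrite setTI (_ : _ @^-1` _ = f @^-1` A)//.
by apply/seteqP; split=> t /= h; [exact: set_mem|exact: mem_set].
Qed.

Lemma indic_preimageI (R : realType) (T U V : Type) (f : T -> U) (g : T -> V)
    (A : set U) (B : set V) (t : T) :
  \1_(f @^-1` A `&` g @^-1` B) t = \1_A (f t) * \1_B (g t) :> R.
Proof.
rewrite !indicE in_setI.
have -> : (t \in f @^-1` A) = (f t \in A).
  by apply/idP/idP => h; [apply: mem_set; exact: (set_mem h)|apply: mem_set; exact: (set_mem h)].
have -> : (t \in g @^-1` B) = (g t \in B).
  by apply/idP/idP => h; [apply: mem_set; exact: (set_mem h)|apply: mem_set; exact: (set_mem h)].
by case: (f t \in A); rewrite ?mul1r ?mul0r.
Qed.

Section Split.
Variables (R : realType) (beta : nat).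
Hypothesis hbeta : beta \in [:: 1%N; 2%N; 4%N].
Variable n : nat.
Local Notation m := n.+1.
Local Notation mat := 'M[quat R]_m.
Local Notation mu := (@herm_measure R beta m).
Local Notation pd := (posdef beta (m := m)).

Lemma measurable_pd : measurable (pd : set mat).
Proof. exact: (measurable_posdef hbeta (@measurable_id _ mat setT)). Qed.

Lemma measurable_unit_interval : measurable (unit_interval beta (n := n) : set mat).
Proof.
apply: measurableI; first exact: measurable_pd.
apply: (measurable_posdef hbeta (f := fun S : mat => 1%:M - S)).
apply: measurable_addmx; first exact: measurable_cst.
by apply: measurable_oppmx; exact: measurable_id.
Qed.

(** Off the cone the Cholesky factor is the identity by convention, so the
    congruence does nothing. *)
Definition normalize (p : mat * mat) : mat :=
  if p.2 \in pd then conjtrq (invchol p.2) *m p.1 *m invchol p.2 else p.1.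

Lemma measurable_in_pd d (T : measurableType d) (f : T -> mat) :
  measurable_fun setT f -> measurable_fun setT (fun t => f t \in pd).
Proof.
move=> mf; apply: measurable_mem_set; exact: (measurable_posdef hbeta mf).
Qed.

Lemma measurable_normalize : measurable_fun setT normalize.
Proof.
apply: measurable_fun_ifT.
- by apply: measurable_in_pd; exact: measurable_snd.
- have mi : measurable_fun setT (fun p : mat * mat => invchol p.2).
    by apply: measurable_invchol; exact: measurable_snd.
  apply: measurable_mulmx => //; apply: measurable_mulmx.
    exact: measurable_conjtrq.
  exact: measurable_fst.
- exact: measurable_fst.
Qed.

Variable ell : mat -> R.
Hypothesis mell : measurable_fun setT ell.

(** The kernel is extended by 0 to all matrices, so that its integrals run over
    the whole space. *)
Definition expker (C al : R) (kappa : 'rV[R]_m) (X : mat) : R :=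
  if X \in pd then C * expR (- ell X) * powker beta al kappa X else 0.

Lemma expkerE C al kappa X : pd X ->
  expker C al kappa X = C * expR (- ell X) * powker beta al kappa X.
Proof. by move=> pX; rewrite /expker (mem_set pX). Qed.

Lemma expker_out C al kappa X : ~ pd X -> expker C al kappa X = 0.
Proof. by move=> pX; rewrite /expker memNset. Qed.

Lemma expker_ge0 C al kappa X : 0 <= C -> 0 <= expker C al kappa X.
Proof.
move=> C0; rewrite /expker; case: ifPn => // /set_mem pX.
apply: mulr_ge0; last exact/ltW/(powker_gt0 hbeta).
by apply: mulr_ge0 => //; exact: expR_ge0.
Qed.

Lemma measurable_expker C al kappa d (T : measurableType d) (f : T -> mat) :
  measurable_fun setT f -> measurable_fun setT (fun t => expker C al kappa (f t)).
Proof.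
move=> mf.
rewrite (_ : (fun t => _) = fun t => if f t \in pd
    then C * expR (- ell (f t)) * powkerT al kappa (f t) else 0); last first.
  apply/funext => t; rewrite /expker; case: ifPn => // /set_mem pX.
  by rewrite powkerTE.
apply: measurable_fun_ifT => //; first exact: measurable_in_pd.
apply: measurable_funM; last exact: measurable_powkerT.
apply: measurable_funM => //.
apply: (@measurableT_comp _ _ _ _ _ _ (@expR R) setT) => //.
apply: measurable_funN.
exact: (measurableT_comp mell mf).
Qed.

Definition betaker (al : R) (kappa : 'rV[R]_m) (be : R) (tau : 'rV[R]_m) (S : mat) : R :=
  if S \in unit_interval beta (n := n)
  then powker beta al kappa S * powker beta be tau (1%:M - S) else 0.

Lemma betakerE al kappa be tau S : pd S -> pd (1%:M - S) ->
  betaker al kappa be tau S =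
  powker beta al kappa S * powker beta be tau (1%:M - S).
Proof. by move=> p1 p2; rewrite /betaker mem_set. Qed.

Lemma betaker_out al kappa be tau S : ~ (pd S /\ pd (1%:M - S)) ->
  betaker al kappa be tau S = 0.
Proof. by move=> p1; rewrite /betaker memNset. Qed.

Lemma betaker_ge0 al kappa be tau S : 0 <= betaker al kappa be tau S.
Proof.
rewrite /betaker; case: ifPn => // /set_mem[p1 p2].
by apply: mulr_ge0; exact/ltW/(powker_gt0 hbeta).
Qed.

Lemma measurable_betaker al kappa be tau :
  measurable_fun setT (betaker al kappa be tau).
Proof.
have m1 : measurable_fun setT (fun S : mat => 1%:M - S).
  apply: measurable_addmx; first exact: measurable_cst.
  by apply: measurable_oppmx; exact: measurable_id.
rewrite (_ : betaker _ _ _ _ = fun S => if S \in unit_interval beta (n := n)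
    then powkerT al kappa S * powkerT be tau (1%:M - S) else 0); last first.
  apply/funext => S; rewrite /betaker; case: ifPn => // /set_mem[p1 p2].
  by rewrite !powkerTE.
apply: measurable_fun_ifT => //.
  by apply: (measurable_mem_set (f := id)); exact: measurable_unit_interval.
apply: measurable_funM; last exact: measurable_powkerT.
by apply: measurable_powkerT; exact: measurable_id.
Qed.

Hypothesis ellD : forall X Y, ell (X + Y) = ell X + ell Y.

Variables (al be : R) (kappa tau : 'rV[R]_m).
Variables (C1 C2 : R).
Hypotheses (C10 : 0 <= C1) (C20 : 0 <= C2).
Local Notation k1 := (expker C1 al kappa).
Local Notation k2 := (expker C2 be tau).
Local Notation p := (rdim R beta n).

(** The product of the two densities at x = U* S U and y - x = U* (1 - S) U, for
    y = U* U, separates into a function of S and a function of y. *)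
Lemma product_kernel (U S : mat) : uptri beta U ->
  let y := conjtrq U *m U in
  k1 (conjtrq U *m S *m U) * k2 (y - conjtrq U *m S *m U) =
  betaker al kappa be tau S *
  (C1 * C2 * expR (- ell y) *
    (powker beta al kappa y * powker beta be tau y)).
Proof.
move=> Ut y; have [V [Vt UV VU]] := uptri_inv hbeta Ut.
have [Ub _ _] := Ut; have [Vb _ _] := Vt.
have back X : X = conjtrq V *m (conjtrq U *m X *m U) *m V.
  by rewrite congr_cancel.
have pdE X : pd (conjtrq U *m X *m U) <-> pd X.
  split=> h; last exact: (posdef_congr hbeta Ub VU).
  by rewrite (back X); apply: (posdef_congr hbeta Vb UV).
have yE : y - conjtrq U *m S *m U = conjtrq U *m (1%:M - S) *m U.
  by rewrite mulmxBr mulmxBl mulmx1.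
rewrite yE.
have [h1|h1] := pselect (pd S); last first.
  have e1 : ~ pd (conjtrq U *m S *m U) := fun h => h1 ((pdE S).1 h).
  have e2 : ~ (pd S /\ pd (1%:M - S)) := fun h => h1 h.1.
  by rewrite (expker_out C1 al kappa e1) (betaker_out al kappa be tau e2) !mul0r.
have [h2|h2] := pselect (pd (1%:M - S)); last first.
  have e1 : ~ pd (conjtrq U *m (1%:M - S) *m U) := fun h => h2 ((pdE _).1 h).
  have e2 : ~ (pd S /\ pd (1%:M - S)) := fun h => h2 h.2.
  by rewrite (expker_out C2 be tau e1) (betaker_out al kappa be tau e2) mul0r mulr0.
have h1' := (pdE _).2 h1; have h2' := (pdE _).2 h2.
rewrite (betakerE al kappa be tau h1 h2) (expkerE C1 al kappa h1') (expkerE C2 be tau h2').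
have -> : ell y = ell (conjtrq U *m S *m U) + ell (conjtrq U *m (1%:M - S) *m U).
  by rewrite -ellD -yE addrC subrK.
rewrite (powker_congr hbeta al kappa h1 Ut) (powker_congr hbeta be tau h2 Ut).
rewrite opprD expRD.
have rearrange (a b e1 e2 p1 p2 q1 q2 : R) :
    a * e1 * (p1 * q1) * (b * e2 * (p2 * q2)) =
    p1 * p2 * (a * b * (e1 * e2) * (q1 * q2)) by ring.
exact: rearrange.
Qed.

Local Open Scope ereal_scope.

Context d (T : measurableType d) (P : probability T R).
Variables X1 X2 : T -> mat.
Hypotheses (mX1 : measurable_fun setT X1) (mX2 : measurable_fun setT X2).
Hypothesis P1 : forall A, measurable A ->
  P (X1 @^-1` A) = \int[mu]_(x in A) (k1 x)%:E.
Hypothesis P2 : forall A, measurable A ->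
  P (X2 @^-1` A) = \int[mu]_(x in A) (k2 x)%:E.
Hypothesis ind : forall A B, measurable A -> measurable B ->
  P (X1 @^-1` A `&` X2 @^-1` B) = P (X1 @^-1` A) * P (X2 @^-1` B).

(** The law of X1 and X2 is integrated over x and y = x + (y - x) by a
    translation; Tonelli puts the integral over y outside, and for each y the
    congruence by its Cholesky factor produces the beta kernel. *)
Lemma law_split (A B : set mat) : measurable A -> measurable B ->
  P [set w | A (normalize (X1 w, X1 w + X2 w)%R) /\ B (X1 w + X2 w)%R] =
  (\int[mu]_(y in B) (expker (C1 * C2) (p + (al + be)) (kappa + tau) y)%:E) *
  (\int[mu]_(S in A) (betaker al kappa be tau S)%:E).
Proof.
move=> mA mB.
have mnp : measurable_fun setT (fun q : mat * mat => normalize q).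
  exact: measurable_normalize.
have mk1 := measurable_expker C1 al kappa (@measurable_id _ mat setT).
have mk2 := measurable_expker C2 be tau (@measurable_id _ mat setT).
have k10 x : (0 <= k1 x)%R by exact: expker_ge0.
have k20 x : (0 <= k2 x)%R by exact: expker_ge0.
(* the integrand in the variables x and y *)
pose phi (q : mat * mat) : R :=
  (\1_A (normalize q) * \1_B q.2 * k1 q.1 * k2 (q.2 - q.1))%R.
have mdiff : measurable_fun setT (fun q : mat * mat => q.2 - q.1)%R.
  apply: measurable_addmx; first exact: measurable_snd.
  by apply: measurable_oppmx; exact: measurable_fst.
have mphi : measurable_fun setT phi.
  apply: measurable_funM; last exact: measurable_expker.
  apply: measurable_funM; last by apply: measurable_expker; exact: measurable_fst.
  apply: measurable_funM.
    by apply: (measurableT_comp _ mnp); exact: measurable_indic.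
  by apply: (measurableT_comp _ measurable_snd); exact: measurable_indic.
have phi0 q : (0 <= phi q)%R by rewrite !mulr_ge0.
have mphiE : measurable_fun setT (EFin \o phi) by exact/measurable_EFinP.
pose normsum (q : mat * mat) : mat := normalize (q.1, q.1 + q.2)%R.
pose sum (q : mat * mat) : mat := (q.1 + q.2)%R.
pose G : set (mat * mat) := normsum @^-1` A `&` sum @^-1` B.
have madd : measurable_fun setT (fun q : mat * mat => q.1 + q.2)%R.
  by apply: measurable_addmx; [exact: measurable_fst|exact: measurable_snd].
have mG : measurable G.
  apply: measurableI; last by rewrite -[X in measurable X]setTI; exact: madd.
  rewrite -[X in measurable X]setTI; apply: (measurableT_comp mnp) => //.
  by apply: measurable_fun_pair => //; exact: measurable_fst.
transitivity (\int[mu]_x \int[mu]_y (phi (x, y))%:E).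
  rewrite (@joint_law _ _ _ P _ _ mu X1 X2 k1 k2 mX1 mX2 mk1 mk2 k10 k20 P1 P2 ind G mG).
  apply: eq_integral => x _.
  have [/set_mem px|px] := boolP (x \in pd); last first.
    rewrite {2}/expker (negbTE px) mule0.
    rewrite integral0_eq// => y _.
    by rewrite /phi /= {1}/expker (negbTE px) mulr0 mul0r.
  have mx : measurable_fun setT (fun y : mat => (phi (x, y))%:E).
    exact: (measurableT_comp mphiE (@pair1_measurable _ _ mat mat x)).
  have tr := integral_herm_translation hbeta px.1 mx (fun y => phi0 _).
  apply: (eq_trans _ tr); rewrite [LHS]muleC.
  have mGk : measurable_fun setT (fun y : mat => (\1_G (x, y))%:E * (k2 y)%:E).
    apply: emeasurable_funM; last exact/measurable_EFinP.
    apply/measurable_EFinP.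
    apply: (measurableT_comp (measurable_indic mG)).
    exact: (@pair1_measurable _ _ mat mat x).
  have Gk0 y : setT y -> 0 <= (\1_G (x, y))%:E * (k2 y)%:E.
    by move=> _; rewrite -EFinM lee_fin mulr_ge0.
  have k1x : 0 <= (k1 x)%:E by rewrite lee_fin.
  apply: (eq_trans (esym (ge0_integralZl mu measurableT mGk Gk0 k1x))).
  apply: eq_integral => y _.
  rewrite -!EFinM; congr (_%:E).
  rewrite /G indic_preimageI /phi /normsum /sum /= addrK (addrC y x).
  have rearrange (i1 i2 c1 c2 : R) : (c1 * (i1 * i2 * c2) = i1 * i2 * c1 * c2)%R.
    by ring.
  exact: rearrange.
rewrite (fubini_tonelli (fun q => (phi q)%:E) mphiE phi0)//.
have mbk := measurable_betaker al kappa be tau.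
have bk0 := betaker_ge0 al kappa be tau.
set IA := \int[mu]_(S in A) _.
have IA0 : 0 <= IA by apply: integral_ge0 => S _; rewrite lee_fin.
have mexp := measurable_expker (C1 * C2) (p + (al + be)) (kappa + tau)
  (@measurable_id _ mat setT).
have exp0 y : (0 <= expker (C1 * C2) (p + (al + be)) (kappa + tau) y)%R.
  by apply: expker_ge0; exact: mulr_ge0.
rewrite muleC -ge0_integralZl//; last 2 first.
- by apply: measurable_funTS; exact/measurable_EFinP.
- by move=> y _; rewrite lee_fin.
rewrite [RHS]integral_mkcond; apply: eq_integral => y _.
rewrite patchE.
have my : measurable_fun setT (fun x : mat => (phi (x, y))%:E).
  exact: (measurableT_comp mphiE (@pair2_measurable _ _ mat mat y)).
case: ifPn => [/set_mem yB|yB]; last first.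
  rewrite integral0_eq// => x _.
  by rewrite /phi /= [\1_B y]indicE (negbTE yB) mulr0 !mul0r.
have [py|py] := pselect (pd y); last first.
  rewrite (expker_out _ _ _ py) mule0 integral0_eq// => x _.
  rewrite /phi /=.
  have [h1|h1] := pselect (pd x); last first.
    by rewrite (expker_out C1 al kappa h1) mulr0 mul0r.
  have h2 : ~ pd (y - x)%R.
    by move=> h2; apply: py; rewrite -(subrK x y); exact: posdefD.
  by rewrite (expker_out C2 be tau h2) mulr0.
have [hy pvy] := (posdefP hbeta y).1 py.
have [Ut yE UV VU _] := cholP hbeta hy pvy.
have cv := integral_congr hbeta Ut my (fun x => phi0 _).
rewrite -yE in cv; apply: (eq_trans cv).
rewrite (expkerE _ _ _ py) [RHS]muleC.
pose bE (S : mat) := (betaker al kappa be tau S)%:E.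
have mbE : measurable_fun setT bE by apply/measurable_EFinP; exact: mbk.
have mA' : measurable_fun setT (bE \_ A).
  exact: (measurable_restrictT bE mA).1 (measurable_funTS mbE).
have A0 S : setT S -> 0 <= (bE \_ A) S.
  by move=> _; rewrite patchE; case: ifP => _ //; rewrite lee_fin.
have c0 : 0 <= (C1 * C2 * expR (- ell y) *
    powker beta (p + (al + be)) (kappa + tau) y)%:E.
  rewrite lee_fin; apply: mulr_ge0; last exact/ltW/(powker_gt0 hbeta).
  by apply: mulr_ge0; [exact: mulr_ge0|exact: expR_ge0].
rewrite /IA [X in _ = _ * X]integral_mkcond.
apply: (eq_trans _ (ge0_integralZl mu measurableT mA' A0 c0)).
have mc : measurable_fun setT (fun S : mat => (phi (conjtrq (chol y) *m S *m chol y, y)%R)%:E).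
  apply: (measurableT_comp my); apply: measurable_mulmx; last exact: measurable_cst.
  apply: measurable_mulmx; first exact: measurable_cst.
  exact: measurable_id.
have h0 : 0 <= (hdet beta y `^ p)%:E by rewrite lee_fin powR_ge0.
apply: (eq_trans (esym (ge0_integralZl mu measurableT mc (fun S _ => phi0 _) h0))).
apply: eq_integral => S _.
have nS : normalize (conjtrq (chol y) *m S *m chol y, y)%R = S.
  by rewrite /normalize /= (mem_set py); exact: congr_cancel.
rewrite /phi nS patchE /= indicE [\1_B y]indicE (mem_set yB) mulr1.
case: ifPn => SA; last by rewrite !mul0r mule0 mule0.
rewrite mul1r.
have := product_kernel S Ut; rewrite /= -yE => ->.
rewrite -!EFinM; congr (_%:E).
rewrite (powkerM hbeta al be kappa tau py).
rewrite -(powker_hdet hbeta (al + be) p (kappa + tau) py).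
have rearrange (a b c e q : R) : (a * (b * (c * e * q)) = c * e * (a * q) * b)%R.
  by ring.
exact: rearrange.
Qed.

End Split.

(** * The parameters are real *)

Lemma sclmx_congr (K : comNzRingType) m (c : K) (X : 'M[quat K]_m) :
  conjtrq ((sclq c)%:M) *m X *m (sclq c)%:M = (sclq (c * c))%:M *m X.
Proof.
by rewrite conjtrq_scl -sclmxC mulmxA -scalar_mxM -(rmorphM (@sclq K)).
Qed.

Lemma retr_sclmx (K : comNzRingType) m p (c : K) (A : 'M[quat K]_(m, p)) B :
  retr (A *m ((sclq c)%:M *m B)) = c * retr (A *m B).
Proof.
have -> : A *m ((sclq c)%:M *m B) = (sclq c)%:M *m (A *m B).
  by rewrite mulmxA -sclmxC -mulmxA.
rewrite /retr /mxtrace !summxE mulr_sumr.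
by apply: eq_bigr => i _; rewrite mul_sclE sclq_mulE.
Qed.

Lemma emb_sclmx (R : realType) m (c : R) :
  emb ((sclq c)%:M : 'M[quat R]_m) = (sclq c%:C%C)%:M.
Proof.
apply/matrixP => i j; rewrite embE !mxE.
case: eqP => _; first by rewrite !mulr1n; exact: qcomplex_scl.
by rewrite !mulr0n raddf0.
Qed.

Lemma pos_ratio (R : realType) (z w : R[i]) (q q' : R) : z != 0 -> w != 0 ->
  0 < q -> 0 < q' -> 0 <= z * (q%:C)%C -> 0 <= z * w * (q'%:C)%C -> 0 < w.
Proof.
move=> z0 w0 q0 q'0.
have qc : 0 < (q%:C)%C :> R[i] by rewrite ltcR.
have qc' : 0 < (q'%:C)%C :> R[i] by rewrite ltcR.
rewrite (pmulr_lge0 _ qc) (pmulr_lge0 _ qc') => z1 zw1.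
have zp : 0 < z by rewrite lt_neqAle eq_sym z0.
by rewrite -(pmulr_rgt0 _ zp) lt_neqAle eq_sym mulf_neq0.
Qed.

Section RealParameters.
Variables (R : realType) (beta : nat).
Hypothesis hbeta : beta \in [:: 1%N; 2%N; 4%N].
Variable n : nat.
Local Notation m := n.+1.
Local Notation mat := 'M[quat R]_m.
Local Notation mu := (lebesgue_herm R beta m).
Local Notation pd := (posdef beta (m := m)).
Local Notation p := (rdim R beta n).
Local Notation sc c := ((@sclq R c)%:M).
Local Open Scope complex_scope.
Notation ImC := complex.Im.
Local Notation C := R[i].

Lemma dim_ratioE : dim_ratio R beta n = p%:C.
Proof. by rewrite /dim_ratio /rdim rmorphD rmorph1 !rmorphM fmorphV !rmorph_nat. Qed.

Lemma hdet_scale (t : R) (X : mat) : 0 < t -> pd X ->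
  hdet beta (sc t *m X) = hdet beta X * t ^+ m /\ pd (sc t *m X).
Proof.
move=> t0 pX; have q0 : 0 < Num.sqrt t by rewrite sqrtr_gt0.
have Ut := @uptri_sc R beta hbeta m _ q0.
have -> : sc t *m X = conjtrq (sc (Num.sqrt t)) *m X *m sc (Num.sqrt t).
  by rewrite sclmx_congr -expr2 sqr_sqrtr// ltW.
split; last first.
  have [V [_ UV VU]] := uptri_inv hbeta Ut; have [Ub _ _] := Ut.
  exact: (posdef_congr hbeta Ub VU).
rewrite (hdet_congr hbeta pX Ut); congr (_ * _).
under eq_bigr do rewrite dg_sc.
by rewrite prodr_const card_ord -exprM mulnC exprM sqr_sqrtr// ltW.
Qed.

Lemma retr_scale (M : 'M[quat C]_m) (t : R) (X : mat) :
  retr (M *m complexify (sc t *m X) 0) = t%:C * retr (M *m complexify X 0).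
Proof.
rewrite !complexify0 embM.
rewrite emb_sclmx; exact: retr_sclmx.
Qed.

(** On the ray t X the quotient of the densities at t X and X is positive, and up to
    a positive factor it is [cexp] of an affine function of t plus a multiple of
    ln t. *)
Lemma riesz_phase (D : C) (M : 'M[quat C]_m) (a : C) (kappa : 'rV[R]_m) :
  D != 0 ->
  (forall X, pd X -> 0 <= D * cexp (- (beta%:R * retr (M *m complexify X 0))) *
     cpow (hdet beta X) (a - dim_ratio R beta n) * (qpow beta kappa X)%:C) ->
  ImC a = 0 /\ forall X, pd X -> ImC (retr (M *m complexify X 0)) = 0.
Proof.
move=> D0 H.
suff K X : pd X -> ImC a = 0 /\ ImC (retr (M *m complexify X 0)) = 0.
  split; first by have [] := K _ (posdef1 R hbeta m).
  by move=> X pX; have [] := K X pX.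
move=> pX; set z := retr (M *m complexify X 0).
pose a' := a - dim_ratio R beta n.
have Ia' : ImC a' = ImC a by rewrite /a' dim_ratioE raddfB /= subr0.
have h0 := hdet_gt0 hbeta pX.
(* logarithm of the quotient of the densities at t X and at X *)
pose w (t : R) : C := - (beta%:R * ((t - 1)%:C * z)) + a' * (m%:R * ln t)%:C.
have Iw t : ImC (w t) = (- (beta%:R * ImC z)) * (t - 1) + (m%:R * ImC a) * ln t.
  rewrite /w -Ia' -(rmorph_nat (real_complex R) beta).
  have G (u v : C) (b l : R) : ImC (- (b%:C * ((t - 1)%:C * u)) + v * (m%:R * l)%:C) =
      (- (b * ImC u)) * (t - 1) + (m%:R * ImC v) * l.
    by case: u v => [u1 u2] [v1 v2] /=; ring.
  exact: G.
have pos t : 0 < t -> 0 < cexp (w t).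
  move=> t0; have [ht pt] := hdet_scale t0 pX.
  have g1 := H _ pX; have gt := H _ pt.
  rewrite retr_scale -/z ht in gt; rewrite -/z in g1.
  have q1 := qpow_gt0 hbeta kappa pX; have qt := qpow_gt0 hbeta kappa pt.
  set E1 := D * cexp (- (beta%:R * z)) * cpow (hdet beta X) a'.
  have Ene : E1 != 0.
    by apply: mulf_neq0; [apply: mulf_neq0 => //; exact: cexp_neq0|exact: cpow_neq0].
  apply: (pos_ratio Ene (cexp_neq0 _) q1 qt g1).
  suff -> : E1 * cexp (w t) = D * cexp (- (beta%:R * (t%:C * z))) *
    cpow (hdet beta X * t ^+ m) a' by exact: gt.
  have lnE : ln (hdet beta X * t ^+ m) = ln (hdet beta X) + m%:R * ln t.
    by rewrite lnM ?posrE ?exprn_gt0// lnXn// mulr_natl.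
  have rearr (d u v x y z' : C) : u * v * x = y * z' -> d * u * v * x = d * y * z'.
    by move=> h; rewrite -(mulrA d y) -h !mulrA.
  rewrite /E1; apply: rearr; rewrite /cpow lnE.
  rewrite -(cexpD (- _) (a' * _)) -(cexpD (_ + _) (w t)) -(cexpD (- _) (a' * _)).
  congr cexp; rewrite /w.
  have R3 (bb zz aa h' mt t' : C) :
    - (bb * zz) + aa * h' + (- (bb * ((t' - 1) * zz)) + aa * mt) =
    - (bb * (t' * zz)) + aa * (h' + mt) by ring.
  by rewrite rmorphB rmorph1 (rmorphD (real_complex R)); exact: R3.
have [c1 c2] := constant_phase (fun t t0 => etrans (congr1 cos (esym (Iw t))) (cexp_gt0 (pos t t0))).
have b0 : (beta%:R : R) != 0 by rewrite pnatr_eq0 -lt0n (beta_gt0 hbeta).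
split.
  by move/eqP: c2; rewrite mulf_eq0 pnatr_eq0 /= => /eqP.
by move/eqP: c1; rewrite oppr_eq0 mulf_eq0 (negbTE b0) /= => /eqP.
Qed.

End RealParameters.

(** * The gamma function of the cone *)

Section RealKernels.
Variables (R : realType) (beta : nat).
Hypothesis hbeta : beta \in [:: 1%N; 2%N; 4%N].
Variable n : nat.
Local Notation m := n.+1.
Local Notation mat := 'M[quat R]_m.
Local Notation mu := (@herm_measure R beta m).
Local Notation pd := (posdef beta (m := m)).
Local Notation p := (rdim R beta n).
Local Notation sc c := ((@sclq R c)%:M).
Local Open Scope complex_scope.
Notation ImC := complex.Im.
Local Notation C := R[i].

Lemma measurable_retr (B : mat) : measurable_fun setT (fun X : mat => retr (B *m X)).
Proof.
have mB : measurable_fun setT (fun X : mat => B *m X).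
  by apply: measurable_mulmx; [exact: measurable_cst|exact: measurable_id].
rewrite (_ : (fun X => _) = fun X => \sum_i (B *m X) i i 0 0); last first.
  by apply/funext => X; rewrite /retr /mxtrace !summxE.
apply: measurable_sum => i.
by move/measurable_mxP : mB; exact.
Qed.

Lemma cpow_dim (r : R) (X : mat) : pd X ->
  cpow (hdet beta X) (r%:C - dim_ratio R beta n) = (hdet beta X `^ (r - p))%:C.
Proof.
by move=> pX; rewrite dim_ratioE -rmorphB cpow_real// hdet_gt0.
Qed.

Definition gamma_ker (r : R) (kappa : 'rV[R]_m) : mat -> R :=
  expker beta (fun X => retr X) 1 (r - p) kappa.

Lemma integral_gamma_ge0 r kappa : (0 <= \int[mu]_X (gamma_ker r kappa X)%:E)%E.
Proof. by apply: integral_ge0 => X _; rewrite lee_fin; exact: expker_ge0. Qed.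

Lemma gammaR_real (r : R) kappa :
  gammaR beta r%:C kappa = (fine (\int[mu]_X (gamma_ker r kappa X)%:E)%E)%:C.
Proof.
have E (X : mat) : pd X -> cexp (- (retr X)%:C) *
   cpow (hdet beta X) (r%:C - dim_ratio R beta n) * (qpow beta kappa X)%:C =
   (gamma_ker r kappa X)%:C.
  move=> pX; rewrite cpow_dim// -rmorphN cexp_real -!rmorphM /gamma_ker.
  by rewrite (expkerE _ _ _ _ pX) mul1r /powker mulrA.
rewrite /gammaR /cintegral.
apply: (congr2 (@Complex R)).
  rewrite /Rintegral integral_mkcond; congr fine; apply: eq_integral => X _.
  rewrite patchE; case: (pselect (pd X)) => pX.
    by rewrite (mem_set pX) (congr1 (@complex.Re R) (E X pX)).
  by rewrite memNset// /gamma_ker expker_out.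
rewrite /Rintegral integral0_eq// => X pX.
by rewrite (congr1 (@complex.Im R) (E X pX)).
Qed.

Section GammaScale.
Variables (A Ai : mat) (pA : pd A) (AAi : A *m Ai = 1%:M).
Let ell (X : mat) : R := beta%:R * retr (Ai *m X).

Lemma measurable_ell : measurable_fun setT ell.
Proof.
by apply: measurable_funM; [exact: measurable_cst|exact: measurable_retr].
Qed.

Definition scale_const (r : R) (kappa : 'rV[R]_m) : R :=
  hdet beta A `^ r * qpow beta kappa A / beta%:R `^ (r * m%:R + \sum_i kappa 0 i).

Lemma beta_pos : 0 < beta%:R :> R.
Proof. by rewrite ltr0n; exact: (beta_gt0 hbeta). Qed.

Lemma scale_const_gt0 r kappa : 0 < scale_const r kappa.
Proof.
apply: divr_gt0; last exact/powR_gt0/beta_pos.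
by apply: mulr_gt0; [exact/powR_gt0/(hdet_gt0 hbeta)|exact: qpow_gt0].
Qed.

Lemma powker_inv_beta r kappa : powker beta r kappa (sc (beta%:R^-1) : mat) =
  (beta%:R `^ (r * m%:R + \sum_i kappa 0 i))^-1.
Proof.
have b0 := beta_pos; have bi0 : 0 < beta%:R^-1 :> R by rewrite invr_gt0.
rewrite /powker (hdet_sc hbeta _ bi0) (qpow_sc hbeta _ bi0).
rewrite -(powR_mulrn m (ltW bi0)) -powRrM -powRD_pos//.
by rewrite -powR_inv1 ?ltW// -powRrM mulN1r powRN mulrC.
Qed.

(** The congruence by U, the Cholesky factor of A divided by the square root of
    beta, turns ell into the trace, because Ai is the inverse of A. *)
Lemma gamma_scale r kappa :
  (\int[mu]_X (expker beta ell 1 (r - p) kappa X)%:E =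
   (scale_const r kappa)%:E * \int[mu]_X (gamma_ker r kappa X)%:E)%E.
Proof.
have b0 := beta_pos; have bi0 : 0 < beta%:R^-1 :> R by rewrite invr_gt0.
pose s : R := Num.sqrt (beta%:R^-1); have s0 : 0 < s by rewrite sqrtr_gt0.
have ss : s * s = beta%:R^-1 by rewrite -expr2 sqr_sqrtr// ltW.
have [hA pvA] := (posdefP hbeta A).1 pA.
have [Ut AE UV VU _] := cholP hbeta hA pvA.
have St := @uptri_sc R beta hbeta m s s0.
(* U* U = A / beta *)
pose U := chol A *m sc s; have Uu : uptri beta U by exact: uptri_mul.
have [V [Vu UVi VUi]] := uptri_inv hbeta Uu.
have [Ub _ _] := Uu; have [Vb _ _] := Vu.
have UE X : conjtrq U *m X *m U = sc (beta%:R^-1) *m (conjtrq (chol A) *m X *m chol A).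
  rewrite /U conjtrq_mul -ss -sclmx_congr.
  exact: regroup.
have mf := measurable_expker (ell := ell) hbeta measurable_ell 1 (r - p) kappa
  (@measurable_id _ mat setT).
have mfE : measurable_fun setT (fun X : mat => (expker beta ell 1 (r - p) kappa X)%:E).
  exact/measurable_EFinP.
have f0 X : (0 <= (expker beta ell 1 (r - p) kappa X)%:E)%E.
  by rewrite lee_fin; exact: expker_ge0.
have mg : measurable_fun setT (fun X : mat => (gamma_ker r kappa X)%:E).
  have mr : measurable_fun setT (fun X : mat => retr X).
    rewrite (_ : (fun X => _) = fun X => retr (1%:M *m X)).
      exact: measurable_retr.
    by apply/funext => X; rewrite mul1mx.
  apply/measurable_EFinP.
  exact: (measurable_expker hbeta mr 1 (r - p) kappa (@measurable_id _ mat setT)).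
rewrite (integral_congr hbeta Uu mfE f0).
have pU : pd (conjtrq U *m U) by exact: posdef_gram.
have UUE : conjtrq U *m U = conjtrq (sc s) *m A *m sc s.
  rewrite {1}AE /U conjtrq_mul -(mulmxA (conjtrq (sc s)) (conjtrq (chol A))).
  by rewrite (mulmxA (conjtrq (chol A)) (chol A)) mulmxA.
have KE : hdet beta (conjtrq U *m U) `^ p * powker beta (r - p) kappa (conjtrq U *m U) =
    scale_const r kappa.
  rewrite (powker_hdet hbeta)// addrC subrK UUE (powker_congr hbeta)//.
  by rewrite conjtrq_scl sc_mul ss powker_inv_beta.
have lE X : ell (conjtrq U *m X *m U) = retr X.
  rewrite /ell UE retr_sclmx mulrA mulfV ?mul1r ?gt_eqF//.
  have cA : chol A *m Ai = conjtrq (invchol A).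
    apply: (eq_trans (esym (mul1mx _))).
    rewrite -[in LHS]conjtrq1 -[in LHS]UV conjtrq_mul -mulmxA (mulmxA _ (chol A)) -AE.
    by rewrite AAi mulmx1.
  rewrite mulmxA retrC !mulmxA cA -conjtrq_mul UV conjtrq1.
  by rewrite mul1mx.
have f1 X : (expker beta ell 1 (r - p) kappa (conjtrq U *m X *m U))%:E =
   ((powker beta (r - p) kappa (conjtrq U *m U))%:E * (gamma_ker r kappa X)%:E)%E.
  rewrite -EFinM; congr (_%:E); rewrite /gamma_ker.
  have [pX|pX] := pselect (pd X); last first.
    have pX' : ~ pd (conjtrq U *m X *m U).
      move=> h; apply: pX; rewrite -(congr_cancel X UVi).
      exact: (posdef_congr hbeta Vb UVi).
    by rewrite (expker_out ell _ _ _ pX') (expker_out _ _ _ _ pX) mulr0.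
  have pX' : pd (conjtrq U *m X *m U) by exact: (posdef_congr hbeta Ub VUi).
  rewrite (expkerE _ _ _ _ pX) (expkerE _ _ _ _ pX') lE (powker_congr hbeta _ _ pX Uu).
  by rewrite mulrA; exact: mulrC.
under eq_integral do rewrite f1.
rewrite ge0_integralZl//; last 2 first.
- by move=> X _; rewrite lee_fin; exact: expker_ge0.
- by rewrite lee_fin; exact/ltW/(powker_gt0 hbeta).
by rewrite muleA -EFinM KE.
Qed.

End GammaScale.

End RealKernels.

(** * Riesz laws with real parameters *)

Lemma mule_eq1 (R : realType) (x y : \bar R) : (0 <= x)%E -> (0 <= y)%E ->
  (x * y = 1)%E -> exists r s : R, [/\ x = r%:E, y = s%:E & r * s = 1].
Proof.
case: x => [x| |]; case: y => [y| |] //=; rewrite ?lee_fin => x0 y0.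
- by move=> h; exists x, y; split=> //; exact: (EFin_inj h).
- have [->|xp] := eqVneq x 0; first by rewrite mul0e => /eqP; rewrite eqe eq_sym oner_eq0.
  by rewrite gt0_muley ?lte_fin ?lt_neqAle ?x0 ?andbT 1?eq_sym.
- have [->|yp] := eqVneq y 0; first by rewrite mule0 => /eqP; rewrite eqe eq_sym oner_eq0.
  by rewrite gt0_mulye ?lte_fin ?lt_neqAle ?y0 ?andbT 1?eq_sym.
Qed.

Lemma pmule_fin (R : realType) (c r : R) (x : \bar R) : 0 < c -> (0 <= x)%E ->
  (c%:E * x = r%:E)%E -> exists2 y : R, x = y%:E & c * y = r.
Proof.
move=> c0; case: x => [y| |] // x0 h; first by exists y => //; exact: (EFin_inj h).
by move: h; rewrite gt0_muley ?lte_fin.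
Qed.

Lemma expker_scale (R : realType) (beta n : nat) (ell : 'M[quat R]_n.+1 -> R)
    (c al : R) (kappa : 'rV[R]_n.+1) X :
  expker beta ell c al kappa X = c * expker beta ell 1 al kappa X.
Proof.
rewrite /expker; case: (X \in _); last by rewrite mulr0.
by rewrite mul1r -mulrA.
Qed.

Section RieszLaw.
Variables (R : realType) (beta : nat).
Hypothesis hbeta : beta \in [:: 1%N; 2%N; 4%N].
Variable n : nat.
Local Notation m := n.+1.
Local Notation mat := 'M[quat R]_m.
Local Notation mu := (@herm_measure R beta m).
Local Notation pd := (posdef beta (m := m)).
Local Notation p := (rdim R beta n).
Local Open Scope complex_scope.
Notation ImC := complex.Im.
Local Notation C := R[i].

(** The factor of [riesz_density] that does not depend on the matrix. *)
Definition riesz_const (a : C) (kappa : 'rV[R]_m) (Sigma : 'M[quat C]_m) : C :=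
  cpow beta%:R (a * m%:R + (\sum_i kappa 0 i)%:C) /
    (gammaR beta a kappa *
     holo_ext beta (fun S => cpow (hdet beta S) a) Sigma *
     holo_ext beta (fun S => (qpow beta kappa S)%:C) Sigma).

Lemma riesz_densityE0 a kappa Sigma (X : mat) :
  riesz_density beta a kappa Sigma X = riesz_const a kappa Sigma *
    cexp (- (beta%:R * retr (mxinv Sigma *m complexify X 0))) *
    cpow (hdet beta X) (a - dim_ratio R beta n) * (qpow beta kappa X)%:C.
Proof. by []. Qed.

Section OneLaw.
Context d (T : measurableType d) (P : probability T R).

(** Otherwise the density would vanish, but its integral is 1. *)
Lemma riesz_const_neq0 (X : T -> mat) a kappa Sigma :
  riesz beta P X a kappa Sigma -> riesz_const a kappa Sigma != 0.
Proof.
move=> [_ _ _ law]; apply/eqP => D0.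
have := law setT measurableT; rewrite preimage_setT probability_setT.
rewrite integral0_eq => [|S _]; first by move=> /eqP; rewrite eqe oner_eq0.
by rewrite riesz_densityE0 D0 !mul0r.
Qed.

Lemma riesz_real (X : T -> mat) a kappa Sigma :
  riesz beta P X a kappa Sigma ->
  ImC a = 0 /\
  forall X, pd X -> ImC (retr (mxinv Sigma *m complexify X 0)) = 0.
Proof.
move=> hX; have D0 := riesz_const_neq0 hX; case: hX => _ _ pos _.
exact: (riesz_phase hbeta D0 pos).
Qed.

End OneLaw.

Lemma riesz_const_ext a kappa Sigma : riesz_const a kappa Sigma != 0 ->
  has_ext beta (fun S : mat => cpow (hdet beta S) a) /\
  has_ext beta (fun S : mat => (qpow beta kappa S)%:C).
Proof.
rewrite /riesz_const mulf_eq0 invr_eq0 !mulf_eq0 !negb_or => /and3P[_ /andP[_ h1] h2].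
by split; [exact: holo_ext_ex h1|exact: holo_ext_ex h2].
Qed.

Section RealDensity.
Variables (A Ai : mat) (Sigma : 'M[quat C]_m).
Hypotheses (pA : pd A) (AAi : A *m Ai = 1%:M) (SE : Sigma = complexify A 0).
Hypothesis trE :
  forall X, retr (mxinv Sigma *m complexify X 0) = (retr (Ai *m X))%:C.
Let ell (X : mat) : R := beta%:R * retr (Ai *m X).

(** The inverse of the integral of the kernel, as [gamma_scale] computes it. *)
Definition real_const (r : R) (kappa : 'rV[R]_m) : R :=
  (scale_const beta A r kappa * fine (\int[mu]_X (gamma_ker beta r kappa X)%:E)%E)^-1.

Lemma real_const_ge0 r kappa : 0 <= real_const r kappa.
Proof.
rewrite invr_ge0; apply: mulr_ge0; first exact/ltW/(scale_const_gt0 hbeta).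
exact/fine_ge0/(integral_gamma_ge0 hbeta).
Qed.

(** At a point of the cone the holomorphic extensions take the values of the
    functions they extend. *)
Lemma riesz_densityE r kappa X : pd X ->
  has_ext beta (fun S : mat => cpow (hdet beta S) r%:C) ->
  has_ext beta (fun S : mat => (qpow beta kappa S)%:C) ->
  riesz_density beta r%:C kappa Sigma X =
  (expker beta ell (real_const r kappa) (r - p) kappa X)%:C.
Proof.
move=> pX e1 e2; rewrite riesz_densityE0 trE cpow_dim// (expkerE _ _ _ _ pX).
have -> : riesz_const r%:C kappa Sigma = (real_const r kappa)%:C.
  rewrite /riesz_const SE (holo_extE pA e1) (holo_extE pA e2) gammaR_real//.
  have b0 := @beta_pos R beta hbeta.
  have -> : cpow beta%:R (r%:C * m%:R + (\sum_i kappa 0 i)%:C) =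
      (beta%:R `^ (r * m%:R + \sum_i kappa 0 i))%:C.
    by rewrite -cpow_real// rmorphD rmorphM rmorph_nat.
  rewrite cpow_real ?(hdet_gt0 hbeta)// -!rmorphM -fmorphV -rmorphM; congr (_%:C).
  rewrite /real_const /scale_const !invfM invrK; ring.
rewrite -(rmorph_nat (real_complex R) beta) -rmorphM -rmorphN cexp_real.
by rewrite -!rmorphM; congr (_%:C); rewrite /powker /ell !mulrA.
Qed.

Section Law.
Context d (T : measurableType d) (P : probability T R).

Lemma riesz_law (X : T -> mat) r kappa :
  riesz beta P X r%:C kappa Sigma ->
  forall B, measurable B -> P (X @^-1` B) =
    (\int[mu]_(S in B) (expker beta ell (real_const r kappa) (r - p) kappa S)%:E)%E.
Proof.
move=> hX B mB; have [e1 e2] := riesz_const_ext (riesz_const_neq0 hX).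
case: hX => _ _ _ -> //.
rewrite [LHS]integral_mkcond [RHS]integral_mkcond; apply: eq_integral => S _.
rewrite !patchE in_setI.
have [pS|pS] := pselect (pd S).
  by rewrite (mem_set pS) andbT (congr1 (@complex.Re R) (riesz_densityE pS e1 e2)).
by rewrite (memNset pS) andbF (expker_out _ _ _ _ pS); case: ifP.
Qed.

Lemma riesz_of_law (X : T -> mat) r kappa :
  has_ext beta (fun S : mat => cpow (hdet beta S) r%:C) ->
  has_ext beta (fun S : mat => (qpow beta kappa S)%:C) ->
  measurable_fun setT X ->
  (forall B, measurable B -> P (X @^-1` B) =
    (\int[mu]_(S in B) (expker beta ell (real_const r kappa) (r - p) kappa S)%:E)%E) ->
  riesz beta P X r%:C kappa Sigma.
Proof.
move=> e1 e2 mX law; split=> //.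
- apply: (@eq_measurable_fun _ _ _ _ _
    (expker beta ell (real_const r kappa) (r - p) kappa)).
    move=> S /set_mem pS.
    by rewrite (congr1 (@complex.Re R) (riesz_densityE pS e1 e2)).
  apply: measurable_funTS.
  exact: (measurable_expker hbeta (measurable_ell beta Ai) _ _ _ (@measurable_id _ mat setT)).
- move=> S pS; rewrite riesz_densityE// ler0c.
  apply: (expker_ge0 hbeta); exact: real_const_ge0.
- move=> B mB; rewrite law//.
  rewrite [LHS]integral_mkcond [RHS]integral_mkcond; apply: eq_integral => S _.
  rewrite !patchE in_setI.
  have [pS|pS] := pselect (pd S).
    by rewrite (mem_set pS) andbT (congr1 (@complex.Re R) (riesz_densityE pS e1 e2)).
  by rewrite (memNset pS) andbF (expker_out _ _ _ _ pS); case: ifP.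
Qed.

End Law.
End RealDensity.
End RieszLaw.

(** * Independence and the laws of the ratio and the sum *)

Section Normalized.
Variables (R : realType) (beta : nat).
Hypothesis hbeta : beta \in [:: 1%N; 2%N; 4%N].
Variable n : nat.
Local Notation mat := 'M[quat R]_n.+1.

Lemma normalizeE (X Y : mat) :
  mxinv (conjtrq (cholesky beta Y)) *m X *m mxinv (cholesky beta Y) =
  normalize beta (X, Y).
Proof.
rewrite /normalize /=; have [pY|pY] := pselect (posdef beta Y); last first.
  by rewrite memNset// cholesky_junk// conjtrq1 mxinv1 mul1mx mulmx1.
have [hY pvY] := (posdefP hbeta Y).1 pY.
have [_ _ UV VU _] := cholP hbeta hY pvY.
rewrite (mem_set pY) (choleskyE hbeta pY) (mxinv_eq VU UV).
have e1 : conjtrq (invchol Y) *m conjtrq (chol Y) = 1%:M.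
  by rewrite -conjtrq_mul UV; exact: conjtrq1.
have e2 : conjtrq (chol Y) *m conjtrq (invchol Y) = 1%:M.
  by rewrite -conjtrq_mul VU; exact: conjtrq1.
by rewrite (mxinv_eq e1 e2).
Qed.

Local Open Scope complex_scope.

Lemma beta_kernelE (ra rb : R) (kappa tau : 'rV[R]_n.+1) (S : mat) :
  unit_interval beta S ->
  beta_kernel beta ra%:C kappa rb%:C tau S =
  (betaker beta (ra - rdim R beta n) kappa (rb - rdim R beta n) tau S)%:C.
Proof.
move=> [p1 p2]; rewrite /beta_kernel !cpow_dim// (betakerE _ _ _ _ p1 p2).
by rewrite -!rmorphM; congr (_%:C); rewrite /powker !mulrA.
Qed.

Lemma betaR_real (ra rb : R) (kappa tau : 'rV[R]_n.+1) :
  betaR beta ra%:C kappa rb%:C tau =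
  (fine (\int[@herm_measure R beta n.+1]_S
    (betaker beta (ra - rdim R beta n) kappa (rb - rdim R beta n) tau S)%:E)%E)%:C.
Proof.
rewrite /betaR /cintegral; apply: (congr2 (@Complex R)).
  rewrite /Rintegral integral_mkcond; congr fine; apply: eq_integral => X _.
  rewrite patchE; case: (pselect (unit_interval beta X)) => pX.
    by rewrite (mem_set pX) (congr1 (@complex.Re R) (beta_kernelE ra rb kappa tau pX)).
  by rewrite memNset// betaker_out.
rewrite /Rintegral integral0_eq// => X pX.
by rewrite (congr1 (@complex.Im R) (beta_kernelE ra rb kappa tau pX)).
Qed.

End Normalized.

Theorem theorem4p3 (R : realType) (beta : nat)
    (hbeta : beta \in [:: 1%N; 2%N; 4%N]) (n : nat)
    (kappa tau : 'rV[R]_n.+1) (Sigma : 'M[quat R[i]]_n.+1)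
    (hSigma : half_plane beta Sigma) (a b : R[i])
    (ha : n%:R * beta%:R / 2 + kappa 0 ord0 < complex.Re a)
    (hb : n%:R * beta%:R / 2 + tau 0 ord0 < complex.Re b)
    (d : measure_display) (T : measurableType d) (P : probability T R)
    (X1 X2 : T -> 'M[quat R]_n.+1)
    (hX1 : riesz beta P X1 a kappa Sigma)
    (hX2 : riesz beta P X2 b tau Sigma)
    (hind : independent P X1 X2) :
  let Y := fun w : T => X1 w + X2 w in
  let U := fun w : T => cholesky beta (Y w) in
  let S := fun w : T => mxinv (conjtrq (U w)) *m X1 w *m mxinv (U w) in
  [/\ independent P S Y,
      beta_riesz beta P S a kappa b tau &
      riesz beta P Y (a + b) (kappa + tau) Sigma].
Proof.
have [Ima tr] := riesz_real hbeta hX1; have [Imb _] := riesz_real hbeta hX2.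
have [A [Ai [pA SE AAi _ trE]]] := real_half_plane hbeta hSigma tr.
have [ra aE] : exists ra, a = (ra%:C)%C.
  by exists (complex.Re a); case: (a) Ima => x y /= ->.
have [rb bE] : exists rb, b = (rb%:C)%C.
  by exists (complex.Re b); case: (b) Imb => x y /= ->.
clear ha hb Ima Imb; subst a b => Y U S.
have [ea1 eq1] := riesz_const_ext (riesz_const_neq0 hX1).
have [ea2 eq2] := riesz_const_ext (riesz_const_neq0 hX2).
have mX1 : measurable_fun setT X1 by case: hX1.
have mX2 : measurable_fun setT X2 by case: hX2.
have law1 := riesz_law hbeta pA SE trE hX1.
have law2 := riesz_law hbeta pA SE trE hX2.
pose p := rdim R beta n; pose mu := @herm_measure R beta n.+1.
pose ell (X : 'M[quat R]_n.+1) : R := beta%:R * retr (Ai *m X).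
have mell : measurable_fun setT ell := measurable_ell beta Ai.
have ellD X X' : ell (X + X') = ell X + ell X'.
  rewrite /ell -mulrDr /retr /mxtrace !summxE -big_split; congr (_ * _).
  by apply: eq_bigr => i _; rewrite mulmxDr addqmxE quat_add0.
pose C1 := real_const beta A ra kappa; pose C2 := real_const beta A rb tau.
have C10 : 0 <= C1 := real_const_ge0 hbeta pA ra kappa.
have C20 : 0 <= C2 := real_const_ge0 hbeta pA rb tau.
have SN w : S w = normalize beta (X1 w, Y w) := normalizeE hbeta (X1 w) (Y w).
pose eY := expker beta ell (C1 * C2) (ra + rb - p) (kappa + tau).
pose bS := betaker beta (ra - p) kappa (rb - p) tau.
have split B D : measurable B -> measurable D ->
    P (S @^-1` B `&` Y @^-1` D) =
    ((\int[mu]_(y in D) (eY y)%:E) * (\int[mu]_(s in B) (bS s)%:E))%E.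
  move=> mB mD; have := law_split hbeta mell ellD C10 C20 mX1 mX2 law1 law2 hind mB mD.
  have -> : p + (ra - p + (rb - p)) = ra + rb - p by ring.
  move=> <-; congr (P _); apply/seteqP; split=> w /=; first by rewrite SN.
  by rewrite SN.
have mY : measurable_fun setT Y by exact: measurable_addmx.
have mS : measurable_fun setT S.
  rewrite (_ : S = fun w => normalize beta (X1 w, Y w)); last exact/funext.
  have mXY := measurable_fun_pair mX1 mY.
  exact: (measurableT_comp (measurable_normalize hbeta (n := n)) mXY).
have bS0 s : 0 <= bS s by exact: betaker_ge0.
have eY0 y : 0 <= eY y by exact: (expker_ge0 hbeta _ _ _ _ (mulr_ge0 C10 C20)).
have mbS : measurable_fun setT (EFin \o bS).
  by apply/measurable_EFinP; exact: measurable_betaker.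
have IB0 : (0 <= \int[mu]_s (bS s)%:E)%E.
  by apply: integral_ge0 => s _; rewrite lee_fin.
have IY0 : (0 <= \int[mu]_y (eY y)%:E)%E.
  by apply: integral_ge0 => y _; exact: eY0.
(* only the product of the two total masses is known so far *)
have I1 : ((\int[mu]_y (eY y)%:E) * (\int[mu]_s (bS s)%:E) = 1)%E.
  by rewrite -split// !preimage_setT setTI; exact: probability_setT.
have [iY [iB [IYE IBE I1']]] := mule_eq1 IY0 IB0 I1.
have lawS B : measurable B ->
    P (S @^-1` B) = (iY%:E * \int[mu]_(s in B) (bS s)%:E)%E.
  by move=> mB; rewrite -IYE -split// preimage_setT setIT.
have lawY D : measurable D ->
    P (Y @^-1` D) = ((\int[mu]_(y in D) (eY y)%:E) * iB%:E)%E.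
  by move=> mD; rewrite -IBE -split// preimage_setT setTI.
have iB0 : iB != 0 by apply/eqP => h; move/eqP: I1'; rewrite h mulr0 eq_sym oner_eq0.
have iYE : iY = iB^-1 by rewrite -[RHS]mul1r -I1' mulfK.
have iBge0 : 0 <= iB by have := IB0; rewrite IBE lee_fin.
have betaRE : betaR beta (ra%:C)%C kappa (rb%:C)%C tau = (iB%:C)%C.
  by rewrite (betaR_real hbeta) (congr1 fine IBE).
split.
- move=> B D mB mD; rewrite split// lawS// lawY//.
  have e1 : (iY%:E * iB%:E = 1)%E by rewrite -EFinM I1'.
  have rearr (x y i j : \bar R) : (i * j = 1 -> y * x = (i * x) * (y * j))%E.
    by move=> ij; rewrite (muleC y j) muleACA ij mul1e muleC.
  exact: rearr.
- split=> //.
  + apply: (@eq_measurable_fun _ _ _ _ _ (fun s => iB^-1 * bS s)).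
      move=> s /set_mem us.
      by rewrite /beta_density (beta_kernelE hbeta _ _ _ _ us) betaRE -fmorphV -rmorphM.
    apply: measurable_funTS; apply: measurable_funM => //.
    exact: measurable_betaker.
  + move=> s us.
    rewrite /beta_density (beta_kernelE hbeta _ _ _ _ us) betaRE -fmorphV -rmorphM.
    by rewrite ler0c mulr_ge0// invr_ge0.
  + move=> B mB; rewrite lawS// iYE.
    have iBi0 : 0 <= iB^-1 by rewrite invr_ge0.
    rewrite -ge0_integralZl//; last 2 first.
    - exact: measurable_funTS.
    - by move=> s _; rewrite lee_fin.
    rewrite [LHS]integral_mkcond [RHS]integral_mkcond; apply: eq_integral => s _.
    rewrite !patchE in_setI.
    have [us|us] := pselect (unit_interval beta s).
      rewrite (mem_set us) andbT /beta_density (beta_kernelE hbeta _ _ _ _ us).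
      by rewrite betaRE -fmorphV -rmorphM.
    by rewrite (memNset us) andbF /bS betaker_out// mule0; case: ifP.
- rewrite -rmorphD.
  have e1 : has_ext beta (fun S : 'M[quat R]_n.+1 => cpow (hdet beta S) (ra + rb)%:C)%C.
    apply: (holo_ext_mul _ ea1 ea2) => X _.
    by rewrite rmorphD cpowD.
  have e2 : has_ext beta (fun S : 'M[quat R]_n.+1 => (qpow beta (kappa + tau) S)%:C)%C.
    apply: (holo_ext_mul _ eq1 eq2) => X pX.
    by rewrite (qpowD hbeta _ _ pX) rmorphM.
  apply: (riesz_of_law hbeta pA SE trE e1 e2 mY) => D mD.
  rewrite lawY//.
  have gE := gamma_scale hbeta pA AAi (ra + rb) (kappa + tau).
  have J0 : (0 <= \int[mu]_X (expker beta ell 1 (ra + rb - p) (kappa + tau) X)%:E)%E.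
    by apply: integral_ge0 => y _; exact: (expker_ge0 hbeta _ _ _ _ ler01).
  have mE : measurable_fun setT (fun X => (expker beta ell 1 (ra + rb - p) (kappa + tau) X)%:E).
    apply/measurable_EFinP.
    exact: (measurable_expker hbeta mell _ _ _ (@measurable_id _ _ setT)).
  have CC0 : 0 <= C1 * C2 := mulr_ge0 C10 C20.
  have IYJ : (iY%:E = (C1 * C2)%:E *
      \int[mu]_X (expker beta ell 1 (ra + rb - p) (kappa + tau) X)%:E)%E.
    rewrite -IYE -ge0_integralZl//; last first.
      by move=> X _; exact: (expker_ge0 hbeta _ _ _ _ ler01).
    by apply: eq_integral => X _; rewrite -EFinM -expker_scale.
  (* iY is nonzero, so neither factor of it vanishes *)
  have C12 : 0 < C1 * C2.
    rewrite lt_neqAle CC0 andbT eq_sym; apply/eqP => h.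
    move: IYJ; rewrite h mul0e => -[iY0]; move: I1'.
    by rewrite iY0 mul0r => /eqP; rewrite eq_sym oner_eq0.
  have [j JE Cj] := pmule_fin C12 J0 (esym IYJ).
  have [g gE' sg] := pmule_fin (scale_const_gt0 hbeta pA (ra + rb) (kappa + tau))
    (integral_gamma_ge0 hbeta (ra + rb) (kappa + tau)) (etrans (esym gE) JE).
  (* both sides are the inverse of j *)
  have cE : real_const beta A (ra + rb) (kappa + tau) = C1 * C2 * iB.
    rewrite /real_const (congr1 fine gE') /= sg.
    have j0 : j != 0.
      apply/eqP => h; move/eqP: I1'.
      by rewrite -Cj h mulr0 mul0r eq_sym oner_eq0.
    apply: (mulIf j0); rewrite mulVf//.
    by rewrite mulrAC Cj I1'.
  rewrite cE -ge0_integralZr//; last 2 first.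
  - by apply/measurable_funTS/measurable_EFinP; exact: (measurable_expker hbeta mell _ _ _ (@measurable_id _ _ setT)).
  - by move=> y _; exact: eY0.
  by apply: eq_integral => y _; rewrite -EFinM /eY expker_scale [in RHS]expker_scale mulrAC.
Qed.
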